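(* For any $\sigma_1<0$, there exists $t_0>0$ such that $\zeta_2(s,s)$ has no zero in $\{s=\sigma+it \mid \sigma_1\le\sigma<0,\ |t|\ge t_0\}$.
   Context: The Euler double zeta-function is $\zeta_2(s_1,s_2)=\sum_{n_1=1}^{\infty}\sum_{n_2=1}^{\infty}\frac{1}{n_1^{s_1}(n_1+n_2)^{s_2}}$, absolutely convergent for $\operatorname{Re}(s_1+s_2)>2$, $\operatorname{Re} s_2>1$, and continued meromorphically to $\mathbb{C}^2$. The function $\zeta_2(s,s)$ of one complex variable $s$ is obtained by putting $s_1=s_2=s$; it is the meromorphic function on $\mathbb{C}$ satisfying $\zeta_2(s,s)=\frac12\left(\zeta(s)^2-\zeta(2s)\right)$, where $\zeta$ is the Riemann zeta-function. Here $\sigma,t$ are real. *)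

(* Defs.v *)
From Stdlib Require Import Reals.
From Coquelicot Require Import Coquelicot.
Open Scope R_scope.
Open Scope C_scope.

Definition Cexp (z : C) : C :=
  (exp (Re z) * cos (Im z), exp (Re z) * sin (Im z))%R.

(* [n^s] with the real logarithm of [n]; only meant for [n >= 1], since
   [ln 0 = 0] makes [ncpow 0 s = 1]. *)
Definition ncpow (n : nat) (s : C) : C := Cexp (s * RtoC (ln (INR n))).

(* The indices start at 0, so the mathematical [n1], [n2] are [S i], [S j]. *)
Definition zeta2_term (s1 s2 : C) (i j : nat) : C :=
  / (ncpow (S i) s1 * ncpow (S i + S j) s2).

(* The iterated sum, inner sum over [n2].  Where the double series converges
   absolutely, the order of summation is irrelevant. *)
Definition is_zeta2_series (s1 s2 l : C) : Prop :=
  exists r : nat -> C,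
    (forall i : nat,
       @is_series C_AbsRing C_NormedModule (zeta2_term s1 s2 i) (r i)) /\
    @is_series C_AbsRing C_NormedModule r l.

Definition analytic_at (f : C -> C) (p : C) : Prop :=
  exists a : nat -> C,
    locally p (fun s : C =>
      @is_pseries C_AbsRing C_NormedModule a (s - p) (f s)).

Definition pole_at (f : C -> C) (p : C) : Prop :=
  exists (m : nat) (g : C -> C),
    (1 <= m)%nat /\ analytic_at g p /\ g p <> 0 /\
    locally' p (fun s : C => f s = g s / (s - p) ^ m).

(* A meromorphic function on [C] is represented by a total function whose
   values at its poles are irrelevant.  Every other point, removable
   singularities included, must be a point of analyticity. *)
Definition meromorphic (f : C -> C) : Prop :=
  forall p : C, analytic_at f p \/ pole_at f p.

(* The clause [analytic_at f p] discards the irrelevant value at a pole. *)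
Definition is_zero_of (f : C -> C) (p : C) : Prop :=
  analytic_at f p /\ f p = 0.

(* [Z] is the function [s |-> zeta_2(s, s)].  On the diagonal the region of
   absolute convergence [Re (s1 + s2) > 2, Re s2 > 1] is [Re s > 1]; by the
   identity theorem [Z] is determined outside its poles. *)
Definition is_zeta2_diag (Z : C -> C) : Prop :=
  meromorphic Z /\
  (forall s : C,
     (2 < Re (s + s))%R -> (1 < Re s)%R -> is_zeta2_series s s (Z s)).

(* Main.v *)
Require Import Defs.
From Stdlib Require Import Reals Lra Lia Factorial Classical_Prop FunctionalExtensionality.
From Coquelicot Require Import Coquelicot.
Local Open Scope R_scope.

(** Let [q s = 1 - 2 ^ (1 - s)] and let [eta s = q s * zeta s] be the
    alternating zeta-function, which is entire.  For [Re s > 1] the double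
    series satisfies [2 Z s = zeta s ^ 2 - zeta (2 s)], so that
    [2 q(s)^2 q(2s) Z(s) = eta(s)^2 q(2s) - eta(2s) q(s)^2], and this persists
    wherever [Z] is analytic ([zeta2_diag_eta], by [identity_theorem]).  A zero
    of [Z] therefore forces [|eta(s)|^2] and [|eta(2s)|] to be comparable.

    For [Re s < 0] they are not.  With [s = - 2 a], the functional equation
    gives [eta(s) = - 2 (2 / pi)^(2 a) P(a) lambda(1 - s)], where
    [P(a) = Gamma(a + 1/2) / (sqrt pi Gamma(- a))] and [lambda] is the zeta
    series over the odd integers.  The quotient [|P(a)|^2 / |P(2 a)|] is at
    least of order [|t|^(1/2)] ([gamma_factor_ratio]), whereas [1 - s] and
    [1 - 2 s] lie to the right of the line of real part one, where [zeta] is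
    bounded from above and from below by powers of [ln |t|] ([zeta_log_bound],
    [zeta_lower_bound]), uniformly up to that line.  For large [|t|] the two
    sides cannot balance ([zero_balance]).

    The continuation of [eta] and its functional equation are obtained together
    from the finite sums of [(-1)^(j-1) h(j)^(-s)], where
    [h(j) = (2 l / pi) sin (pi j / 2 l)] stands in for [j].  These sums are
    entire in [s].  As [l] grows they converge locally uniformly for
    [Re s > -1], after two summations by parts ([sine_sum_right]).  For
    [Re s < 0] they are samples of [sin (pi x)^(2 a)] at equidistant points;
    its Fourier coefficients are explicit products, the alternating signs
    select those of index an odd multiple of [l], and their asymptotics
    [n^(- 2 a - 1)] produce the series [lambda(1 - s)] ([fourier_sine_power],
    [sine_sum_left]).  The two half-planes overlap, so the limit is entire.  The
    gamma factors appear only as limits of products, which is also the form in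
    which they are estimated.

    Holomorphy is expressed by uniform approximation by polynomials on discs:
    sums, products and uniform limits are then immediate, and the identity
    theorem needs only Cauchy's estimate for the coefficients of a polynomial,
    an average over roots of unity ([approx_identity]).

    The lower bound for [zeta] is the classical argument with
    [3 + 4 cos t + cos 2t >= 0], run on the series sieved by the first primes
    instead of the logarithm of an Euler product ([three_four_one]). *)

(** * Moduli and elementary inequalities *)

Lemma C_ext (x y : C) : Re x = Re y -> Im x = Im y -> x = y.
Proof. destruct x, y; simpl; intros; subst; reflexivity. Qed.

Lemma im_le_Cmod (c : C) : Rabs (Im c) <= Cmod c.
Proof. destruct c as [x y]. eapply Rle_trans; [apply Rmax_r | apply Rmax_Cmod]. Qed.

Lemma Cmod_le_Re_Im (z : C) : Cmod z <= Rabs (Re z) + Rabs (Im z).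
Proof.
  destruct z as [x y]; simpl.
  replace (x, y) with (RtoC x + Ci * RtoC y)%C by (apply C_ext; simpl; ring).
  eapply Rle_trans; [apply Cmod_triangle|].
  rewrite Cmod_mult, Cmod_Ci, !Cmod_R; lra.
Qed.

Lemma Cmod_minus_sym (x y : C) : Cmod (x - y) = Cmod (y - x).
Proof. rewrite <- Cmod_opp. f_equal. ring. Qed.

Lemma Cmod_triangle_rev (x y : C) : Cmod x - Cmod y <= Cmod (x - y).
Proof.
  replace x with ((x - y) + y)%C at 1 by ring.
  generalize (Cmod_triangle (x - y) y); lra.
Qed.

Lemma Cmod_triangle_minus (x y : C) : Cmod (x - y) <= Cmod x + Cmod y.
Proof. unfold Cminus. rewrite <- (Cmod_opp y). apply Cmod_triangle. Qed.

Lemma Cmod_real_minus (x y : R) : Cmod (RtoC x - RtoC y) = Rabs (x - y).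
Proof. rewrite <- RtoC_minus. apply Cmod_R. Qed.

Lemma Rdiv_le_of_mult (a b r : R) : 0 < r -> a <= b * r -> a / r <= b.
Proof.
  intros Hr H. apply Rmult_le_reg_r with r; auto.
  replace (a / r * r) with a by (field; lra). auto.
Qed.

Lemma Rinv_le_1 (y : R) : 1 <= y -> / y <= 1.
Proof. intros H. rewrite <- Rinv_1. apply Rinv_le_contravar; lra. Qed.

Lemma exp_monotone (x y : R) : x <= y -> exp x <= exp y.
Proof. intros [H|H]; [left; apply exp_increasing; auto | rewrite H; lra]. Qed.

Lemma ln_nonneg (x : R) : 1 <= x -> 0 <= ln x.
Proof. intros H. rewrite <- ln_1. apply ln_le; lra. Qed.

(** * The complex exponential and complex powers of positive reals *)

Lemma Cexp_plus (x y : C) : Cexp (x + y) = (Cexp x * Cexp y)%C.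
Proof.
  destruct x as [a b], y as [c d]. unfold Cexp; simpl.
  rewrite exp_plus, cos_plus, sin_plus. apply C_ext; simpl; ring.
Qed.

Lemma Cexp_0 : Cexp 0 = 1%C.
Proof. unfold Cexp; simpl. rewrite exp_0, cos_0, sin_0. apply C_ext; simpl; ring. Qed.

Lemma Cmod_Cexp (z : C) : Cmod (Cexp z) = exp (Re z).
Proof.
  unfold Cexp, Cmod; simpl.
  replace (exp (Re z) * cos (Im z) * (exp (Re z) * cos (Im z) * 1)
      + exp (Re z) * sin (Im z) * (exp (Re z) * sin (Im z) * 1))
    with ((exp (Re z)) ^ 2 * ((sin (Im z))² + (cos (Im z))²))
    by (unfold Rsqr; ring).
  rewrite sin2_cos2, Rmult_1_r, sqrt_pow2; [reflexivity | left; apply exp_pos].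
Qed.

Lemma Cexp_neq_0 (z : C) : Cexp z <> 0%C.
Proof. apply Cmod_gt_0. rewrite Cmod_Cexp. apply exp_pos. Qed.

Lemma Cexp_opp (z : C) : Cexp (- z) = (/ Cexp z)%C.
Proof.
  assert (H : (Cexp z * Cexp (- z) = 1)%C).
  { rewrite <- Cexp_plus, Cplus_opp_r. apply Cexp_0. }
  assert (Hz := Cexp_neq_0 z).
  replace (Cexp (- z)) with (/ Cexp z * (Cexp z * Cexp (- z)))%C by (field; auto).
  rewrite H. ring.
Qed.

Lemma Cexp_nat_mult (n : nat) (z : C) : Cexp (RtoC (INR n) * z) = (Cexp z ^ n)%C.
Proof.
  induction n as [|n IH].
  - simpl. rewrite Cmult_0_l. apply Cexp_0.
  - rewrite S_INR, RtoC_plus. simpl.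
    replace ((RtoC (INR n) + 1) * z)%C with (z + RtoC (INR n) * z)%C by ring.
    rewrite Cexp_plus, IH. reflexivity.
Qed.

Lemma Cexp_real (x : R) : Cexp (RtoC x) = RtoC (exp x).
Proof. unfold Cexp; simpl. rewrite cos_0, sin_0. apply C_ext; simpl; ring. Qed.

Definition rpow (x : R) (s : C) : C := Cexp (s * RtoC (ln x)).

Lemma Cmod_rpow (x : R) (s : C) : Cmod (rpow x s) = Rpower x (Re s).
Proof.
  unfold rpow. rewrite Cmod_Cexp. unfold Rpower. f_equal.
  rewrite re_scal_r. reflexivity.
Qed.

Lemma rpow_neq_0 (x : R) (s : C) : rpow x s <> 0%C.
Proof. apply Cexp_neq_0. Qed.

Lemma rpow_plus (x : R) (s t : C) : rpow x (s + t) = (rpow x s * rpow x t)%C.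
Proof. unfold rpow. rewrite <- Cexp_plus. f_equal. ring. Qed.

Lemma rpow_opp (x : R) (s : C) : rpow x (- s) = (/ rpow x s)%C.
Proof. unfold rpow. rewrite <- Cexp_opp. f_equal. ring. Qed.

Lemma rpow_mult_base (x y : R) (s : C) :
  0 < x -> 0 < y -> rpow (x * y) s = (rpow x s * rpow y s)%C.
Proof.
  intros Hx Hy. unfold rpow. rewrite <- Cexp_plus, ln_mult by auto.
  rewrite RtoC_plus. f_equal. ring.
Qed.

Lemma rpow_1_l (s : C) : rpow 1 s = 1%C.
Proof. unfold rpow. rewrite ln_1, Cmult_0_r. apply Cexp_0. Qed.

Lemma rpow_0 (x : R) : rpow x 0 = 1%C.
Proof. unfold rpow. rewrite Cmult_0_l. apply Cexp_0. Qed.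

Lemma rpow_1 (x : R) : 0 < x -> rpow x 1 = RtoC x.
Proof. intros Hx. unfold rpow. rewrite Cmult_1_l, Cexp_real, exp_ln by auto. reflexivity. Qed.

Lemma rpow_real (x y : R) : rpow x (RtoC y) = RtoC (Rpower x y).
Proof. unfold rpow, Rpower. rewrite <- RtoC_mult, Cexp_real. reflexivity. Qed.

Lemma ncpow_rpow (n : nat) (s : C) : ncpow n s = rpow (INR n) s.
Proof. reflexivity. Qed.

(** * Differentiation of complex functions of a real variable *)

(** Coordinatewise, so that differentiation of real functions applies. *)
Definition Cderiv (f : R -> C) (x : R) (l : C) : Prop :=
  is_derive (fun u => Re (f u)) x (Re l) /\ is_derive (fun u => Im (f u)) x (Im l).

Lemma Cderiv_ext (f g : R -> C) (x : R) (l : C) :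
  (forall u, f u = g u) -> Cderiv f x l -> Cderiv g x l.
Proof.
  intros E [H1 H2]; split; [eapply is_derive_ext, H1 | eapply is_derive_ext, H2];
  intros t; simpl; now rewrite E.
Qed.

Lemma Cderiv_const (c : C) (x : R) : Cderiv (fun _ => c) x 0.
Proof. split; simpl; apply is_derive_Reals, derivable_pt_lim_const. Qed.

Lemma Cderiv_plus (f g : R -> C) (x : R) (l m : C) :
  Cderiv f x l -> Cderiv g x m -> Cderiv (fun u => f u + g u)%C x (l + m)%C.
Proof.
  intros [H1 H2] [H3 H4]; split.
  - rewrite re_plus. eapply is_derive_ext;
      [intros t; symmetry; apply re_plus | apply (is_derive_plus (K:=R_AbsRing) (V:=R_NormedModule)); auto].
  - rewrite im_plus. eapply is_derive_ext;
      [intros t; symmetry; apply im_plus | apply (is_derive_plus (K:=R_AbsRing) (V:=R_NormedModule)); auto].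
Qed.

Lemma Cderiv_mult (f g : R -> C) (x : R) (l m : C) :
  Cderiv f x l -> Cderiv g x m ->
  Cderiv (fun u => f u * g u)%C x (l * g x + f x * m)%C.
Proof.
  intros [H1 H2] [H3 H4]. apply is_derive_Reals in H1, H2, H3, H4.
  split; apply is_derive_Reals.
  - replace (Re (l * g x + f x * m)) with
      ((Re l * Re (g x) + Re (f x) * Re m) - (Im l * Im (g x) + Im (f x) * Im m))
      by (rewrite re_plus, !re_mult; ring).
    apply (derivable_pt_lim_minus (fun u => Re (f u) * Re (g u)) (fun u => Im (f u) * Im (g u)));
    [apply (derivable_pt_lim_mult (fun u => Re (f u)) (fun u => Re (g u)))
    |apply (derivable_pt_lim_mult (fun u => Im (f u)) (fun u => Im (g u)))]; auto.
  - replace (Im (l * g x + f x * m)) with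
      ((Re l * Im (g x) + Re (f x) * Im m) + (Im l * Re (g x) + Im (f x) * Re m))
      by (rewrite im_plus, !im_mult; ring).
    apply (derivable_pt_lim_plus (fun u => Re (f u) * Im (g u)) (fun u => Im (f u) * Re (g u)));
    [apply (derivable_pt_lim_mult (fun u => Re (f u)) (fun u => Im (g u)))
    |apply (derivable_pt_lim_mult (fun u => Im (f u)) (fun u => Re (g u)))]; auto.
Qed.

Lemma Cderiv_scal (c : C) (f : R -> C) (x : R) (l : C) :
  Cderiv f x l -> Cderiv (fun u => c * f u)%C x (c * l)%C.
Proof.
  intros H. generalize (Cderiv_mult _ _ x _ _ (Cderiv_const c x) H).
  replace (0 * f x + c * l)%C with (c * l)%C by ring. auto.
Qed.

Lemma Cderiv_minus (f g : R -> C) (x : R) (l m : C) :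
  Cderiv f x l -> Cderiv g x m -> Cderiv (fun u => f u - g u)%C x (l - m)%C.
Proof.
  intros Hf Hg.
  generalize (Cderiv_plus _ _ x _ _ Hf (Cderiv_scal (- (1)) _ _ _ Hg)).
  replace (l + - (1) * m)%C with (l - m)%C by ring.
  apply Cderiv_ext. intros; ring.
Qed.

Lemma Cderiv_real (f : R -> R) (x l : R) :
  is_derive f x l -> Cderiv (fun u => RtoC (f u)) x (RtoC l).
Proof. intros H; split; simpl; auto. apply is_derive_Reals, derivable_pt_lim_const. Qed.

Lemma Cderiv_Cexp (z : C) (g : R -> R) (x l : R) :
  is_derive g x l ->
  Cderiv (fun u => Cexp (z * RtoC (g u))) x (z * RtoC l * Cexp (z * RtoC (g x)))%C.
Proof.
  intros H. destruct z as [a b].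
  assert (Hx : ex_derive g x) by (eexists; eauto).
  assert (HD : Derive (fun x => g x) x = l) by (apply is_derive_unique; auto).
  split; simpl; (auto_derive; [auto|]); rewrite HD; unfold Rminus; ring.
Qed.

Lemma Cderiv_rpow_comp (s : C) (g : R -> R) (x l : R) :
  is_derive g x l -> 0 < g x ->
  Cderiv (fun u => rpow (g u) s) x (s * RtoC l * rpow (g x) (s - 1))%C.
Proof.
  intros H Hg. unfold rpow.
  assert (Hl : is_derive (fun u => ln (g u)) x (l / g x)).
  { assert (HD : Derive (fun x => g x) x = l) by (apply is_derive_unique; auto).
    auto_derive; [split; [eexists; eauto| auto] | rewrite HD; field; lra]. }
  generalize (Cderiv_Cexp s (fun u => ln (g u)) x _ Hl).
  match goal with |- Cderiv _ _ ?a -> Cderiv _ _ ?b => replace b with a; auto end.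
  replace ((s - 1) * RtoC (ln (g x)))%C with (s * RtoC (ln (g x)) + - RtoC (ln (g x)))%C by ring.
  rewrite Cexp_plus, Cexp_opp, Cexp_real, exp_ln, RtoC_div by lra.
  field. intro E; apply RtoC_inj in E; lra.
Qed.

(** The increment of [f] is read off along its own direction, which reduces
    the complex case to monotonicity of a real function. *)
Lemma mean_value_inequality (f f' : R -> C) (g g' : R -> R) (a b : R) :
  a <= b ->
  (forall x, a <= x <= b -> Cderiv f x (f' x)) ->
  (forall x, a <= x <= b -> is_derive g x (g' x)) ->
  (forall x, a <= x <= b -> Cmod (f' x) <= g' x) ->
  Cmod (f b - f a) <= g b - g a.
Proof.
  intros Hab Hf Hg Hb.
  set (v := (f b - f a)%C).
  assert (Hmon : forall h h' : R -> R,
    (forall x, a <= x <= b -> is_derive h x (h' x)) ->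
    (forall x, a <= x <= b -> 0 <= h' x) -> h a <= h b).
  { intros h h' Hd Hp.
    destruct (MVT_gen h a b h') as [c [Hc E]].
    - rewrite Rmin_left, Rmax_right by auto. intros x Hx; apply Hd; lra.
    - rewrite Rmin_left, Rmax_right by auto. intros x Hx.
      apply derivable_continuous_pt. exists (h' x). apply is_derive_Reals, Hd; auto.
    - rewrite Rmin_left, Rmax_right in Hc by auto.
      assert (0 <= h' c * (b - a)) by (apply Rmult_le_pos; [apply Hp; auto | lra]). lra. }
  destruct (Req_dec (Cmod v) 0) as [Hv|Hv].
  - rewrite Hv.
    assert (g a <= g b); [|lra].
    apply (Hmon g g'); auto. intros x Hx.
    eapply Rle_trans; [apply Cmod_ge_0 | apply Hb; auto].
  - assert (Hv0 : 0 < Cmod v) by (generalize (Cmod_ge_0 v); lra).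
    set (h := fun x => g x * Cmod v - (Re v * Re (f x) + Im v * Im (f x))).
    assert (Hh : h a <= h b).
    { apply (Hmon h (fun x => g' x * Cmod v - (Re v * Re (f' x) + Im v * Im (f' x)))).
      - intros x Hx. destruct (Hf x Hx) as [H1 H2]. specialize (Hg x Hx).
        unfold h.
        assert (D1 := is_derive_unique _ _ _ H1).
        assert (D2 := is_derive_unique _ _ _ H2).
        assert (D3 := is_derive_unique _ _ _ Hg).
        apply is_derive_Reals in H1, H2, Hg.
        apply is_derive_Reals.
        apply (derivable_pt_lim_minus (fun x => g x * Cmod v) (fun x => Re v * Re (f x) + Im v * Im (f x))).
        + replace (g' x * Cmod v) with (g' x * Cmod v + g x * 0) by ring.
          apply (derivable_pt_lim_mult g (fun _ => Cmod v)); auto. apply derivable_pt_lim_const.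
        + apply (derivable_pt_lim_plus (fun x => Re v * Re (f x)) (fun x => Im v * Im (f x)));
          [apply (derivable_pt_lim_scal (fun x => Re (f x)))|apply (derivable_pt_lim_scal (fun x => Im (f x)))]; auto.
      - intros x Hx.
        assert (Re v * Re (f' x) + Im v * Im (f' x) <= Cmod v * Cmod (f' x)).
        { rewrite <- (Cmod_conj v), <- Cmod_mult.
          eapply Rle_trans; [|apply re_le_Cmod].
          eapply Rle_trans; [|apply Rle_abs]. right; rewrite re_mult, re_conj, im_conj; ring. }
        specialize (Hb x Hx). nra. }
    assert (E : Re v * Re (f b) + Im v * Im (f b) - (Re v * Re (f a) + Im v * Im (f a)) = Cmod v ^ 2).
    { rewrite Cmod2_alt. unfold v, Cminus. rewrite re_plus, im_plus, re_opp, im_opp. ring. }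
    unfold h in Hh. fold v. nra.
Qed.

Lemma mean_value_bound (f f' : R -> C) (B a b : R) :
  a <= b ->
  (forall x, a <= x <= b -> Cderiv f x (f' x)) ->
  (forall x, a <= x <= b -> Cmod (f' x) <= B) ->
  Cmod (f b - f a) <= B * (b - a).
Proof.
  intros Hab Hf Hb.
  replace (B * (b - a)) with (B * b - B * a) by ring.
  apply (mean_value_inequality f f' (fun x => B * x) (fun _ => B)); auto.
  intros x _. auto_derive; auto. ring.
Qed.

(** * Finite sums *)

Fixpoint csum (u : nat -> C) (n : nat) : C :=
  match n with O => 0%C | S m => (csum u m + u m)%C end.

Fixpoint rsum (u : nat -> R) (n : nat) : R :=
  match n with O => 0 | S m => rsum u m + u m end.

Lemma csum_ext (u v : nat -> C) (n : nat) :
  (forall k, (k < n)%nat -> u k = v k) -> csum u n = csum v n.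
Proof. induction n; intros H; simpl; auto. rewrite IHn, H; auto. Qed.

Lemma csum_plus (u v : nat -> C) (n : nat) :
  csum (fun k => u k + v k)%C n = (csum u n + csum v n)%C.
Proof. induction n; simpl; [ring | rewrite IHn; ring]. Qed.

Lemma csum_minus (u v : nat -> C) (n : nat) :
  csum (fun k => u k - v k)%C n = (csum u n - csum v n)%C.
Proof. induction n; simpl; [ring | rewrite IHn; ring]. Qed.

Lemma csum_scal (c : C) (u : nat -> C) (n : nat) :
  csum (fun k => c * u k)%C n = (c * csum u n)%C.
Proof. induction n; simpl; [ring | rewrite IHn; ring]. Qed.

Lemma rsum_scal (c : R) (u : nat -> R) (n : nat) :
  rsum (fun k => c * u k) n = c * rsum u n.
Proof. induction n; simpl; [ring | rewrite IHn; ring]. Qed.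

Lemma csum_const (c : C) (n : nat) : csum (fun _ => c) n = (RtoC (INR n) * c)%C.
Proof. induction n; [simpl; ring|]. rewrite S_INR, RtoC_plus. simpl. rewrite IHn. ring. Qed.

Lemma csum_zero (u : nat -> C) (n : nat) :
  (forall k, (k < n)%nat -> u k = 0%C) -> csum u n = 0%C.
Proof. intros H. rewrite (csum_ext u (fun _ => 0%C)) by auto. rewrite csum_const. ring. Qed.

Lemma csum_shift (u : nat -> C) (n : nat) :
  csum u (S n) = (u 0%nat + csum (fun k => u (S k)) n)%C.
Proof.
  induction n; [simpl; ring|].
  change (csum u (S (S n))) with (csum u (S n) + u (S n))%C. rewrite IHn. simpl. ring.
Qed.

Lemma csum_add (u : nat -> C) (n m : nat) :
  csum u (n + m) = (csum u n + csum (fun k => u (n + k)%nat) m)%C.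
Proof.
  induction m; simpl.
  - rewrite Nat.add_0_r. ring.
  - rewrite Nat.add_succ_r. simpl. rewrite IHm. ring.
Qed.

Lemma rsum_add (u : nat -> R) (n m : nat) :
  rsum u (n + m) = rsum u n + rsum (fun k => u (n + k)%nat) m.
Proof.
  induction m; simpl.
  - rewrite Nat.add_0_r. ring.
  - rewrite Nat.add_succ_r. simpl. rewrite IHm. ring.
Qed.

Lemma csum_rev (u : nat -> C) (n : nat) :
  csum u n = csum (fun k => u (n - 1 - k)%nat) n.
Proof.
  induction n; auto.
  rewrite (csum_shift (fun k => u (S n - 1 - k)%nat)). simpl csum at 1.
  rewrite IHn. replace (S n - 1 - 0)%nat with n by lia. rewrite Cplus_comm. f_equal.
  apply csum_ext. intros k Hk. f_equal. lia.
Qed.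

Lemma csum_exchange (u : nat -> nat -> C) (n m : nat) :
  csum (fun i => csum (fun j => u i j) m) n = csum (fun j => csum (fun i => u i j) n) m.
Proof.
  induction n; simpl.
  - symmetry. apply csum_zero. auto.
  - rewrite IHn. rewrite <- csum_plus. reflexivity.
Qed.

Lemma csum_single (u : nat -> C) (n k : nat) :
  (k < n)%nat -> (forall j, (j < n)%nat -> j <> k -> u j = 0%C) -> csum u n = u k.
Proof.
  induction n; intros Hk H; [lia|]. simpl.
  destruct (Nat.eq_dec k n) as [->|Hne].
  - rewrite csum_zero. { ring. } intros j Hj. apply H; lia.
  - rewrite IHn by (try lia; intros; apply H; lia).
    rewrite (H n) by lia. ring.
Qed.

Lemma csum_RtoC (u : nat -> R) (n : nat) : csum (fun k => RtoC (u k)) n = RtoC (rsum u n).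
Proof. induction n; simpl; auto. rewrite IHn, RtoC_plus. reflexivity. Qed.

Lemma Cmod_csum_le (u : nat -> C) (M : nat -> R) (n : nat) :
  (forall k, (k < n)%nat -> Cmod (u k) <= M k) -> Cmod (csum u n) <= rsum M n.
Proof.
  induction n; intros H; simpl.
  - rewrite Cmod_0; lra.
  - eapply Rle_trans; [apply Cmod_triangle|].
    apply Rplus_le_compat; auto.
Qed.

Lemma rsum_le (u v : nat -> R) (n : nat) :
  (forall k, (k < n)%nat -> u k <= v k) -> rsum u n <= rsum v n.
Proof. induction n; intros H; simpl; [lra|]. apply Rplus_le_compat; auto. Qed.

Lemma rsum_nonneg (u : nat -> R) (n : nat) :
  (forall k, (k < n)%nat -> 0 <= u k) -> 0 <= rsum u n.
Proof. induction n; intros H; simpl; [lra|]. apply Rplus_le_le_0_compat; auto. Qed.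

Lemma rsum_const (c : R) (n : nat) : rsum (fun _ => c) n = INR n * c.
Proof. induction n; [simpl; ring|]. rewrite S_INR. simpl. rewrite IHn. ring. Qed.

Lemma geometric_sum (z : C) (n : nat) :
  ((z - 1) * csum (fun k => z ^ k) n = z ^ n - 1)%C.
Proof. induction n; simpl; [ring|]. rewrite Cmult_plus_distr_l, IHn. ring. Qed.

Lemma geometric_sum_half (n : nat) : rsum (fun k => (1/2) ^ k) n <= 2.
Proof.
  assert (rsum (fun k => (1/2) ^ k) n = 2 - 2 * (1/2) ^ n).
  { induction n; simpl; [lra|]. rewrite IHn. lra. }
  assert (0 < (1/2) ^ n) by (apply pow_lt; lra). lra.
Qed.

(** Along the segment from [0] to [z], each Taylor remainder is a primitive of
    the preceding one, so the mean value inequality yields the bound by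
    induction. *)
Lemma Cexp_taylor (z : C) (n : nat) :
  Cmod (Cexp z - csum (fun k => z ^ k / RtoC (INR (fact k)))%C n)
    <= exp (Cmod z) * Cmod z ^ n / INR (fact n).
Proof.
  set (T := fun n x => csum (fun k => (RtoC x * z) ^ k / RtoC (INR (fact k)))%C n).
  assert (HF : forall k, INR (fact k) <> 0) by (intros; apply INR_fact_neq_0).
  assert (HFC : forall k, RtoC (INR (fact k)) <> 0%C).
  { intros k E. apply RtoC_inj in E. now apply (HF k). }
  assert (HTd : forall n x, Cderiv (fun x => T (S n) x) x (z * T n x)%C).
  { clear n. induction n as [|n IH]; intros x.
    - unfold T; simpl. rewrite Cmult_0_r.
      apply (Cderiv_ext (fun _ => (0 + 1 / RtoC 1))%C); auto. apply Cderiv_const.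
    - change (fun x => T (S (S n)) x) with
        (fun x => T (S n) x + (RtoC x * z) ^ (S n) / RtoC (INR (fact (S n))))%C.
      change (T (S n) x) with (T n x + (RtoC x * z) ^ n / RtoC (INR (fact n)))%C.
      rewrite Cmult_plus_distr_l. apply Cderiv_plus; auto.
      replace (z * ((RtoC x * z) ^ n / RtoC (INR (fact n))))%C
        with ((z ^ S n / RtoC (INR (fact (S n)))) * RtoC (INR (S n) * x ^ n))%C.
      + apply (Cderiv_ext (fun x => (z ^ S n / RtoC (INR (fact (S n)))) * RtoC (x ^ S n))%C).
        * intros u. cbv beta. rewrite Cpow_mult_l, RtoC_pow. unfold Cdiv.
          generalize (/ RtoC (INR (fact (S n))))%C (RtoC u ^ S n)%C (z ^ S n)%C. intros; ring.
        * apply Cderiv_scal, Cderiv_real. auto_derive; auto. rewrite Rmult_1_l. reflexivity.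
      + change (fact (S n)) with ((S n) * fact n)%nat.
        rewrite mult_INR, !RtoC_mult, RtoC_pow, Cpow_mult_l.
        simpl (z ^ S n)%C. field. split; auto.
        intro E; apply RtoC_inj in E. now apply (not_0_INR (S n)). }
  assert (HE : forall x, Cderiv (fun x => Cexp (z * RtoC x)) x (z * Cexp (z * RtoC x))%C).
  { intros x. generalize (Cderiv_Cexp z (fun u => u) x 1 (is_derive_id x)).
    now rewrite Cmult_1_r. }
  assert (HR : forall n x, 0 <= x <= 1 ->
     Cmod (Cexp (z * RtoC x) - T n x) <= exp (Cmod z) * (Cmod z * x) ^ n / INR (fact n)).
  { clear n. induction n as [|n IH]; intros x Hx.
    - unfold T; simpl. replace (Cexp (z * RtoC x) - 0)%C with (Cexp (z * RtoC x)) by ring.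
      rewrite Cmod_Cexp, re_scal_r.
      replace (exp (Cmod z) * 1 / 1) with (exp (Cmod z)) by field.
      assert (Re z * x <= Cmod z).
      { assert (H := re_le_Cmod z). assert (H2 := Cmod_ge_0 z).
        assert (Re z <= Cmod z) by (eapply Rle_trans; [apply Rle_abs|auto]). nra. }
      apply exp_monotone; exact H.
    - assert (H0 : (Cexp (z * RtoC 0) - T (S n) 0 = 0)%C).
      { unfold T. rewrite csum_shift, Cmult_0_r, Cexp_0. simpl.
        rewrite csum_zero. { field. }
        intros k _. simpl. unfold Cdiv. ring. }
      replace (Cexp (z * RtoC x) - T (S n) x)%C with
        ((Cexp (z * RtoC x) - T (S n) x) - (Cexp (z * RtoC 0) - T (S n) 0))%C
        by (rewrite H0; ring).
      replace (exp (Cmod z) * (Cmod z * x) ^ S n / INR (fact (S n))) with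
        (exp (Cmod z) * (Cmod z * x) ^ S n / INR (fact (S n)) - exp (Cmod z) * (Cmod z * 0) ^ S n / INR (fact (S n)))
        by (rewrite Rmult_0_r, pow_i by lia; field; auto).
      apply (mean_value_inequality (fun x => Cexp (z * RtoC x) - T (S n) x)%C
        (fun x => z * Cexp (z * RtoC x) - z * T n x)%C
        (fun x => exp (Cmod z) * (Cmod z * x) ^ S n / INR (fact (S n)))
        (fun x => Cmod z * (exp (Cmod z) * (Cmod z * x) ^ n / INR (fact n)))).
      + lra.
      + intros y Hy. apply Cderiv_minus; auto.
      + intros y Hy.
        change (fact (S n)) with ((S n) * fact n)%nat. rewrite mult_INR.
        apply (is_derive_ext (fun x => (exp (Cmod z) / (INR (S n) * INR (fact n))) * (Cmod z * x) ^ S n)).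
        { intros t. match goal with |- ?a = ?b => change (@eq R a b) end.
          field. split; auto. apply not_0_INR; lia. }
        auto_derive; auto. change (Init.Nat.pred (S n)) with n.
        change (match n with 0%nat => 1 | S _ => INR n + 1 end) with (INR (S n)).
        field. split; auto. apply not_0_INR; lia.
      + intros y Hy.
        replace (z * Cexp (z * RtoC y) - z * T n y)%C with (z * (Cexp (z * RtoC y) - T n y))%C by ring.
        rewrite Cmod_mult. apply Rmult_le_compat_l; [apply Cmod_ge_0|]. apply IH; lra. }
  specialize (HR n 1 ltac:(lra)). unfold T in HR.
  rewrite Cmult_1_r, Rmult_1_r in HR.
  rewrite (csum_ext _ (fun k => (RtoC 1 * z) ^ k / RtoC (INR (fact k)))%C); auto.
  intros k _. now rewrite Cmult_1_l.
Qed.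

Lemma Cexp_minus_1_bound (z : C) : Cmod (Cexp z - 1) <= exp (Cmod z) * Cmod z.
Proof.
  generalize (Cexp_taylor z 1). simpl.
  replace (Cexp z - (0 + 1 / 1))%C with (Cexp z - 1)%C by field.
  replace (exp (Cmod z) * (Cmod z * 1) / 1) with (exp (Cmod z) * Cmod z) by field. auto.
Qed.

Lemma Cexp_minus_1_z_bound (z : C) : Cmod (Cexp z - 1 - z) <= exp (Cmod z) * Cmod z ^ 2.
Proof.
  generalize (Cexp_taylor z 2). simpl.
  replace (Cexp z - (0 + 1 / 1 + z * 1 / 1))%C with (Cexp z - 1 - z)%C by field.
  intros H. eapply Rle_trans; [exact H|].
  assert (0 < exp (Cmod z)) by apply exp_pos. assert (0 <= Cmod z) by apply Cmod_ge_0.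
  assert (0 <= exp (Cmod z) * (Cmod z * (Cmod z * 1))) by (apply Rmult_le_pos; nra). lra.
Qed.

(** * Limits and uniform limits *)

Definition Ccv (u : nat -> C) (l : C) : Prop :=
  forall eps, 0 < eps -> exists N, forall n, (N <= n)%nat -> Cmod (u n - l) < eps.

Definition ucv {X : Type} (D : X -> Prop) (u : nat -> X -> C) (f : X -> C) : Prop :=
  forall eps, 0 < eps ->
  exists N, forall n x, (N <= n)%nat -> D x -> Cmod (u n x - f x) < eps.

Lemma ucv_Ccv {X : Type} (D : X -> Prop) u f x :
  ucv D u f -> D x -> Ccv (fun n => u n x) (f x).
Proof. intros H Hx e He. destruct (H e He) as [N HN]. exists N. auto. Qed.

Lemma Ccv_ucv {X : Type} (D : X -> Prop) (u : nat -> C) (l : C) :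
  Ccv u l -> ucv D (fun n _ => u n) (fun _ => l).
Proof. intros H e He. destruct (H e He) as [N HN]. exists N. auto. Qed.

Lemma ucv_Ccv_unit (u : nat -> C) (l : C) :
  ucv (fun _ : unit => True) (fun n _ => u n) (fun _ => l) -> Ccv u l.
Proof. intros H. exact (ucv_Ccv _ _ _ tt H I). Qed.

Lemma ucv_mono {X : Type} (D D' : X -> Prop) u f :
  (forall x, D' x -> D x) -> ucv D u f -> ucv D' u f.
Proof. intros HD H e He. destruct (H e He) as [N HN]. exists N. auto. Qed.

Lemma ucv_ext {X : Type} (D : X -> Prop) u v f g :
  (exists N, forall n x, (N <= n)%nat -> D x -> u n x = v n x) ->
  (forall x, D x -> f x = g x) -> ucv D u f -> ucv D v g.
Proof.
  intros [N0 H0] Hg H e He. destruct (H e He) as [N HN]. exists (max N N0).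
  intros n x Hn Hx. rewrite <- H0, <- Hg by (auto; lia). apply HN; auto; lia.
Qed.

Lemma ucv_bound {X : Type} (D : X -> Prop) u f (e : nat -> R) :
  is_lim_seq e 0 ->
  (exists N, forall n x, (N <= n)%nat -> D x -> Cmod (u n x - f x) <= e n) -> ucv D u f.
Proof.
  intros He [N0 H] eps Heps. apply is_lim_seq_spec in He.
  destruct (He (mkposreal eps Heps)) as [N HN]. simpl in HN.
  exists (max N N0). intros n x Hn Hx.
  eapply Rle_lt_trans; [apply H; auto; lia|].
  eapply Rle_lt_trans; [apply Rle_abs|]. specialize (HN n ltac:(lia)).
  now rewrite Rminus_0_r in HN.
Qed.

Lemma ucv_plus {X : Type} (D : X -> Prop) u v f g :
  ucv D u f -> ucv D v g -> ucv D (fun n x => u n x + v n x)%C (fun x => f x + g x)%C.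
Proof.
  intros Hu Hv e He.
  destruct (Hu (e/2) ltac:(lra)) as [N1 H1]. destruct (Hv (e/2) ltac:(lra)) as [N2 H2].
  exists (max N1 N2). intros n x Hn Hx.
  specialize (H1 n x ltac:(lia) Hx). specialize (H2 n x ltac:(lia) Hx).
  replace (u n x + v n x - (f x + g x))%C with ((u n x - f x) + (v n x - g x))%C by ring.
  eapply Rle_lt_trans; [apply Cmod_triangle|]. lra.
Qed.

Lemma ucv_mult {X : Type} (D : X -> Prop) u v f g (A B : R) :
  (forall x, D x -> Cmod (f x) <= A) -> (forall x, D x -> Cmod (g x) <= B) ->
  ucv D u f -> ucv D v g -> ucv D (fun n x => u n x * v n x)%C (fun x => f x * g x)%C.
Proof.
  intros HA HB Hu Hv e He.
  set (K := Rabs A + Rabs B + 1).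
  assert (HK : 1 <= K) by (unfold K; generalize (Rabs_pos A), (Rabs_pos B); lra).
  set (d := Rmin 1 (e / (2 * K))).
  assert (Hd : 0 < d) by (apply Rmin_pos; [lra | apply Rdiv_lt_0_compat; lra]).
  assert (Hd1 : d <= 1) by apply Rmin_l.
  assert (Hd2 : d * (2 * K) <= e).
  { apply Rle_trans with (e / (2 * K) * (2 * K)).
    - apply Rmult_le_compat_r; [lra | apply Rmin_r].
    - right; field; lra. }
  destruct (Hu d Hd) as [N1 H1]. destruct (Hv d Hd) as [N2 H2].
  exists (max N1 N2). intros n x Hn Hx.
  specialize (H1 n x ltac:(lia) Hx). specialize (H2 n x ltac:(lia) Hx).
  replace (u n x * v n x - f x * g x)%C with
    ((u n x - f x) * (v n x - g x) + (u n x - f x) * g x + f x * (v n x - g x))%C by ring.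
  eapply Rle_lt_trans; [apply Cmod_triangle|].
  eapply Rle_lt_trans; [apply Rplus_le_compat_r, Cmod_triangle|]. rewrite !Cmod_mult.
  specialize (HA x Hx). specialize (HB x Hx).
  assert (P1 := Cmod_ge_0 (u n x - f x)). assert (P2 := Cmod_ge_0 (v n x - g x)).
  assert (P3 := Cmod_ge_0 (f x)). assert (P4 := Cmod_ge_0 (g x)).
  assert (A <= Rabs A) by apply Rle_abs. assert (B <= Rabs B) by apply Rle_abs.
  assert (Q1 : Cmod (u n x - f x) * Cmod (v n x - g x) <= d * 1) by (apply Rmult_le_compat; lra).
  assert (Q2 : Cmod (u n x - f x) * Cmod (g x) <= d * Rabs B) by (apply Rmult_le_compat; lra).
  assert (Q3 : Cmod (f x) * Cmod (v n x - g x) <= Rabs A * d) by (apply Rmult_le_compat; lra).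
  assert (d * (2 * K) = 2 * (d * 1 + d * Rabs B + Rabs A * d)) by (unfold K; ring).
  assert (0 <= d * Rabs B) by (apply Rmult_le_pos; [lra | apply Rabs_pos]).
  assert (0 <= Rabs A * d) by (apply Rmult_le_pos; [apply Rabs_pos | lra]).
  lra.
Qed.

Lemma ucv_scal {X : Type} (D : X -> Prop) (c : C) u f :
  ucv D u f -> ucv D (fun n x => c * u n x)%C (fun x => c * f x)%C.
Proof.
  intros Hu e He.
  assert (Hc := Cmod_ge_0 c).
  destruct (Hu (e / (Cmod c + 1))) as [N HN]; [apply Rdiv_lt_0_compat; lra|].
  exists N. intros n x Hn Hx. specialize (HN n x Hn Hx).
  replace (c * u n x - c * f x)%C with (c * (u n x - f x))%C by ring.
  rewrite Cmod_mult.
  apply Rle_lt_trans with ((Cmod c + 1) * Cmod (u n x - f x)).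
  - apply Rmult_le_compat_r; [apply Cmod_ge_0 | lra].
  - apply Rlt_le_trans with ((Cmod c + 1) * (e / (Cmod c + 1))).
    + apply Rmult_lt_compat_l; lra.
    + right; field; lra.
Qed.

Lemma Ccv_const (c : C) : Ccv (fun _ => c) c.
Proof.
  intros e He. exists 0%nat. intros n _. replace (c - c)%C with (RtoC 0) by ring. now rewrite Cmod_0.
Qed.

Lemma ucv_refl {X : Type} (D : X -> Prop) (f : X -> C) : ucv D (fun _ => f) f.
Proof.
  intros e He. exists 0%nat. intros n x _ _. replace (f x - f x)%C with (RtoC 0) by ring. now rewrite Cmod_0.
Qed.

Lemma Ccv_ext (u v : nat -> C) (l : C) : (forall n, u n = v n) -> Ccv u l -> Ccv v l.
Proof. intros E H e He. destruct (H e He) as [N HN]. exists N. intros. rewrite <- E. auto. Qed.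

Lemma Ccv_ext_loc (u v : nat -> C) (l : C) (N0 : nat) :
  (forall n, (N0 <= n)%nat -> u n = v n) -> Ccv u l -> Ccv v l.
Proof.
  intros E H e He. destruct (H e He) as [N HN]. exists (max N N0). intros.
  rewrite <- E by lia. apply HN; lia.
Qed.

Lemma Ccv_plus u v a b : Ccv u a -> Ccv v b -> Ccv (fun n => u n + v n)%C (a + b)%C.
Proof.
  intros H1 H2. apply ucv_Ccv_unit.
  apply (ucv_plus (fun _ : unit => True) (fun n _ => u n) (fun n _ => v n) (fun _ => a) (fun _ => b));
  apply Ccv_ucv; auto.
Qed.

Lemma Ccv_mult u v a b : Ccv u a -> Ccv v b -> Ccv (fun n => u n * v n)%C (a * b)%C.
Proof.
  intros H1 H2. apply ucv_Ccv_unit.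
  apply (ucv_mult (fun _ : unit => True) (fun n _ => u n) (fun n _ => v n) (fun _ => a) (fun _ => b)
    (Cmod a) (Cmod b)); try (intros; lra);
  apply Ccv_ucv; auto.
Qed.

Lemma Ccv_scal c u a : Ccv u a -> Ccv (fun n => c * u n)%C (c * a)%C.
Proof. intros H. apply Ccv_mult; auto. apply Ccv_const. Qed.

Lemma Ccv_minus u v a b : Ccv u a -> Ccv v b -> Ccv (fun n => u n - v n)%C (a - b)%C.
Proof.
  intros H1 H2. replace (a - b)%C with (a + - (1) * b)%C by ring.
  apply (Ccv_ext (fun n => u n + - (1) * v n)%C); [intros; ring|].
  apply Ccv_plus; auto. apply Ccv_scal; auto.
Qed.

Lemma Ccv_Cmod (u : nat -> C) (l : C) :
  Ccv u l -> is_lim_seq (fun n => Cmod (u n)) (Cmod l).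
Proof.
  intros H. apply is_lim_seq_spec. intros e. destruct (H e (cond_pos e)) as [N HN].
  exists N. intros n Hn. specialize (HN n Hn).
  apply Rabs_def1.
  - generalize (Cmod_triangle_rev (u n) l). lra.
  - generalize (Cmod_triangle_rev l (u n)). rewrite Cmod_minus_sym. lra.
Qed.

Lemma Ccv_bound (u : nat -> C) (l : C) (e : nat -> R) :
  is_lim_seq e 0 -> (exists N, forall n, (N <= n)%nat -> Cmod (u n - l) <= e n) -> Ccv u l.
Proof.
  intros He [N H]. apply ucv_Ccv_unit. apply (ucv_bound _ _ _ e He). exists N. auto.
Qed.

Lemma Ccv_0_Cmod (u : nat -> C) : is_lim_seq (fun n => Cmod (u n)) 0 -> Ccv u 0.
Proof.
  intros H. apply (Ccv_bound _ _ _ H). exists 0%nat. intros n _. right. f_equal. ring.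
Qed.

Lemma Ccv_Re u l : Ccv u l -> is_lim_seq (fun n => Re (u n)) (Re l).
Proof.
  intros H. apply is_lim_seq_spec. intros e. destruct (H e (cond_pos e)) as [N HN].
  exists N. intros n Hn. eapply Rle_lt_trans; [|apply HN, Hn].
  replace (Re (u n) - Re l) with (Re (u n - l)%C)
    by (unfold Cminus; rewrite re_plus, re_opp; ring).
  apply re_le_Cmod.
Qed.

Lemma Ccv_Im u l : Ccv u l -> is_lim_seq (fun n => Im (u n)) (Im l).
Proof.
  intros H. apply is_lim_seq_spec. intros e. destruct (H e (cond_pos e)) as [N HN].
  exists N. intros n Hn. eapply Rle_lt_trans; [|apply HN, Hn].
  replace (Im (u n) - Im l) with (Im (u n - l)%C)
    by (unfold Cminus; rewrite im_plus, im_opp; ring).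
  apply im_le_Cmod.
Qed.

Lemma is_lim_seq_scal_0 (K : R) (e : nat -> R) : is_lim_seq e 0 -> is_lim_seq (fun n => K * e n) 0.
Proof.
  intros H. replace (Finite 0) with (Rbar_mult K 0) by (simpl; f_equal; ring).
  apply is_lim_seq_scal_l, H.
Qed.

Definition Clim (u : nat -> C) : C :=
  (real (Lim_seq (fun n => Re (u n))), real (Lim_seq (fun n => Im (u n)))).

Lemma Clim_unique (u : nat -> C) (l : C) : Ccv u l -> Clim u = l.
Proof.
  intros H. unfold Clim.
  rewrite (is_lim_seq_unique _ _ (Ccv_Re _ _ H)), (is_lim_seq_unique _ _ (Ccv_Im _ _ H)).
  apply C_ext; reflexivity.
Qed.

Lemma Ccv_unique (u : nat -> C) (l m : C) : Ccv u l -> Ccv u m -> l = m.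
Proof. intros H1 H2. rewrite <- (Clim_unique _ _ H1). apply Clim_unique, H2. Qed.

Lemma Ccv_cauchy (u : nat -> C) :
  (forall eps, 0 < eps -> exists N, forall n m, (N <= n)%nat -> (n <= m)%nat -> Cmod (u m - u n) < eps) ->
  Ccv u (Clim u).
Proof.
  intros H.
  assert (HR : forall p : C -> R, (forall a b, Rabs (p a - p b) <= Cmod (a - b)) ->
    is_lim_seq (fun n => p (u n)) (real (Lim_seq (fun n => p (u n))))).
  { intros p Hp. apply Lim_seq_correct', ex_lim_seq_cauchy_corr.
    intros e. destruct (H e (cond_pos e)) as [N HN]. exists N. intros n m Hn Hm.
    eapply Rle_lt_trans; [apply Hp|].
    destruct (Nat.le_ge_cases n m).
    - rewrite Cmod_minus_sym. apply HN; lia.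
    - apply HN; lia. }
  assert (H1 : is_lim_seq (fun n => Re (u n)) (Re (Clim u))).
  { apply (HR Re). intros a b. replace (Re a - Re b) with (Re (a - b)%C)
    by (unfold Cminus; rewrite re_plus, re_opp; ring). apply re_le_Cmod. }
  assert (H2 : is_lim_seq (fun n => Im (u n)) (Im (Clim u))).
  { apply (HR Im). intros a b. replace (Im a - Im b) with (Im (a - b)%C)
    by (unfold Cminus; rewrite im_plus, im_opp; ring). apply im_le_Cmod. }
  intros e He. apply is_lim_seq_spec in H1, H2.
  destruct (H1 (mkposreal (e/2) ltac:(lra))) as [N1 HN1].
  destruct (H2 (mkposreal (e/2) ltac:(lra))) as [N2 HN2]. cbn [pos] in HN1, HN2.
  exists (max N1 N2). intros n Hn.
  eapply Rle_lt_trans; [apply Cmod_le_Re_Im|]. unfold Cminus.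
  rewrite re_plus, im_plus, re_opp, im_opp.
  specialize (HN1 n ltac:(lia)). specialize (HN2 n ltac:(lia)). unfold Rminus in HN1, HN2. lra.
Qed.

Lemma Ccv_subseq (u : nat -> C) (l : C) (phi : nat -> nat) :
  (forall n, (n <= phi n)%nat) -> Ccv u l -> Ccv (fun n => u (phi n)) l.
Proof.
  intros Hp H e He. destruct (H e He) as [N HN]. exists N. intros n Hn. apply HN.
  specialize (Hp n); lia.
Qed.

Lemma ucv_subseq {X : Type} (D : X -> Prop) u f (phi : nat -> nat) :
  (forall n, (n <= phi n)%nat) -> ucv D u f -> ucv D (fun n => u (phi n)) f.
Proof.
  intros Hp H e He. destruct (H e He) as [N HN]. exists N. intros n x Hn Hx. apply HN; auto.
  specialize (Hp n); lia.
Qed.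

Lemma Ccv_Cmod_le (u : nat -> C) (l : C) (B : R) (N : nat) :
  Ccv u l -> (forall n, (N <= n)%nat -> Cmod (u n) <= B) -> Cmod l <= B.
Proof.
  intros H HB.
  apply (is_lim_seq_le_loc (fun n => Cmod (u n)) (fun _ => B) (Cmod l) B).
  - exists N. auto.
  - apply Ccv_Cmod, H.
  - apply is_lim_seq_const.
Qed.

(** * Series dominated by a series of powers *)

Lemma INR_S_pos (k : nat) : 0 < INR (S k).
Proof. apply lt_0_INR; lia. Qed.

Lemma Rpower_pos (x y : R) : 0 < Rpower x y.
Proof. apply exp_pos. Qed.

Lemma Rpower_1_base (y : R) : Rpower 1 y = 1.
Proof. unfold Rpower. rewrite ln_1, Rmult_0_r. apply exp_0. Qed.

Lemma Rpower_antitone_base (x y d : R) : 0 < x <= y -> 0 <= d -> Rpower y (- d) <= Rpower x (- d).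
Proof.
  intros Hx Hd. rewrite !Rpower_Ropp. apply Rinv_le_contravar; [apply Rpower_pos|].
  apply Rle_Rpower_l; lra.
Qed.

Lemma is_lim_seq_Rpower_neg (d : R) : 0 < d -> is_lim_seq (fun n => Rpower (INR n) (- d)) 0.
Proof.
  intros Hd. apply is_lim_seq_spec. intros e. destruct e as [e He]. simpl.
  set (x0 := Rpower e (- / d)).
  destruct (INR_unbounded x0) as [N HN]. exists (S N). intros n Hn.
  rewrite Rminus_0_r, Rabs_pos_eq by (left; apply Rpower_pos).
  assert (Hx : 0 < x0) by apply Rpower_pos.
  assert (x0 < INR n) by (eapply Rlt_trans; [exact HN|]; apply lt_INR; lia).
  rewrite Rpower_Ropp.
  replace e with (/ Rpower x0 d).
  - apply Rinv_lt_contravar; [apply Rmult_lt_0_compat; apply Rpower_pos|].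
    apply Rlt_Rpower_l; lra.
  - unfold x0. rewrite Rpower_mult. replace (- / d * d) with (- (1)) by (field; lra).
    rewrite Rpower_Ropp, Rpower_1 by auto. apply Rinv_inv.
Qed.

(** The mean value theorem for [x ^ (- d)]; it makes the tails of the series of
    powers telescope. *)
Lemma Rpower_decrement (d x : R) : 0 < d -> 0 < x ->
  d * Rpower (x + 1) (- 1 - d) <= Rpower x (- d) - Rpower (x + 1) (- d).
Proof.
  intros Hd Hx.
  destruct (MVT_gen (fun u => Rpower u (- d)) x (x + 1) (fun u => - d * Rpower u (- d - 1)))
    as [c [Hc E]].
  - rewrite Rmin_left, Rmax_right by lra. intros u Hu. apply is_derive_Reals.
    apply derivable_pt_lim_power; lra.
  - rewrite Rmin_left, Rmax_right by lra. intros u Hu.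
    apply derivable_continuous_pt. eexists. apply derivable_pt_lim_power; lra.
  - rewrite Rmin_left, Rmax_right in Hc by lra. cbv beta in E.
    assert (H : Rpower (x + 1) (- (1 + d)) <= Rpower c (- (1 + d))) by (apply Rpower_antitone_base; lra).
    replace (-1 - d) with (- (1 + d)) by ring. replace (- d - 1) with (- (1 + d)) in E by ring. nra.
Qed.

Lemma rsum_Rpower_tail (d : R) (n m : nat) : 0 < d -> (1 <= n)%nat ->
  rsum (fun k => Rpower (INR (S (n + k))) (- 1 - d)) m <= Rpower (INR n) (- d) / d.
Proof.
  intros Hd Hn.
  assert (H : d * rsum (fun k => Rpower (INR (S (n + k))) (- 1 - d)) m
     <= Rpower (INR n) (- d) - Rpower (INR (n + m)) (- d)).
  { induction m; cbn [rsum].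
    - rewrite Nat.add_0_r. lra.
    - rewrite Nat.add_succ_r.
      assert (0 < INR (n + m)) by (apply lt_0_INR; lia).
      generalize (Rpower_decrement d (INR (n + m)) Hd H). rewrite !S_INR. lra. }
  assert (0 < Rpower (INR (n + m)) (- d)) by apply Rpower_pos.
  apply Rmult_le_reg_l with d; auto. unfold Rdiv.
  replace (d * (Rpower (INR n) (- d) * / d)) with (Rpower (INR n) (- d)) by (field; lra). lra.
Qed.

Lemma rsum_Rpower_total (d : R) (m : nat) : 0 < d ->
  rsum (fun k => Rpower (INR (S k)) (- 1 - d)) m <= 1 + / d.
Proof.
  intros Hd. destruct m as [|m].
  - cbn [rsum]. assert (0 < / d) by (apply Rinv_0_lt_compat; auto). lra.
  - replace (S m) with (1 + m)%nat by lia. rewrite rsum_add.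
    generalize (rsum_Rpower_tail d 1 m Hd (le_n 1)). change (rsum (fun k => Rpower (INR (S k)) (-1 - d)) 1) with (0 + Rpower (INR 1) (-1 - d)).
    change (INR 1) with 1.
    rewrite !Rpower_1_base. unfold Rdiv. lra.
Qed.

Definition Cser (u : nat -> C) : C := Clim (csum u).

Lemma Cser_unique (u : nat -> C) (l : C) : Ccv (csum u) l -> Cser u = l.
Proof. apply Clim_unique. Qed.

(** Domination by a series of powers.  All infinite series below are controlled
    in this form, because its tails are bounded in terms of [B] and [d] alone,
    hence uniformly in every other parameter. *)
Definition pdom (u : nat -> C) (B d : R) : Prop :=
  forall k, Cmod (u k) <= B * Rpower (INR (S k)) (- 1 - d).

Lemma pdom_nonneg u B d : pdom u B d -> 0 <= B.
Proof.
  intros H. specialize (H 0%nat). simpl (INR 1) in H. rewrite Rpower_1_base in H.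
  generalize (Cmod_ge_0 (u 0%nat)). lra.
Qed.

Section Dominated.
Variables (u : nat -> C) (B d : R).
Hypotheses (Hd : 0 < d) (Hu : pdom u B d).

Lemma pdom_csum_diff n m : (1 <= n)%nat -> (n <= m)%nat ->
  Cmod (csum u m - csum u n) <= B * (Rpower (INR n) (- d) / d).
Proof.
  intros Hn Hm. assert (H0 := pdom_nonneg _ _ _ Hu).
  replace m with (n + (m - n))%nat by lia. rewrite csum_add.
  replace (csum u n + csum (fun k => u (n + k)%nat) (m - n) - csum u n)%C
    with (csum (fun k => u (n + k)%nat) (m - n))%C by ring.
  eapply Rle_trans; [apply Cmod_csum_le with (M := fun k => B * Rpower (INR (S (n + k))) (- 1 - d));
    intros k _; apply Hu|].
  rewrite rsum_scal. apply Rmult_le_compat_l; auto. apply rsum_Rpower_tail; auto.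
Qed.

Lemma is_lim_seq_pdom_tail : is_lim_seq (fun n => B * (Rpower (INR n) (- d) / d)) 0.
Proof.
  apply (is_lim_seq_ext (fun n => B / d * Rpower (INR n) (- d))); [intros; field; lra|].
  apply is_lim_seq_scal_0, is_lim_seq_Rpower_neg; auto.
Qed.

Lemma pdom_cv : Ccv (csum u) (Cser u).
Proof.
  apply Ccv_cauchy. intros e He.
  assert (Hl := is_lim_seq_pdom_tail). apply is_lim_seq_spec in Hl.
  destruct (Hl (mkposreal e He)) as [N HN]. cbn [pos] in HN.
  exists (S N). intros n m Hn Hm.
  eapply Rle_lt_trans; [apply pdom_csum_diff; lia|].
  eapply Rle_lt_trans; [|apply (HN n); lia]. rewrite Rminus_0_r. apply Rle_abs.
Qed.

Lemma pdom_tail n : (1 <= n)%nat -> Cmod (Cser u - csum u n) <= B * (Rpower (INR n) (- d) / d).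
Proof.
  intros Hn.
  apply (Ccv_Cmod_le (fun m => csum u m - csum u n)%C _ _ n).
  - apply Ccv_minus; [apply pdom_cv | apply Ccv_const].
  - intros m Hm. apply pdom_csum_diff; auto.
Qed.

Lemma pdom_total : Cmod (Cser u) <= B * (1 + / d).
Proof.
  assert (H0 := pdom_nonneg _ _ _ Hu).
  apply (Ccv_Cmod_le (csum u) _ _ 0%nat).
  - apply pdom_cv.
  - intros m _.
    eapply Rle_trans; [apply Cmod_csum_le with (M := fun k => B * Rpower (INR (S k)) (- 1 - d));
      intros k _; apply Hu|].
    rewrite rsum_scal. apply Rmult_le_compat_l; auto. apply rsum_Rpower_total; auto.
Qed.

End Dominated.

(** Tannery's theorem, uniformly in a parameter: domination makes the tails
    small at once for all [l] and [x], and finitely many terms converge. *)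
Lemma ucv_Cser {X : Type} (D : X -> Prop) (u : nat -> nat -> X -> C) (v : nat -> X -> C) (B d : R) :
  0 < d ->
  (forall l x, D x -> pdom (fun k => u l k x) B d) ->
  (forall k, ucv D (fun l => u l k) (v k)) ->
  ucv D (fun l x => Cser (fun k => u l k x)) (fun x => Cser (fun k => v k x)).
Proof.
  intros Hd Hu Hv e He.
  assert (Hvd : forall x, D x -> pdom (fun k => v k x) B d).
  { intros x Hx k. apply (Ccv_Cmod_le (fun l => u l k x) _ _ 0%nat).
    - exact (ucv_Ccv _ _ _ x (Hv k) Hx).
    - intros l _. apply (Hu l x Hx k). }
  assert (Hl := is_lim_seq_pdom_tail B d Hd). apply is_lim_seq_spec in Hl.
  destruct (Hl (mkposreal (e/4) ltac:(lra))) as [n0 Hn0]. cbn [pos] in Hn0.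
  set (n := S n0). specialize (Hn0 n ltac:(unfold n; lia)). rewrite Rminus_0_r in Hn0.
  assert (Htail := Rle_lt_trans _ _ _ (Rle_abs _) Hn0).
  assert (HS : ucv D (fun l x => csum (fun k => u l k x) n) (fun x => csum (fun k => v k x) n)).
  { generalize n. clear - Hv. induction n; simpl.
    - apply ucv_refl.
    - apply (ucv_plus D (fun l x => csum (fun k => u l k x) n) (fun l x => u l n x)); auto. }
  destruct (HS (e/4) ltac:(lra)) as [N HN]. exists N. intros l x Hl' Hx.
  specialize (HN l x Hl' Hx).
  assert (T1 := pdom_tail _ B d Hd (Hu l x Hx) n ltac:(unfold n; lia)).
  assert (T2 := pdom_tail _ B d Hd (Hvd x Hx) n ltac:(unfold n; lia)).
  replace (Cser (fun k => u l k x) - Cser (fun k => v k x))%C with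
    ((Cser (fun k => u l k x) - csum (fun k => u l k x) n)
     + (csum (fun k => u l k x) n - csum (fun k => v k x) n)
     - (Cser (fun k => v k x) - csum (fun k => v k x) n))%C by ring.
  eapply Rle_lt_trans; [apply Cmod_triangle_minus|].
  eapply Rle_lt_trans; [apply Rplus_le_compat_r, Cmod_triangle|]. lra.
Qed.

(** Serves both to pick a subseries out of a sampled Fourier series and to sum
    over the multiples of a prime. *)
Lemma Ccv_csum_sparse (u : nat -> C) (m r : nat) (S : C) :
  (r < m)%nat -> (forall q j, (j < m)%nat -> j <> r -> u (m * q + j)%nat = 0%C) ->
  Ccv (csum u) S -> Ccv (csum (fun q => u (m * q + r)%nat)) S.
Proof.
  intros Hr H0 H.
  apply (Ccv_ext (fun Q => csum u (m * Q)%nat)).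
  - induction n.
    + rewrite Nat.mul_0_r. reflexivity.
    + replace (m * Datatypes.S n)%nat with (m * n + m)%nat by lia.
      rewrite csum_add, IHn. simpl. f_equal.
      apply (csum_single (fun k => u (m * n + k)%nat)); auto.
  - apply (Ccv_subseq (csum u) S (fun Q => (m * Q)%nat)); auto. intros n; nia.
Qed.

(** * Roots of unity *)

Definition unity_root (n : nat) : C := Cexp (Ci * RtoC (2 * PI / INR n)).

Lemma Cexp_Ci (x : R) : Cexp (Ci * RtoC x) = (cos x, sin x).
Proof.
  unfold Cexp. simpl. replace (0 * x - 1 * 0) with 0 by ring. replace (0 * 0 + 1 * x) with x by ring.
  rewrite exp_0. apply C_ext; simpl; ring.
Qed.

Lemma unity_root_pow (n m : nat) :
  (unity_root n ^ m)%C = Cexp (Ci * RtoC (2 * PI * INR m / INR n)).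
Proof.
  unfold unity_root. rewrite <- Cexp_nat_mult. f_equal.
  replace (2 * PI * INR m / INR n) with (INR m * (2 * PI / INR n)) by (unfold Rdiv; ring).
  rewrite RtoC_mult. ring.
Qed.

Lemma unity_root_pow_n (n : nat) : (0 < n)%nat -> (unity_root n ^ n)%C = 1%C.
Proof.
  intros Hn. rewrite unity_root_pow, Cexp_Ci.
  replace (2 * PI * INR n / INR n) with (2 * PI) by (field; apply not_0_INR; lia).
  rewrite cos_2PI, sin_2PI. reflexivity.
Qed.

Lemma Cmod_unity_root_pow (n m : nat) : Cmod (unity_root n ^ m) = 1.
Proof.
  rewrite unity_root_pow, Cmod_Cexp, re_scal_r. simpl. rewrite Rmult_0_l. apply exp_0.
Qed.

Lemma unity_root_pow_neq_1 (n m : nat) : (0 < m < n)%nat -> (unity_root n ^ m)%C <> 1%C.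
Proof.
  intros Hm E. rewrite unity_root_pow, Cexp_Ci in E.
  assert (Hc : cos (2 * PI * INR m / INR n) = 1) by (injection E; auto).
  assert (H0 : 0 < INR m) by (apply lt_0_INR; lia).
  assert (H1 : INR m < INR n) by (apply lt_INR; lia).
  assert (HP := PI_RGT_0).
  replace (2 * PI * INR m / INR n) with (2 * (PI * INR m / INR n)) in Hc by (field; lra).
  rewrite cos_2a_sin in Hc.
  assert (Hs : 0 < sin (PI * INR m / INR n)).
  { apply sin_gt_0.
    - apply Rdiv_lt_0_compat; nra.
    - apply Rmult_lt_reg_r with (INR n); [lra|]. unfold Rdiv. rewrite Rmult_assoc, Rinv_l by lra. nra. }
  nra.
Qed.

(** Orthogonality of characters: a geometric sum whose ratio is a root of unity
    other than one. *)
Lemma unity_root_sum (n m : nat) : (0 < n)%nat -> (m mod n <> 0)%nat ->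
  csum (fun j => (unity_root n ^ m) ^ j)%C n = 0%C.
Proof.
  intros Hn Hm.
  assert (E : (unity_root n ^ m)%C = (unity_root n ^ (m mod n))%C).
  { rewrite (Nat.div_mod_eq m n) at 1.
    rewrite Cpow_add_r, Cpow_mult_r, unity_root_pow_n, Cpow_1_l by auto. ring. }
  assert (H1 : (unity_root n ^ m)%C <> 1%C).
  { rewrite E. apply unity_root_pow_neq_1. split; [lia | apply Nat.mod_upper_bound; lia]. }
  assert (H := geometric_sum (unity_root n ^ m)%C n).
  rewrite <- Cpow_mult_r, Nat.mul_comm, Cpow_mult_r, unity_root_pow_n, Cpow_1_l in H by auto.
  assert (H2 : ((unity_root n ^ m) - 1)%C <> 0%C) by (apply Cminus_eq_contra; auto).
  replace (csum (fun j => ((unity_root n ^ m) ^ j)%C) n) with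
    (/ (unity_root n ^ m - 1) * ((unity_root n ^ m - 1) * csum (fun j => (unity_root n ^ m) ^ j) n))%C
    by (field; auto).
  rewrite H. ring.
Qed.

Lemma unity_root_sum_dvd (n m : nat) : (0 < n)%nat -> (m mod n = 0)%nat ->
  csum (fun j => (unity_root n ^ m) ^ j)%C n = RtoC (INR n).
Proof.
  intros Hn Hm.
  rewrite (Nat.div_mod_eq m n), Hm, Nat.add_0_r.
  rewrite Cpow_mult_r, unity_root_pow_n, Cpow_1_l by auto.
  rewrite (csum_ext _ (fun _ => 1%C)) by (intros; apply Cpow_1_l).
  rewrite csum_const. ring.
Qed.

(** * Polynomial approximation on discs *)

Definition poly_repr (P : C -> C) (n : nat) (a : nat -> C) : Prop :=
  (forall k, (n <= k)%nat -> a k = 0%C) /\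
  forall z, P z = csum (fun k => a k * z ^ k)%C n.

Definition is_poly (P : C -> C) : Prop := exists n a, poly_repr P n a.

Lemma csum_zero_tail (u : nat -> C) (n m : nat) :
  (forall k, (n <= k)%nat -> u k = 0%C) -> (n <= m)%nat -> csum u m = csum u n.
Proof.
  intros H Hm. replace m with (n + (m - n))%nat by lia. rewrite csum_add.
  rewrite (csum_zero (fun k => u (n + k)%nat)) by (intros; apply H; lia). ring.
Qed.

Lemma poly_repr_enlarge P n m a : poly_repr P n a -> (n <= m)%nat -> poly_repr P m a.
Proof.
  intros [H0 H] Hm. split; [intros; apply H0; lia|].
  intros z. rewrite H. symmetry. apply csum_zero_tail; auto.
  intros k Hk. rewrite H0 by auto. ring.
Qed.

Lemma is_poly_ext P Q : (forall z, P z = Q z) -> is_poly P -> is_poly Q.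
Proof. intros E (n & a & H0 & H). exists n, a. split; auto. intros z. now rewrite <- E. Qed.

Lemma is_poly_const c : is_poly (fun _ => c).
Proof.
  exists 1%nat, (fun k => match k with O => c | _ => 0%C end). split.
  - intros [|k] Hk; [lia|auto].
  - intros z. cbn [csum]. simpl. ring.
Qed.

Lemma is_poly_plus P Q : is_poly P -> is_poly Q -> is_poly (fun z => P z + Q z)%C.
Proof.
  intros (n & a & HP) (m & b & HQ).
  apply (poly_repr_enlarge _ _ (max n m)) in HP; [|lia].
  apply (poly_repr_enlarge _ _ (max n m)) in HQ; [|lia].
  destruct HP as [HP0 HP], HQ as [HQ0 HQ].
  exists (max n m), (fun k => a k + b k)%C. split.
  - intros k Hk. rewrite HP0, HQ0 by auto. ring.
  - intros z. rewrite HP, HQ, <- csum_plus. apply csum_ext. intros; ring.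
Qed.

Lemma is_poly_scal c P : is_poly P -> is_poly (fun z => c * P z)%C.
Proof.
  intros (n & a & H0 & H). exists n, (fun k => c * a k)%C. split.
  - intros k Hk. rewrite H0 by auto. ring.
  - intros z. rewrite H, <- csum_scal. apply csum_ext. intros; ring.
Qed.

Lemma is_poly_X_mult P : is_poly P -> is_poly (fun z => z * P z)%C.
Proof.
  intros (n & a & H0 & H).
  exists (S n), (fun k => match k with O => RtoC 0 | S k => a k end). split.
  - intros [|k] Hk; [lia|]. apply H0; lia.
  - intros z. rewrite csum_shift, H, <- csum_scal. simpl.
    rewrite Cmult_0_l, Cplus_0_l. apply csum_ext. intros; ring.
Qed.

Lemma is_poly_mult P Q : is_poly P -> is_poly Q -> is_poly (fun z => P z * Q z)%C.
Proof.
  intros (n & a & _ & H) HQ.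
  apply (is_poly_ext (fun z => csum (fun k => a k * z ^ k) n * Q z)%C);
    [intros; now rewrite H|].
  clear H P. revert a. induction n as [|n IH]; intros a.
  - apply (is_poly_ext (fun _ => 0%C)); [intros; cbn [csum]; ring|]. apply is_poly_const.
  - apply (is_poly_ext
      (fun z => a 0%nat * Q z + z * (csum (fun k => a (S k) * z ^ k) n * Q z))%C).
    + intros z. rewrite csum_shift.
      rewrite (csum_ext (fun k => a (S k) * z ^ S k)%C (fun k => z * (a (S k) * z ^ k))%C)
        by (intros; simpl; ring).
      rewrite csum_scal. simpl. ring.
    + apply is_poly_plus; [apply is_poly_scal, HQ|].
      apply is_poly_X_mult. apply (IH (fun k => a (S k))).
Qed.

Lemma is_poly_csum (a : nat -> C) n : is_poly (fun z => csum (fun k => a k * z ^ k) n)%C.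
Proof.
  exists n, (fun k => if (k <? n)%nat then a k else 0%C). split.
  - intros k Hk. destruct (Nat.ltb_spec k n); [lia|auto].
  - intros z. apply csum_ext. intros k Hk. destruct (Nat.ltb_spec k n); [auto|lia].
Qed.

(** Cauchy's estimate: each coefficient is a mean over roots of unity, so no
    integral is involved. *)
Lemma poly_coef_bound P n a r M k :
  poly_repr P n a -> 0 <= r -> (forall z, Cmod z <= r -> Cmod (P z) <= M) ->
  Cmod (a k) * r ^ k <= M.
Proof.
  intros [H0 HP] Hr HM.
  assert (HM0 : 0 <= M).
  { eapply Rle_trans; [apply Cmod_ge_0 | apply (HM 0%C)]. rewrite Cmod_0; auto. }
  destruct (Nat.le_gt_cases n k) as [Hk|Hk].
  { rewrite H0, Cmod_0, Rmult_0_l by auto. auto. }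
  assert (Hn : 0 < INR n) by (apply lt_0_INR; lia).
  set (w := unity_root n).
  assert (E : csum (fun j => P (RtoC r * w ^ j) * (w ^ j) ^ (n - k))%C n
              = (RtoC (INR n) * (a k * RtoC (r ^ k)))%C).
  { rewrite (csum_ext _ (fun j => csum (fun i => a i * RtoC (r ^ i) * (w ^ (i + (n - k))) ^ j)%C n)).
    - rewrite csum_exchange, (csum_single _ n k Hk).
      + rewrite csum_scal. unfold w. rewrite unity_root_sum_dvd; [ring|lia|].
        replace (k + (n - k))%nat with n by lia. apply Nat.Div0.mod_same.
      + intros i Hi Hik. rewrite csum_scal. unfold w. rewrite unity_root_sum; [ring|lia|].
        destruct (Nat.lt_ge_cases i k).
        * rewrite Nat.mod_small by lia. lia.
        * replace (i + (n - k))%nat with ((i - k) + 1 * n)%nat by lia.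
          rewrite Nat.Div0.mod_add, Nat.mod_small by lia. lia.
    - intros j Hj. rewrite HP, Cmult_comm, <- csum_scal. apply csum_ext. intros i Hi.
      rewrite Cpow_mult_l, RtoC_pow. rewrite <- !Cpow_mult_r.
      replace ((i + (n - k)) * j)%nat with (j * (n - k) + j * i)%nat by ring.
      rewrite Cpow_add_r. ring. }
  assert (HB : Cmod (RtoC (INR n) * (a k * RtoC (r ^ k)))%C <= INR n * M).
  { rewrite <- E, <- (rsum_const M n). apply Cmod_csum_le. intros j Hj.
    rewrite Cmod_mult, <- Cpow_mult_r. unfold w. rewrite Cmod_unity_root_pow, Rmult_1_r.
    apply HM. rewrite Cmod_mult, Cmod_unity_root_pow, Cmod_R, Rabs_pos_eq; lra. }
  rewrite !Cmod_mult, !Cmod_R, (Rabs_pos_eq (INR n)), (Rabs_pos_eq (r ^ k)) in HB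
    by (try apply pow_le; lra).
  nra.
Qed.

Lemma poly_remainder_bound P n a r M K z :
  poly_repr P n a -> 0 < r -> (forall z, Cmod z <= r -> Cmod (P z) <= M) ->
  Cmod z <= r / 2 ->
  Cmod (P z - csum (fun k => a k * z ^ k) K)%C <= 2 * M * (Cmod z / r) ^ K.
Proof.
  intros HP Hr HM Hz.
  assert (Hco := fun k => poly_coef_bound P n a r M k HP ltac:(lra) HM).
  assert (HM0 : 0 <= M).
  { eapply Rle_trans; [apply Cmod_ge_0 | apply (HM 0%C)]. rewrite Cmod_0; lra. }
  destruct (poly_repr_enlarge _ _ (K + n) _ HP ltac:(lia)) as [_ E]. rewrite E, csum_add.
  replace (csum (fun k => a k * z ^ k) K + csum (fun k => a (K + k)%nat * z ^ (K + k)) n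
    - csum (fun k => a k * z ^ k) K)%C with (csum (fun k => a (K + k)%nat * z ^ (K + k))%C n) by ring.
  set (q := Cmod z / r).
  assert (Hq : 0 <= q) by (apply Rdiv_le_0_compat; [apply Cmod_ge_0|auto]).
  assert (Hq2 : q <= 1 / 2).
  { apply Rdiv_le_of_mult; lra. }
  eapply Rle_trans; [apply Cmod_csum_le with (M := fun k => M * q ^ K * (1/2) ^ k)|].
  - intros k _. rewrite Cmod_mult, Cmod_pow. specialize (Hco (K + k)%nat).
    replace (Cmod z) with (q * r) by (unfold q; field; lra).
    rewrite Rpow_mult_distr.
    replace (Cmod (a (K + k)%nat) * (q ^ (K + k) * r ^ (K + k))) with
      (Cmod (a (K + k)%nat) * r ^ (K + k) * q ^ (K + k)) by ring.
    apply Rle_trans with (M * q ^ (K + k)).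
    + apply Rmult_le_compat_r; auto. apply pow_le; auto.
    + rewrite pow_add, Rmult_assoc. apply Rmult_le_compat_l; auto.
      apply Rmult_le_compat_l; [apply pow_le; auto|]. apply pow_incr; auto.
  - rewrite rsum_scal. assert (H := geometric_sum_half n).
    assert (0 <= M * q ^ K) by (apply Rmult_le_pos; auto; apply pow_le; auto).
    fold q. replace (2 * M * q ^ K) with (M * q ^ K * 2) by ring.
    apply Rmult_le_compat_l; auto.
Qed.

(** Holomorphy at [p], as uniform approximability by polynomials on a closed
    disc: stable under products and uniform limits by its very form, and
    sufficient for the identity theorem. *)
Definition approx (f : C -> C) (p : C) (r : R) : Prop :=
  forall eps, 0 < eps ->
  exists P, is_poly P /\ forall z, Cmod z <= r -> Cmod (f (p + z)%C - P z) < eps.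

Lemma approx_ext f g p r :
  (forall z, Cmod z <= r -> f (p + z)%C = g (p + z)%C) -> approx f p r -> approx g p r.
Proof.
  intros E H e He. destruct (H e He) as (P & HP & H1). exists P. split; auto.
  intros z Hz. rewrite <- E by auto. auto.
Qed.

Lemma approx_mono f p r r' : r' <= r -> approx f p r -> approx f p r'.
Proof.
  intros Hr H e He. destruct (H e He) as (P & HP & H1). exists P. split; auto.
  intros z Hz. apply H1. lra.
Qed.

Lemma approx_limit f p r :
  (forall eps, 0 < eps -> exists g, approx g p r /\
     forall z, Cmod z <= r -> Cmod (f (p + z)%C - g (p + z)%C) < eps) -> approx f p r.
Proof.
  intros H e He. destruct (H (e/2) ltac:(lra)) as (g & Hg & H1).
  destruct (Hg (e/2) ltac:(lra)) as (P & HP & H2). exists P. split; auto.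
  intros z Hz. specialize (H1 z Hz). specialize (H2 z Hz).
  replace (f (p + z) - P z)%C with ((f (p + z) - g (p + z)) + (g (p + z) - P z))%C by ring.
  eapply Rle_lt_trans; [apply Cmod_triangle|]. lra.
Qed.

Lemma approx_ucv u f p r :
  (forall n, approx (u n) p r) ->
  ucv (fun s => Cmod (s - p) <= r) u f -> approx f p r.
Proof.
  intros Hu H. apply approx_limit. intros e He. destruct (H e He) as [N HN].
  exists (u N). split; auto. intros z Hz. rewrite Cmod_minus_sym. apply HN; auto.
  replace (p + z - p)%C with z by ring. auto.
Qed.

Lemma approx_poly P p r : is_poly P -> approx (fun s => P (s - p)%C) p r.
Proof.
  intros HP e He. exists P. split; auto. intros z _.
  replace (p + z - p)%C with z by ring. replace (P z - P z)%C with (RtoC 0) by ring.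
  now rewrite Cmod_0.
Qed.

Lemma approx_const c p r : approx (fun _ => c) p r.
Proof. apply (approx_poly (fun _ => c)), is_poly_const. Qed.

Lemma poly_bounded P r : is_poly P -> exists M, 0 <= M /\ forall z, Cmod z <= r -> Cmod (P z) <= M.
Proof.
  intros (n & a & _ & H).
  exists (rsum (fun k => Cmod (a k) * Rabs r ^ k) n). split.
  - apply rsum_nonneg. intros. apply Rmult_le_pos; [apply Cmod_ge_0 | apply pow_le, Rabs_pos].
  - intros z Hz. rewrite H. apply Cmod_csum_le. intros k _. rewrite Cmod_mult, Cmod_pow.
    apply Rmult_le_compat_l; [apply Cmod_ge_0|]. apply pow_incr. split; [apply Cmod_ge_0|].
    eapply Rle_trans; [exact Hz | apply Rle_abs].
Qed.

Lemma approx_bounded f p r : approx f p r ->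
  exists M, 0 <= M /\ forall z, Cmod z <= r -> Cmod (f (p + z)%C) <= M.
Proof.
  intros H. destruct (H 1 ltac:(lra)) as (P & HP & H1).
  destruct (poly_bounded P r HP) as (M & HM0 & HM). exists (M + 1). split; [lra|].
  intros z Hz. specialize (H1 z Hz). specialize (HM z Hz).
  generalize (Cmod_triangle_rev (f (p + z)%C) (P z)). lra.
Qed.

Lemma approx_plus f g p r : approx f p r -> approx g p r -> approx (fun s => f s + g s)%C p r.
Proof.
  intros Hf Hg e He.
  destruct (Hf (e/2) ltac:(lra)) as (P & HP & H1). destruct (Hg (e/2) ltac:(lra)) as (Q & HQ & H2).
  exists (fun z => P z + Q z)%C. split; [apply is_poly_plus; auto|].
  intros z Hz. specialize (H1 z Hz). specialize (H2 z Hz).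
  replace (f (p + z) + g (p + z) - (P z + Q z))%C with ((f (p + z) - P z) + (g (p + z) - Q z))%C by ring.
  eapply Rle_lt_trans; [apply Cmod_triangle|]. lra.
Qed.

Lemma approx_mult f g p r : approx f p r -> approx g p r -> approx (fun s => f s * g s)%C p r.
Proof.
  intros Hf Hg.
  destruct (approx_bounded _ _ _ Hf) as (A & HA0 & HA).
  destruct (approx_bounded _ _ _ Hg) as (B & HB0 & HB).
  intros e He.
  set (K := A + B + 1). set (d := Rmin 1 (e / (2 * K))).
  assert (HK : 1 <= K) by (unfold K; lra).
  assert (Hd : 0 < d) by (apply Rmin_pos; [lra | apply Rdiv_lt_0_compat; lra]).
  assert (Hd1 : d <= 1) by apply Rmin_l.
  assert (Hd2 : d * (2 * K) <= e).
  { apply Rle_trans with (e / (2 * K) * (2 * K)).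
    - apply Rmult_le_compat_r; [lra | apply Rmin_r].
    - right; field; lra. }
  destruct (Hf d Hd) as (P & HP & H1). destruct (Hg d Hd) as (Q & HQ & H2).
  exists (fun z => P z * Q z)%C. split; [apply is_poly_mult; auto|].
  intros z Hz. specialize (H1 z Hz). specialize (H2 z Hz). specialize (HA z Hz). specialize (HB z Hz).
  replace (f (p + z) * g (p + z) - P z * Q z)%C with
    ((f (p + z) - P z) * g (p + z) + f (p + z) * (g (p + z) - Q z)
     - (f (p + z) - P z) * (g (p + z) - Q z))%C by ring.
  eapply Rle_lt_trans; [apply Cmod_triangle_minus|].
  eapply Rle_lt_trans; [apply Rplus_le_compat_r, Cmod_triangle|]. rewrite !Cmod_mult.
  assert (P1 := Cmod_ge_0 (f (p + z)%C - P z)). assert (P2 := Cmod_ge_0 (g (p + z)%C - Q z)).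
  assert (P3 := Cmod_ge_0 (f (p + z)%C)). assert (P4 := Cmod_ge_0 (g (p + z)%C)).
  unfold K in Hd2. nra.
Qed.

Lemma approx_pow f p r m : approx f p r -> approx (fun s => f s ^ m)%C p r.
Proof.
  intros Hf. induction m; simpl; [apply approx_const|]. apply approx_mult; auto.
Qed.

Lemma approx_scal c f p r : approx f p r -> approx (fun s => c * f s)%C p r.
Proof. intros Hf. apply approx_mult; auto. apply approx_const. Qed.

Lemma approx_minus f g p r : approx f p r -> approx g p r -> approx (fun s => f s - g s)%C p r.
Proof.
  intros Hf Hg. apply (approx_ext (fun s => f s + - (1) * g s)%C); [intros; ring|].
  apply approx_plus; auto. apply approx_scal; auto.
Qed.

Lemma approx_csum (u : nat -> C -> C) n p r :
  (forall k, (k < n)%nat -> approx (u k) p r) -> approx (fun s => csum (fun k => u k s) n) p r.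
Proof.
  induction n; intros H; cbn [csum]; [apply approx_const|].
  apply approx_plus; auto.
Qed.

Lemma approx_minus_center p r : approx (fun s => s - p)%C p r.
Proof.
  apply (approx_poly (fun z => z)).
  apply (is_poly_ext (fun z => z * 1)%C); [intros; ring|]. apply is_poly_X_mult, is_poly_const.
Qed.

Lemma approx_Cexp c p r : approx (fun s => Cexp (c * s)) p r.
Proof.
  apply (approx_ext (fun s => Cexp (c * p) * Cexp (c * (s - p)))%C).
  { intros z _. rewrite <- Cexp_plus. f_equal. ring. }
  apply approx_scal.
  set (R0 := Cmod c * Rabs r).
  assert (HR : 0 <= R0) by (apply Rmult_le_pos; [apply Cmod_ge_0 | apply Rabs_pos]).
  apply (approx_ucv (fun n s => csum (fun k => (c * (s - p)) ^ k / RtoC (INR (fact k))) n)%C).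
  - intros n. apply (approx_ext (fun s => csum (fun k => (c ^ k / RtoC (INR (fact k))) * (s - p) ^ k) n)%C).
    { intros z _. apply csum_ext. intros k _. rewrite Cpow_mult_l. unfold Cdiv. ring. }
    apply (approx_poly (fun z => csum (fun k => (c ^ k / RtoC (INR (fact k))) * z ^ k) n)%C).
    apply is_poly_csum.
  - apply (ucv_bound _ _ _ (fun n => exp R0 * (R0 ^ n / INR (fact n)))).
    + apply is_lim_seq_scal_0. apply is_lim_seq_Reals, cv_speed_pow_fact.
    + exists 0%nat. intros n s _ Hs. rewrite Cmod_minus_sym.
      assert (Hz : Cmod (c * (s - p)) <= R0).
      { rewrite Cmod_mult. apply Rmult_le_compat_l; [apply Cmod_ge_0|].
        eapply Rle_trans; [exact Hs | apply Rle_abs]. }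
      eapply Rle_trans; [apply Cexp_taylor|]. unfold Rdiv. rewrite Rmult_assoc.
      assert (H0 := Cmod_ge_0 (c * (s - p))).
      apply Rmult_le_compat.
      * left; apply exp_pos.
      * apply Rmult_le_pos; [apply pow_le; auto | left; apply Rinv_0_lt_compat, INR_fact_lt_0].
      * apply exp_monotone; exact Hz.
      * apply Rmult_le_compat_r; [left; apply Rinv_0_lt_compat, INR_fact_lt_0|].
        apply pow_incr; auto.
Qed.

Lemma approx_compose_scal f c p r :
  approx f (c * p)%C (Cmod c * r) -> approx (fun s => f (c * s)%C) p r.
Proof.
  intros H e He. destruct (H e He) as (P & (n & a & H0 & HP) & H1).
  exists (fun z => P (c * z)%C). split.
  - exists n, (fun k => a k * c ^ k)%C. split.
    + intros k Hk. rewrite H0 by auto. ring.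
    + intros z. rewrite HP. apply csum_ext. intros k _. rewrite Cpow_mult_l. ring.
  - intros z Hz. rewrite Cmult_plus_distr_l. apply H1. rewrite Cmod_mult.
    apply Rmult_le_compat_l; auto. apply Cmod_ge_0.
Qed.

(** Identity theorem.  The Taylor coefficients of a close approximating
    polynomial are shown to be small one after another: at a zero close to the
    centre, the lowest nonzero coefficient would dominate. *)
Lemma approx_identity f p r : 0 < r -> approx f p r ->
  (forall d, 0 < d -> exists z, 0 < Cmod z < d /\ f (p + z)%C = 0%C) ->
  forall z, Cmod z <= r / 2 -> f (p + z)%C = 0%C.
Proof.
  intros Hr Hf Hz.
  destruct (approx_bounded _ _ _ Hf) as (M0 & HM00 & HM0).
  set (M := M0 + 1).
  assert (HPM : forall P e, e <= 1 -> (forall z, Cmod z <= r -> Cmod (f (p + z)%C - P z) < e) ->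
     forall z, Cmod z <= r -> Cmod (P z) <= M).
  { intros P e He HP z Hzr. specialize (HP z Hzr). specialize (HM0 z Hzr).
    generalize (Cmod_triangle_rev (P z) (f (p + z)%C)). rewrite Cmod_minus_sym. unfold M. lra. }
  assert (Hcoef : forall k eta, 0 < eta -> exists e0, 0 < e0 <= 1 /\
     forall P n a, poly_repr P n a ->
       (forall z, Cmod z <= r -> Cmod (f (p + z)%C - P z) < e0) ->
       forall j, (j < k)%nat -> Cmod (a j) <= eta).
  { induction k as [|k IH]; intros eta Heta.
    - exists 1. split; [lra|]. intros; lia.
    - assert (Hrk : 0 < r ^ S k) by (apply pow_lt; auto).
      set (d := Rmin (Rmin 1 (r / 2)) (eta * r ^ S k / (4 * (M + 1)))).
      assert (Hd : 0 < d).
      { apply Rmin_pos; [apply Rmin_pos; lra | apply Rdiv_lt_0_compat; [nra| unfold M; lra]]. }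
      destruct (Hz d Hd) as (z & [Hz0 Hzd] & Hfz).
      assert (Hz1 : Cmod z <= 1) by (eapply Rle_trans; [left; exact Hzd|]; eapply Rle_trans; [apply Rmin_l | apply Rmin_l]).
      assert (Hz2 : Cmod z <= r / 2) by (eapply Rle_trans; [left; exact Hzd|]; eapply Rle_trans; [apply Rmin_l | apply Rmin_r]).
      assert (Hz3 : Cmod z <= eta * r ^ S k / (4 * (M + 1))) by (eapply Rle_trans; [left; exact Hzd| apply Rmin_r]).
      assert (Hzk : 0 < Cmod z ^ k) by (apply pow_lt; auto).
      assert (HkS : 0 < INR (S k)) by apply INR_S_pos.
      set (eta' := Rmin eta (eta * Cmod z ^ k / (4 * INR (S k)))).
      assert (Heta' : 0 < eta') by (apply Rmin_pos; [auto | apply Rdiv_lt_0_compat; nra]).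
      assert (Heta'2 : INR (S k) * eta' <= eta * Cmod z ^ k / 4).
      { apply Rle_trans with (INR (S k) * (eta * Cmod z ^ k / (4 * INR (S k)))).
        - apply Rmult_le_compat_l; [lra | apply Rmin_r].
        - right; field; lra. }
      destruct (IH eta' Heta') as (e1 & He1 & H1).
      exists (Rmin e1 (eta * Cmod z ^ k / 4)).
      split; [split; [apply Rmin_pos; nra | eapply Rle_trans; [apply Rmin_l|lra]]|].
      intros P n a HP HPf.
      assert (HPf1 : forall z, Cmod z <= r -> Cmod (f (p + z)%C - P z) < e1).
      { intros y Hy. eapply Rlt_le_trans; [apply HPf, Hy | apply Rmin_l]. }
      specialize (H1 P n a HP HPf1).
      intros j Hj. destruct (Nat.eq_dec j k) as [->|Hjk].
      2:{ eapply Rle_trans; [apply H1; lia | apply Rmin_l]. }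
      assert (HB := HPM P e1 ltac:(lra) HPf1).
      assert (Hrem := poly_remainder_bound P n a r M (S k) z HP Hr HB Hz2).
      assert (HPz : Cmod (P z) <= eta * Cmod z ^ k / 4).
      { specialize (HPf z ltac:(lra)). rewrite Hfz in HPf.
        replace (0 - P z)%C with (- P z)%C in HPf by ring. rewrite Cmod_opp in HPf.
        left. eapply Rlt_le_trans; [exact HPf | apply Rmin_r]. }
      assert (Hlow : Cmod (csum (fun k => a k * z ^ k)%C k) <= eta * Cmod z ^ k / 4).
      { eapply Rle_trans; [apply Cmod_csum_le with (M := fun _ => eta')|].
        - intros i Hi. rewrite Cmod_mult, Cmod_pow. specialize (H1 i Hi).
          assert (Cmod z ^ i <= 1) by (rewrite <- (pow1 i); apply pow_incr; lra).
          assert (0 <= Cmod z ^ i) by (apply pow_le; lra).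
          assert (0 <= Cmod (a i)) by apply Cmod_ge_0. nra.
        - rewrite rsum_const. rewrite S_INR in Heta'2. nra. }
      assert (Htail : 2 * M * (Cmod z / r) ^ S k <= eta * Cmod z ^ k / 2).
      { unfold Rdiv at 1. rewrite Rpow_mult_distr, pow_inv. simpl (Cmod z ^ S k).
        apply Rmult_le_reg_r with (r ^ S k); auto.
        replace (2 * M * (Cmod z * Cmod z ^ k * / r ^ S k) * r ^ S k) with
          (Cmod z ^ k * (2 * M * Cmod z)) by (field; lra).
        replace (eta * Cmod z ^ k / 2 * r ^ S k) with (Cmod z ^ k * (eta * r ^ S k / 2)) by field.
        apply Rmult_le_compat_l; [lra|].
        apply Rle_trans with (2 * (M + 1) * (eta * r ^ S k / (4 * (M + 1)))).
        - apply Rmult_le_compat; unfold M in *; lra.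
        - right. field. unfold M; lra. }
      cbn [csum] in Hrem.
      assert (Hmain : Cmod (a k * z ^ k)%C <= eta * Cmod z ^ k).
      { replace (a k * z ^ k)%C with
          (P z - (csum (fun k => a k * z ^ k) k) - (P z - (csum (fun k => a k * z ^ k) k + a k * z ^ k)))%C by ring.
        eapply Rle_trans; [apply Cmod_triangle_minus|].
        assert (H := Cmod_triangle_minus (P z) (csum (fun k => a k * z ^ k)%C k)). lra. }
      rewrite Cmod_mult, Cmod_pow in Hmain. apply Rmult_le_reg_r with (Cmod z ^ k); auto. }
  intros z Hzr. apply Cmod_eq_0.
  apply Rle_antisym; [|apply Cmod_ge_0]. apply le_epsilon. intros e He. rewrite Rplus_0_l.
  destruct (pow_lt_1_zero (1/2) ltac:(rewrite Rabs_pos_eq; lra) (e / (4 * (M + 1)))) as [K HK].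
  { apply Rdiv_lt_0_compat; unfold M; lra. }
  specialize (HK K (le_n K)). rewrite Rabs_pos_eq in HK by (apply pow_le; lra).
  set (T := rsum (fun k => Cmod z ^ k) K).
  assert (HT : 0 <= T) by (apply rsum_nonneg; intros; apply pow_le, Cmod_ge_0).
  destruct (Hcoef K (e / (4 * (T + 1)))) as (e0 & He0 & Hc); [apply Rdiv_lt_0_compat; lra|].
  destruct (Hf (Rmin e0 (e/4))) as (P & (n & a & HP) & HPf); [apply Rmin_pos; lra|].
  assert (HPf1 : forall z, Cmod z <= r -> Cmod (f (p + z)%C - P z) < e0).
  { intros y Hy. eapply Rlt_le_trans; [apply HPf, Hy | apply Rmin_l]. }
  assert (HPz : Cmod (f (p + z)%C - P z) < e / 4).
  { eapply Rlt_le_trans; [apply HPf; lra | apply Rmin_r]. }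
  specialize (Hc P n a HP HPf1).
  assert (HB := HPM P e0 ltac:(lra) HPf1).
  assert (Hrem := poly_remainder_bound P n a r M K z HP Hr HB Hzr).
  assert (Hlow : Cmod (csum (fun k => a k * z ^ k)%C K) <= e / 4).
  { eapply Rle_trans; [apply Cmod_csum_le with (M := fun k => e / (4 * (T + 1)) * Cmod z ^ k)|].
    - intros i Hi. rewrite Cmod_mult, Cmod_pow. apply Rmult_le_compat_r; auto. apply pow_le, Cmod_ge_0.
    - rewrite rsum_scal. change (rsum (pow (Cmod z)) K) with T. apply Rmult_le_reg_r with (4 * (T + 1)); [lra|].
      replace (e / (4 * (T + 1)) * T * (4 * (T + 1))) with (e * T) by (field; lra).
      replace (e / 4 * (4 * (T + 1))) with (e * T + e) by field. lra. }
  assert (Htail : 2 * M * (Cmod z / r) ^ K <= e / 2).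
  { apply Rle_trans with (2 * (M + 1) * (e / (4 * (M + 1)))).
    - apply Rmult_le_compat; [unfold M; lra| |unfold M; lra|].
      + apply pow_le, Rdiv_le_0_compat; [apply Cmod_ge_0|auto].
      + eapply Rle_trans; [|left; exact HK]. apply pow_incr. split.
        * apply Rdiv_le_0_compat; [apply Cmod_ge_0|auto].
        * apply Rdiv_le_of_mult; lra.
    - right. field. unfold M; lra. }
  replace (f (p + z)%C) with ((f (p + z) - P z) + (csum (fun k => a k * z ^ k) K)
    + (P z - csum (fun k => a k * z ^ k) K))%C by ring.
  eapply Rle_trans; [apply Cmod_triangle|].
  eapply Rle_trans; [apply Rplus_le_compat_r, Cmod_triangle|]. lra.
Qed.

(** * Meromorphic functions and the identity theorem along segments *)

Lemma is_series_Ccv (u : nat -> C) (l : C) :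
  @is_series C_AbsRing C_NormedModule u l -> Ccv (csum u) l.
Proof.
  intros H.
  assert (E : forall n, @sum_n C_AbelianMonoid u n = csum u (S n)).
  { induction n as [|n IH].
    - rewrite sum_O. cbn [csum]. symmetry. apply Cplus_0_l.
    - rewrite sum_Sn, IH. reflexivity. }
  intros e He.
  assert (H2 : 0 < sqrt 2) by (apply sqrt_lt_R0; lra).
  assert (He' : 0 < e / sqrt 2) by (apply Rdiv_lt_0_compat; auto).
  assert (HL := proj1 (filterlim_locally _ _) H (mkposreal _ He')).
  destruct HL as [N HN]. exists (S N). intros n Hn.
  destruct n as [|n]; [lia|].
  specialize (HN n ltac:(lia)). apply C_NormedModule_mixin_compat2 in HN.
  rewrite E in HN. simpl in HN.
  replace (sqrt 2 * (e / sqrt 2)) with e in HN by (field; lra). exact HN.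
Qed.

Lemma locally_Cmod (p : C) (P : C -> Prop) :
  locally p P -> exists r, 0 < r /\ forall z, Cmod (z - p) < r -> P z.
Proof.
  intros [e He]. exists e. split; [apply cond_pos|].
  intros z Hz. apply He. apply C_NormedModule_mixin_compat1. exact Hz.
Qed.

(** The partial sums of the power series approximate: its terms are bounded at
    one point of convergence, so the tails are geometric on a smaller disc. *)
Lemma analytic_at_approx (f : C -> C) (p : C) :
  analytic_at f p -> exists r, 0 < r /\ approx f p r.
Proof.
  intros [a Ha]. destruct (locally_Cmod _ _ Ha) as (r & Hr & H).
  set (rho := r / 2).
  assert (Hrho : 0 < rho) by (unfold rho; lra).
  assert (Hser : forall z, Cmod z < r -> Ccv (csum (fun k => a k * z ^ k)%C) (f (p + z)%C)).
  { intros z Hz.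
    assert (Hz' : Cmod ((p + z) - p) < r) by (replace (p + z - p)%C with z by ring; auto).
    specialize (H _ Hz'). apply is_series_Ccv in H.
    replace (p + z - p)%C with z in H by ring.
    apply (Ccv_ext (csum (fun k => @scal C_AbsRing C_NormedModule (@pow_n C_AbsRing z k) (a k)))); auto.
    intros n. apply csum_ext. intros k _.
    assert (E : forall k, @pow_n C_AbsRing z k = (z ^ k)%C).
    { clear. induction k; simpl; auto. }
    rewrite E. change (z ^ k * a k = a k * z ^ k)%C. ring. }
  assert (HM : exists M, 0 <= M /\ forall k, Cmod (a k) * rho ^ k <= M).
  { assert (Hc := Hser (RtoC rho) ltac:(rewrite Cmod_R, Rabs_pos_eq; unfold rho; lra)).
    destruct (Hc 1 ltac:(lra)) as [N HN].
    set (M1 := rsum (fun k => Cmod (a k) * rho ^ k) N).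
    assert (Hpos : forall k, 0 <= Cmod (a k) * rho ^ k)
      by (intros; apply Rmult_le_pos; [apply Cmod_ge_0 | apply pow_le; lra]).
    assert (HM1 : 0 <= M1) by (apply rsum_nonneg; auto).
    exists (M1 + 2). split; [lra|]. intros k.
    destruct (Nat.lt_ge_cases k N) as [Hk|Hk].
    - assert (Hle : Cmod (a k) * rho ^ k <= M1); [|lra].
      unfold M1. clear - Hk Hpos. induction N; [lia|]. cbn [rsum].
      destruct (Nat.eq_dec k N) as [->|].
      + assert (0 <= rsum (fun k => Cmod (a k) * rho ^ k) N) by (apply rsum_nonneg; auto). lra.
      + specialize (IHN ltac:(lia)). specialize (Hpos N). lra.
    - assert (H1 := HN k Hk). assert (H2 := HN (S k) ltac:(lia)). cbn [csum] in H2.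
      set (s := csum (fun k => a k * RtoC rho ^ k)%C k) in *.
      assert (E : Cmod (a k) * rho ^ k = Cmod (a k * RtoC rho ^ k)%C).
      { rewrite Cmod_mult, Cmod_pow, Cmod_R, Rabs_pos_eq by lra. reflexivity. }
      rewrite E.
      replace (a k * RtoC rho ^ k)%C with ((s + a k * RtoC rho ^ k - f (p + RtoC rho)) - (s - f (p + RtoC rho)))%C by ring.
      eapply Rle_trans; [apply Cmod_triangle_minus|]. lra. }
  destruct HM as (M & HM0 & HM).
  exists (rho / 2). split; [lra|].
  apply (approx_ucv (fun n s => csum (fun k => a k * (s - p) ^ k)%C n)).
  - intros n. apply (approx_poly (fun z => csum (fun k => a k * z ^ k)%C n)). apply is_poly_csum.
  - apply (ucv_bound _ _ _ (fun n => 2 * M * (1/2) ^ n)).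
    + apply is_lim_seq_scal_0, is_lim_seq_geom. rewrite Rabs_pos_eq; lra.
    + exists 0%nat. intros n s _ Hs.
      set (z := (s - p)%C) in *.
      replace (f s) with (f (p + z)%C) by (f_equal; unfold z; ring).
      rewrite Cmod_minus_sym.
      apply (Ccv_Cmod_le (fun m => csum (fun k => a k * z ^ k) m - csum (fun k => a k * z ^ k) n)%C _ _ n).
      * apply Ccv_minus; [apply Hser; unfold rho in *; lra | apply Ccv_const].
      * intros m Hm. replace m with (n + (m - n))%nat by lia. rewrite csum_add.
        match goal with |- Cmod (?x + ?y - ?x) <= _ => replace (x + y - x)%C with y by ring end.
        eapply Rle_trans; [apply Cmod_csum_le with (M := fun k => M * (1/2) ^ n * (1/2) ^ k)|].
        -- intros k _. rewrite Cmod_mult, Cmod_pow, Rmult_assoc, <- pow_add.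
           apply Rle_trans with (Cmod (a (n + k)%nat) * (rho * (1/2)) ^ (n + k)).
           ++ apply Rmult_le_compat_l; [apply Cmod_ge_0|]. apply pow_incr. split; [apply Cmod_ge_0|lra].
           ++ rewrite Rpow_mult_distr, <- Rmult_assoc. apply Rmult_le_compat_r; auto. apply pow_le; lra.
        -- rewrite rsum_scal. assert (HG := geometric_sum_half (m - n)).
           replace (2 * M * (1/2) ^ n) with (M * (1/2) ^ n * 2) by ring.
           apply Rmult_le_compat_l; auto. apply Rmult_le_pos; auto. apply pow_le; lra.
Qed.

Section Identity.
Variables Z F G : C -> C.
Hypothesis HZ : meromorphic Z.
Hypothesis HF : forall p, exists r, 0 < r /\ approx F p r.
Hypothesis HG : forall p, exists r, 0 < r /\ approx G p r.

(** Punctured neighbourhoods, because the values of [Z] at its poles are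
    irrelevant. *)
Let good (q : C) : Prop :=
  exists e, 0 < e /\ forall z, 0 < Cmod z < e -> (Z (q + z) * G (q + z) = F (q + z))%C.

Let adherent (q : C) : Prop :=
  forall d, 0 < d -> exists z, 0 < Cmod z < d /\ (Z (q + z) * G (q + z) = F (q + z))%C.

Lemma identity_at_analytic q : analytic_at Z q -> adherent q ->
  exists e, 0 < e /\ forall z, Cmod z < e -> (Z (q + z) * G (q + z) = F (q + z))%C.
Proof.
  intros Ha Hq.
  destruct (analytic_at_approx _ _ Ha) as (r1 & Hr1 & A1).
  destruct (HF q) as (r2 & Hr2 & A2). destruct (HG q) as (r3 & Hr3 & A3).
  set (r := Rmin r1 (Rmin r2 r3)).
  assert (Hr : 0 < r) by (repeat apply Rmin_pos; auto).
  assert (r <= r1) by apply Rmin_l.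
  assert (r <= r2) by (eapply Rle_trans; [apply Rmin_r | apply Rmin_l]).
  assert (r <= r3) by (eapply Rle_trans; [apply Rmin_r | apply Rmin_r]).
  assert (A : approx (fun s => Z s * G s - F s)%C q r).
  { apply approx_minus; [apply approx_mult|];
    [apply approx_mono with r1 | apply approx_mono with r3 | apply approx_mono with r2]; auto. }
  exists (r / 2). split; [lra|]. intros z Hz.
  apply Ceq_minus. apply (approx_identity _ q r Hr A); [|lra].
  intros d Hd. destruct (Hq d Hd) as (y & Hy & E). exists y. split; auto. rewrite E. ring.
Qed.

(** Multiplication by [(s - q) ^ m] turns the relation into one between
    functions holomorphic at [q]; it is divided out again off [q], which is all
    that [good] asks for. *)
Lemma identity_at_pole q : pole_at Z q -> adherent q -> good q.
Proof.
  intros (m & g & Hm & Ha & Hg & HL) Hq.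
  destruct (locally_Cmod _ _ HL) as (r0 & Hr0 & H0).
  destruct (analytic_at_approx _ _ Ha) as (r1 & Hr1 & A1).
  destruct (HF q) as (r2 & Hr2 & A2). destruct (HG q) as (r3 & Hr3 & A3).
  set (r := Rmin r1 (Rmin r2 r3)).
  assert (Hr : 0 < r) by (repeat apply Rmin_pos; auto).
  assert (r <= r1) by apply Rmin_l.
  assert (r <= r2) by (eapply Rle_trans; [apply Rmin_r | apply Rmin_l]).
  assert (r <= r3) by (eapply Rle_trans; [apply Rmin_r | apply Rmin_r]).
  assert (A : approx (fun s => g s * G s - (s - q) ^ m * F s)%C q r).
  { apply approx_minus; [apply approx_mult|apply approx_mult; [apply approx_pow, approx_minus_center|]];
    [apply approx_mono with r1 | apply approx_mono with r3 | apply approx_mono with r2]; auto. }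
  assert (HZg : forall z, 0 < Cmod z < r0 ->
    Z (q + z)%C = (g (q + z) / z ^ m)%C /\ (z ^ m)%C <> 0%C).
  { intros z Hz.
    assert (Hz0 : z <> 0%C) by (apply Cmod_gt_0; lra).
    split; [|apply Cpow_nz; auto].
    replace (z ^ m)%C with ((q + z - q) ^ m)%C by (f_equal; ring).
    apply H0; [replace (q + z - q)%C with z by ring; lra|].
    intro E. apply Hz0. replace z with (q + z - q)%C by ring. rewrite E. ring. }
  exists (Rmin r0 (r / 2)). split; [apply Rmin_pos; lra|]. intros z Hz.
  assert (Hzr0 : Cmod z < r0) by (eapply Rlt_le_trans; [apply Hz | apply Rmin_l]).
  assert (Hzr : Cmod z < r / 2) by (eapply Rlt_le_trans; [apply Hz | apply Rmin_r]).
  assert (E := approx_identity _ q r Hr A).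
  assert (E1 : (g (q + z) * G (q + z) - (q + z - q) ^ m * F (q + z) = 0)%C).
  { apply E; [|lra]. intros d Hd.
    destruct (Hq (Rmin d r0)) as (y & Hy & Ey); [apply Rmin_pos; auto|].
    assert (Hyd : Cmod y < d) by (eapply Rlt_le_trans; [apply Hy | apply Rmin_l]).
    assert (Hyr : Cmod y < r0) by (eapply Rlt_le_trans; [apply Hy | apply Rmin_r]).
    exists y. split; [lra|].
    destruct (HZg y ltac:(lra)) as [E2 Hy0]. rewrite E2 in Ey. rewrite <- Ey.
    replace (q + y - q)%C with y by ring. field. auto. }
  destruct (HZg z ltac:(lra)) as [E2 Hz0]. rewrite E2.
  replace (q + z - q)%C with z in E1 by ring.
  apply Ceq_minus in E1. 
  replace (g (q + z) / z ^ m * G (q + z))%C with (g (q + z) * G (q + z) / z ^ m)%C by (field; auto).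
  rewrite E1. field. auto.
Qed.

Lemma adherent_good q : adherent q -> good q.
Proof.
  intros Hq. destruct (HZ q) as [Ha|Hp].
  - destruct (identity_at_analytic q Ha Hq) as (e & He & H). exists e. split; auto.
    intros z Hz. apply H; lra.
  - apply identity_at_pole; auto.
Qed.

Lemma Cmod_real_pos (x : R) : 0 < x -> Cmod (RtoC x) = x.
Proof. intros. rewrite Cmod_R, Rabs_pos_eq; lra. Qed.

Lemma good_neighbour q e : 0 < e -> (forall z, 0 < Cmod z < e -> (Z (q + z) * G (q + z) = F (q + z))%C) ->
  forall z, 0 < Cmod z < e -> good (q + z)%C.
Proof.
  intros He H z Hz. exists (Rmin (Cmod z) (e - Cmod z)).
  split; [apply Rmin_pos; lra|]. intros y Hy.
  assert (H1 : Cmod y < Cmod z) by (eapply Rlt_le_trans; [apply Hy | apply Rmin_l]).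
  assert (H2 : Cmod y < e - Cmod z) by (eapply Rlt_le_trans; [apply Hy | apply Rmin_r]).
  replace (q + z + y)%C with (q + (z + y))%C by ring. apply H. split.
  - assert (H3 := Cmod_triangle_rev z (- y)). rewrite Cmod_opp in H3.
    replace (z - - y)%C with (z + y)%C in H3 by ring. lra.
  - eapply Rle_lt_trans; [apply Cmod_triangle|]. lra.
Qed.

(** Starting from a half-plane, the relation is carried leftwards along a
    horizontal line: the points reached so far have a limit, which is adherent
    to the set of agreement, hence good, hence not the last one. *)
Theorem identity_theorem (c : R) :
  (forall s, c < Re s -> (Z s * G s = F s)%C) ->
  forall p, analytic_at Z p -> (Z p * G p = F p)%C.
Proof.
  intros Hc p Hp.
  assert (Hgood : forall q, c < Re q -> good q).
  { intros q Hq. exists (Re q - c). split; [lra|]. intros z Hz. apply Hc.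
    rewrite re_plus. assert (H := re_le_Cmod z). apply Rabs_le_between in H. lra. }
  set (b := c + 1).
  assert (Hgp : good p).
  { destruct (Rlt_dec c (Re p)) as [Hlt|Hge]; [apply Hgood; auto|].
    set (L := b - Re p).
    assert (HL : 1 <= L) by (unfold L, b; lra).
    set (pt := fun d => (p + RtoC (L - d))%C).
    assert (Hpt : forall d, Re (pt d) = b - d).
    { intros d. unfold pt. rewrite re_plus, re_RtoC. unfold L. ring. }
    set (E := fun d => 0 <= d <= L /\ forall y, 0 <= y <= d -> good (pt y)).
    assert (E0 : E 0).
    { split; [lra|]. intros y Hy. apply Hgood. rewrite Hpt. unfold b. lra. }
    destruct (completeness E) as [D [HD1 HD2]].
    { exists L. intros d [Hd _]. lra. }
    { exists 0; auto. }
    assert (HD0 : 0 <= D) by (apply HD1; auto).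
    assert (HDL : D <= L) by (apply HD2; intros d [Hd _]; lra).
    assert (Hbelow : forall y, 0 <= y < D -> good (pt y)).
    { intros y Hy.
      destruct (classic (exists d, E d /\ y < d)) as [(d & [Hd Hg] & Hyd)|Hn].
      - apply Hg; lra.
      - exfalso. assert (D <= y); [|lra]. apply HD2. intros d Hd.
        destruct (Rle_dec d y); auto. exfalso. apply Hn. exists d. split; auto. lra. }
    assert (HgD : good (pt D)).
    { destruct (Req_dec D 0) as [->|HDne]; [apply E0; lra|].
      apply adherent_good. intros d Hd.
      set (h := Rmin (D / 2) (d / 2)).
      assert (Hh : 0 < h) by (apply Rmin_pos; lra).
      assert (Hh1 : h <= D / 2) by apply Rmin_l. assert (Hh2 : h <= d / 2) by apply Rmin_r.
      destruct (Hbelow (D - h) ltac:(lra)) as (e & He & Hz).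
      set (k := Rmin (e / 2) (d / 4)).
      assert (Hk : 0 < k) by (apply Rmin_pos; lra).
      assert (Hk1 : k <= e / 2) by apply Rmin_l. assert (Hk2 : k <= d / 4) by apply Rmin_r.
      exists (RtoC (h + k)). rewrite Cmod_real_pos by lra. split; [lra|].
      specialize (Hz (RtoC k)). rewrite Cmod_real_pos in Hz by lra.
      replace (pt D + RtoC (h + k))%C with (pt (D - h)%R + RtoC k)%C; [apply Hz; lra|].
      unfold pt. replace (L - (D - h)) with ((L - D) + h) by ring. rewrite !RtoC_plus. ring. }
    destruct (Req_dec D L) as [HDe|HDne].
    - replace p with (pt D); auto. rewrite HDe. unfold pt.
      replace (L - L) with 0 by ring. ring.
    - exfalso. destruct HgD as (e & He & Hz).
      set (h := Rmin (L - D) (e / 2)).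
      assert (Hh : 0 < h) by (apply Rmin_pos; lra).
      assert (Hh1 : h <= L - D) by apply Rmin_l. assert (Hh2 : h <= e / 2) by apply Rmin_r.
      assert (E (D + h)).
      { split; [lra|]. intros y Hy. destruct (Rlt_le_dec y D) as [Hl|Hl]; [apply Hbelow; lra|].
        destruct (Req_dec y D) as [->|Hne]; [exists e; auto|].
        replace (pt y) with (pt D + RtoC (- (y - D)))%C.
        - apply (good_neighbour _ e He Hz). rewrite RtoC_opp, Cmod_opp, Cmod_real_pos by lra. lra.
        - unfold pt. replace (L - y) with ((L - D) + - (y - D)) by ring. rewrite RtoC_plus. ring. }
      specialize (HD1 _ H). lra. }
  assert (Hadh : adherent p).
  { destruct Hgp as (e & He & H). intros d Hd.
    set (h := Rmin (e / 2) (d / 2)).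
    assert (Hh : 0 < h) by (apply Rmin_pos; lra).
    assert (Hh1 : h <= e / 2) by apply Rmin_l. assert (Hh2 : h <= d / 2) by apply Rmin_r.
    exists (RtoC h). rewrite Cmod_real_pos by auto. split; [lra|]. apply H.
    rewrite Cmod_real_pos by auto. lra. }
  destruct (identity_at_analytic p Hp Hadh) as (e & He & H).
  specialize (H 0%C ltac:(rewrite Cmod_0; auto)). now rewrite Cplus_0_r in H.
Qed.

End Identity.

(** * The Fourier coefficients of a complex power of the sine *)

(** The ratio of the Fourier coefficients of index [k] and [0] of the
    [1]-periodic even function [sin (pi x) ^ (2 a)]. *)
Fixpoint fcoef (a : C) (k : nat) : C :=
  match k with
  | O => 1%C
  | S j => (fcoef a j * ((RtoC (INR j) - a) / (RtoC (INR (S j)) + a)))%C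
  end.

Lemma shift_neq_0 (x : R) (a : C) : 0 < x + Re a -> (RtoC x + a)%C <> 0%C.
Proof.
  intros H E. assert (E' := f_equal Re E). rewrite re_plus, re_RtoC in E'.
  change (Re 0%C) with 0 in E'. lra.
Qed.

Lemma INR_S_shift_neq_0 (k : nat) (a : C) : 0 < Re a -> (RtoC (INR (S k)) + a)%C <> 0%C.
Proof. intros H. apply shift_neq_0. generalize (INR_S_pos k). lra. Qed.

Lemma fcoef_rec a k : 0 < Re a ->
  (fcoef a (S k) * (RtoC (INR (S k)) + a) = fcoef a k * (RtoC (INR k) - a))%C.
Proof.
  intros Ha. cbn [fcoef]. field. apply INR_S_shift_neq_0; auto.
Qed.

Lemma Rinv_sqr_sum_tail (n m : nat) : (1 <= n)%nat ->
  rsum (fun k => / INR (n + k) ^ 2) m <= 2 / INR n - 2 / INR (n + m).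
Proof.
  intros Hn. induction m; cbn [rsum].
  - rewrite Nat.add_0_r. lra.
  - rewrite Nat.add_succ_r, S_INR.
    assert (1 <= INR (n + m)) by (apply (le_INR 1); lia).
    assert (/ INR (n + m) ^ 2 <= 2 / INR (n + m) - 2 / (INR (n + m) + 1)); [|lra].
    replace (2 / INR (n + m) - 2 / (INR (n + m) + 1)) with
      (2 / (INR (n + m) * (INR (n + m) + 1))) by (field; lra).
    apply Rmult_le_reg_r with (INR (n + m) ^ 2 * (INR (n + m) + 1)); [nra|].
    replace (/ INR (n + m) ^ 2 * (INR (n + m) ^ 2 * (INR (n + m) + 1))) with (INR (n + m) + 1) by (field; lra).
    replace (2 / (INR (n + m) * (INR (n + m) + 1)) * (INR (n + m) ^ 2 * (INR (n + m) + 1)))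
      with (2 * INR (n + m)) by (field; lra). lra.
Qed.

Section SlowProduct.
Variables (x : nat -> C) (A B : R).
Hypothesis HB : 0 <= B.
Hypothesis Hx1 : Cmod (x 1%nat) <= A.
Hypothesis Hx : forall n, (1 <= n)%nat -> Cmod (x (S n) - x n) <= B / INR n ^ 2 * Cmod (x n).

(** The sequence is an infinite product with factors [1 + O(1 / n ^ 2)].  Such
    products are bounded, converge at rate [1 / n], and vanish in the limit only
    if a factor does. *)
Lemma slow_product_bounded n : (1 <= n)%nat -> Cmod (x n) <= A * exp (2 * B).
Proof.
  assert (HA : 0 <= A) by (eapply Rle_trans; [apply Cmod_ge_0 | exact Hx1]).
  assert (H : forall m, Cmod (x (1 + m)%nat) <= A * exp (B * rsum (fun k => / INR (1 + k) ^ 2) m)).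
  { induction m; cbn [rsum].
    - rewrite Rmult_0_r, exp_0, Rmult_1_r. exact Hx1.
    - specialize (Hx (1 + m)%nat ltac:(lia)).
      rewrite Nat.add_succ_r.
      assert (Hm : 0 < INR (1 + m)) by (apply INR_S_pos).
      apply Rle_trans with (Cmod (x (1 + m)%nat) * (1 + B * / INR (1 + m) ^ 2)).
      + replace (x (S (1 + m))) with ((x (S (1 + m)) - x (1 + m)%nat) + x (1 + m)%nat)%C by ring.
        eapply Rle_trans; [apply Cmod_triangle|]. unfold Rdiv in Hx. lra.
      + rewrite (Rmult_plus_distr_l B), exp_plus, <- Rmult_assoc.
        apply Rmult_le_compat; auto.
        * apply Cmod_ge_0.
        * assert (0 <= B * / INR (1 + m) ^ 2); [|lra].
          apply Rmult_le_pos; auto. left. apply Rinv_0_lt_compat, pow_lt; auto.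
        * apply exp_ineq1_le. }
  intros Hn. replace n with (1 + (n - 1))%nat by lia.
  eapply Rle_trans; [apply H|]. apply Rmult_le_compat_l; auto.
  assert (H2 := Rinv_sqr_sum_tail 1 (n - 1) (le_n 1)).
  assert (0 < 2 / INR (1 + (n - 1))) by (apply Rdiv_lt_0_compat; [lra | apply INR_S_pos]).
  change (INR 1) with 1 in H2.
  assert (Hle : B * rsum (fun k => / INR (1 + k) ^ 2) (n - 1) <= 2 * B) by nra.
  apply exp_monotone; exact Hle.
Qed.

Lemma slow_product_diff n m : (1 <= n)%nat ->
  Cmod (x (n + m)%nat - x n) <= A * exp (2 * B) * B * (2 / INR n).
Proof.
  intros Hn.
  assert (HA : 0 <= A) by (eapply Rle_trans; [apply Cmod_ge_0 | exact Hx1]).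
  assert (HK : 0 <= A * exp (2 * B) * B).
  { repeat apply Rmult_le_pos; auto. left; apply exp_pos. }
  assert (H : Cmod (x (n + m)%nat - x n) <= A * exp (2 * B) * B * rsum (fun k => / INR (n + k) ^ 2) m).
  { induction m; cbn [rsum].
    - rewrite Nat.add_0_r. replace (x n - x n)%C with (RtoC 0) by ring. rewrite Cmod_0. lra.
    - rewrite Nat.add_succ_r.
      replace (x (S (n + m)) - x n)%C with ((x (n + m)%nat - x n) + (x (S (n + m)) - x (n + m)%nat))%C by ring.
      eapply Rle_trans; [apply Cmod_triangle|]. rewrite Rmult_plus_distr_l.
      apply Rplus_le_compat; auto.
      eapply Rle_trans; [apply Hx; lia|].
      assert (Hb := slow_product_bounded (n + m) ltac:(lia)).
      replace (A * exp (2 * B) * B * / INR (n + m) ^ 2) with (B / INR (n + m) ^ 2 * (A * exp (2 * B)))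
        by (unfold Rdiv; ring).
      apply Rmult_le_compat_l; auto. apply Rmult_le_pos; auto.
      left. apply Rinv_0_lt_compat, pow_lt, lt_0_INR; lia. }
  eapply Rle_trans; [exact H|]. apply Rmult_le_compat_l; auto.
  assert (H2 := Rinv_sqr_sum_tail n m Hn).
  assert (0 < 2 / INR (n + m)) by (apply Rdiv_lt_0_compat; [lra | apply lt_0_INR; lia]). lra.
Qed.

Lemma is_lim_seq_inv_INR (K : R) : is_lim_seq (fun n => K * (2 / INR n)) 0.
Proof.
  apply (is_lim_seq_ext (fun n => K * 2 * / INR n)); [intros; unfold Rdiv; ring|].
  apply is_lim_seq_scal_0, (is_lim_seq_inv INR p_infty); [apply is_lim_seq_INR | discriminate].
Qed.

Lemma slow_product_cv : Ccv x (Clim x).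
Proof.
  apply Ccv_cauchy. intros e He.
  assert (Hl := is_lim_seq_inv_INR (A * exp (2 * B) * B)). apply is_lim_seq_spec in Hl.
  destruct (Hl (mkposreal e He)) as [N HN]. cbn [pos] in HN.
  exists (S N). intros n m Hn Hm. replace m with (n + (m - n))%nat by lia.
  eapply Rle_lt_trans; [apply slow_product_diff; lia|].
  eapply Rle_lt_trans; [|apply (HN n); lia]. rewrite Rminus_0_r. apply Rle_abs.
Qed.

Lemma slow_product_rate n : (1 <= n)%nat ->
  Cmod (x n - Clim x) <= A * exp (2 * B) * B * (2 / INR n).
Proof.
  intros Hn. rewrite Cmod_minus_sym.
  apply (Ccv_Cmod_le (fun m => x m - x n)%C _ _ n).
  - apply Ccv_minus; [apply slow_product_cv | apply Ccv_const].
  - intros m Hm. replace m with (n + (m - n))%nat by lia. apply slow_product_diff; auto.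
Qed.

(** Beyond an index where the remaining relative increments add up to at most
    one half, the modulus cannot drop below half its value. *)
Lemma slow_product_neq_0 : (forall n, (1 <= n)%nat -> x n <> 0%C) -> Clim x <> 0%C.
Proof.
  intros H0.
  destruct (INR_unbounded (4 * B + 1)) as [N HN].
  assert (HN1 : 1 < INR N) by lra.
  assert (HNn : (1 <= N)%nat) by (destruct N; [simpl in HN1; lra | lia]).
  assert (H : forall m, Cmod (x N) * (1 - B * rsum (fun k => / INR (N + k) ^ 2) m) <= Cmod (x (N + m)%nat)
      /\ B * rsum (fun k => / INR (N + k) ^ 2) m <= 1 / 2).
  { intros m.
    assert (HR : B * rsum (fun k => / INR (N + k) ^ 2) m <= 1 / 2).
    { assert (H2 := Rinv_sqr_sum_tail N m HNn).
      assert (0 < 2 / INR (N + m)) by (apply Rdiv_lt_0_compat; [lra | apply lt_0_INR; lia]).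
      apply Rle_trans with (B * (2 / INR N)); [apply Rmult_le_compat_l; lra|].
      replace (B * (2 / INR N)) with (2 * B / INR N) by (unfold Rdiv; ring).
      apply Rdiv_le_of_mult; lra. }
    split; auto. clear HR. induction m; cbn [rsum].
    - rewrite Nat.add_0_r. lra.
    - rewrite Nat.add_succ_r. assert (Hs := Hx (N + m)%nat ltac:(lia)).
      assert (Hm : 0 < INR (N + m)) by (apply lt_0_INR; lia).
      set (t := B / INR (N + m) ^ 2) in *.
      assert (Ht : 0 <= t).
      { apply Rmult_le_pos; auto. left. apply Rinv_0_lt_compat, pow_lt; auto. }
      set (T := rsum (fun k => / INR (N + k) ^ 2) m) in *.
      assert (HRp : 0 <= B * T).
      { apply Rmult_le_pos; auto. apply rsum_nonneg. intros. left.
        apply Rinv_0_lt_compat, pow_lt, lt_0_INR; lia. }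
      replace (B * (T + / INR (N + m) ^ 2)) with (B * T + t) by (unfold t; field; lra).
      assert (H1 := Cmod_triangle_rev (x (N + m)%nat) (x (N + m)%nat - x (S (N + m)))%C).
      rewrite (Cmod_minus_sym (x (N + m)%nat) (x (S (N + m)))) in H1.
      replace (x (N + m)%nat - (x (N + m)%nat - x (S (N + m))))%C with (x (S (N + m))) in H1 by ring.
      assert (H2 := Cmod_ge_0 (x N)). assert (H3 := Cmod_ge_0 (x (N + m)%nat)).
      assert (Ht1 : t <= 1).
      { unfold t. apply Rdiv_le_of_mult; [apply pow_lt; auto|].
        assert (INR N <= INR (N + m)) by (apply le_INR; lia). nra. }
      assert (Cmod (x N) * (1 - B * T) * (1 - t) <= Cmod (x (N + m)%nat) * (1 - t))
        by (apply Rmult_le_compat_r; lra).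
      assert (0 <= Cmod (x N) * (B * T * t)) by (apply Rmult_le_pos; [auto | apply Rmult_le_pos; auto]).
      nra. }
  intros E.
  assert (Hpos : 0 < Cmod (x N)) by (apply Cmod_gt_0, H0; auto).
  destruct (slow_product_cv (Cmod (x N) / 2) ltac:(lra)) as [n0 Hn0].
  specialize (Hn0 (N + n0)%nat ltac:(lia)). rewrite E in Hn0.
  replace (x (N + n0)%nat - 0)%C with (x (N + n0)%nat) in Hn0 by ring.
  destruct (H n0) as [H1 H2]. nra.
Qed.

End SlowProduct.

Lemma ln_1_plus_bounds (x : R) : 0 <= x -> x - x ^ 2 <= ln (1 + x) <= x.
Proof.
  intros Hx. split.
  - assert (H : ln (/ (1 + x)) <= / (1 + x) - 1).
    { assert (Hp : 0 < / (1 + x)) by (apply Rinv_0_lt_compat; lra).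
      assert (H := exp_ineq1_le (ln (/ (1 + x)))). rewrite exp_ln in H by auto. lra. }
    rewrite ln_Rinv in H by lra.
    assert (H2 : x - x ^ 2 <= 1 - / (1 + x)); [|lra].
    replace (1 - / (1 + x)) with (x / (1 + x)) by (field; lra).
    apply Rmult_le_reg_r with (1 + x); [lra|].
    replace (x / (1 + x) * (1 + x)) with x by (field; lra). nra.
  - destruct (Req_dec x 0) as [->|Hne]; [rewrite Rplus_0_r, ln_1; lra|].
    assert (H := exp_ineq1_le (ln (1 + x))). rewrite exp_ln in H by lra. lra.
Qed.

Definition fcoef_scaled (a : C) (n : nat) : C := (rpow (INR n) (2 * a + 1) * fcoef a n)%C.

(** Collects the error terms in [fcoef_scaled_slow]; what matters is that it
    depends on a bound for [|a|] only. *)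
Definition slow_const (A : R) : R :=
  let b := 2 * A + 1 in b * (1 + A) + b ^ 2 + (exp b * b ^ 2 + b) * (1 + b).

Lemma slow_const_nonneg A : 0 <= A -> 0 <= slow_const A.
Proof.
  intros HA. unfold slow_const. set (b := 2 * A + 1). assert (1 <= b) by (unfold b; lra).
  assert (0 < exp b) by apply exp_pos. assert (0 <= exp b * b ^ 2) by (apply Rmult_le_pos; nra). nra.
Qed.

(** The power of [n] cancels the first-order term in
    [(n - a) / (n + 1 + a) = 1 - (2 a + 1) / n + O(1 / n ^ 2)]. *)
Lemma fcoef_scaled_slow (A : R) (a : C) (n : nat) :
  0 < Re a -> Cmod a <= A -> (1 <= n)%nat ->
  Cmod (fcoef_scaled a (S n) - fcoef_scaled a n) <= slow_const A / INR n ^ 2 * Cmod (fcoef_scaled a n).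
Proof.
  intros Ha HA Hn.
  assert (Hn1 : 1 <= INR n) by (apply (le_INR 1); auto).
  set (x := / INR n). set (b := (2 * a + 1)%C).
  assert (Hx : 0 < x <= 1).
  { split; [apply Rinv_0_lt_compat; lra|]. rewrite <- Rinv_1. apply Rinv_le_contravar; lra. }
  set (w := (RtoC (INR (S n)) + a)%C).
  assert (Hw0 : w <> 0%C) by (apply INR_S_shift_neq_0; auto).
  assert (Hw : INR n <= Cmod w).
  { eapply Rle_trans; [|apply re_le_Cmod]. eapply Rle_trans; [|apply Rle_abs].
    unfold w. rewrite re_plus, re_RtoC, S_INR. lra. }
  assert (Hiw : Cmod (/ w) <= x).
  { rewrite Cmod_inv by auto. apply Rinv_le_contravar; lra. }
  set (y := ln (1 + x)). assert (Hy := ln_1_plus_bounds x ltac:(lra)). fold y in Hy.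
  assert (E : fcoef_scaled a (S n) = (fcoef_scaled a n * (Cexp (b * RtoC y) * (1 - b * / w)))%C).
  { unfold fcoef_scaled. cbn [fcoef]. fold b.
    replace (INR (S n)) with (INR n * (1 + x)) at 1
      by (rewrite S_INR; unfold x; field; lra).
    rewrite rpow_mult_base by lra. unfold rpow at 2. fold y. unfold w.
    rewrite S_INR, RtoC_plus. unfold b. field.
    intro E. apply Hw0. unfold w. rewrite S_INR, RtoC_plus. exact E. }
  set (e := (Cexp (b * RtoC y) - 1 - b * RtoC x)%C).
  set (beta := 2 * A + 1).
  assert (HA0 := Cmod_ge_0 a).
  assert (Hb : Cmod b <= beta).
  { unfold b, beta. eapply Rle_trans; [apply Cmod_triangle|]. rewrite Cmod_mult, Cmod_1, Cmod_R, Rabs_pos_eq; lra. }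
  assert (Hb0 := Cmod_ge_0 b).
  assert (He : Cmod e <= (exp beta * beta ^ 2 + beta) * x ^ 2).
  { unfold e. replace (Cexp (b * RtoC y) - 1 - b * RtoC x)%C with
      ((Cexp (b * RtoC y) - 1 - b * RtoC y) + b * (RtoC y - RtoC x))%C by ring.
    eapply Rle_trans; [apply Cmod_triangle|]. rewrite Rmult_plus_distr_r.
    assert (Hy0 : 0 <= y) by nra.
    assert (Hby : Cmod (b * RtoC y) <= beta * x).
    { rewrite Cmod_mult, Cmod_R, Rabs_pos_eq by auto. apply Rmult_le_compat; lra. }
    assert (Hby0 := Cmod_ge_0 (b * RtoC y)).
    apply Rplus_le_compat.
    - eapply Rle_trans; [apply Cexp_minus_1_z_bound|].
      replace (exp beta * beta ^ 2 * x ^ 2) with (exp beta * (beta * x) ^ 2) by ring.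
      apply Rmult_le_compat; [left; apply exp_pos | nra | | nra].
      assert (Hle : Cmod (b * RtoC y) <= beta) by nra.
      apply exp_monotone; exact Hle.
    - rewrite Cmod_mult, Cmod_real_minus. apply Rmult_le_compat; auto; [apply Rabs_pos|].
      apply Rabs_le. nra. }
  set (iw := (/ w)%C) in *.
  assert (Ed : (Cexp (b * RtoC y) * (1 - b * iw) - 1
     = b * (1 + a) * RtoC x * iw - b * b * RtoC x * iw + e * (1 - b * iw))%C).
  { unfold e, x. rewrite RtoC_inv by lra.
    assert (HnC : RtoC (INR n) <> 0%C) by (intro E0; apply RtoC_inj in E0; lra).
    assert (E1 : (iw * (RtoC (INR n) + 1 + a) = 1)%C).
    { unfold iw, w. rewrite S_INR, RtoC_plus. field.
      intro E0. apply Hw0. unfold w. rewrite S_INR, RtoC_plus. exact E0. }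
    assert (E2 : (b * (1 + a) * / RtoC (INR n) * iw = b * / RtoC (INR n) - b * iw)%C).
    { replace (b * / RtoC (INR n))%C with (b * / RtoC (INR n) * (iw * (RtoC (INR n) + 1 + a)))%C
        by (rewrite E1; ring).
      field; auto. }
    rewrite E2. ring. }
  rewrite E.
  replace (fcoef_scaled a n * (Cexp (b * RtoC y) * (1 - b * iw)) - fcoef_scaled a n)%C with
    ((Cexp (b * RtoC y) * (1 - b * iw) - 1) * fcoef_scaled a n)%C by ring.
  rewrite Cmod_mult. apply Rmult_le_compat_r; [apply Cmod_ge_0|].
  rewrite Ed.
  replace (slow_const A / INR n ^ 2) with
    (beta * (1 + A) * x * x + beta * beta * x * x + (exp beta * beta ^ 2 + beta) * x ^ 2 * (1 + beta * 1))
    by (unfold slow_const, x; fold beta; field; lra).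
  assert (Hiw0 := Cmod_ge_0 iw).
  assert (Hbeta : 0 <= beta) by lra.
  assert (Hbiw : Cmod (b * iw) <= beta * 1) by (rewrite Cmod_mult; apply Rmult_le_compat; lra).
  eapply Rle_trans; [apply Cmod_triangle|]. apply Rplus_le_compat.
  - eapply Rle_trans; [apply Cmod_triangle_minus|]. apply Rplus_le_compat.
    + rewrite !Cmod_mult, (Cmod_R x), Rabs_pos_eq by lra.
      assert (H1a : Cmod (1 + a)%C <= 1 + A) by (eapply Rle_trans; [apply Cmod_triangle|]; rewrite Cmod_1; lra).
      assert (H1a0 := Cmod_ge_0 (1 + a)%C).
      repeat apply Rmult_le_compat; repeat apply Rmult_le_pos; lra.
    + rewrite !Cmod_mult, (Cmod_R x), Rabs_pos_eq by lra.
      repeat apply Rmult_le_compat; repeat apply Rmult_le_pos; lra.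
  - rewrite Cmod_mult. apply Rmult_le_compat; auto; try apply Cmod_ge_0.
    eapply Rle_trans; [apply Cmod_triangle_minus|]. rewrite Cmod_1. lra.
Qed.

Lemma fcoef_scaled_1 a : 0 < Re a -> Cmod (fcoef_scaled a 1) <= Cmod a.
Proof.
  intros Ha. unfold fcoef_scaled. change (INR 1) with 1. rewrite rpow_1_l. cbn [fcoef].
  change (INR 1) with 1. change (INR 0) with 0.
  assert (H0 : (1 + a)%C <> 0%C) by (apply (shift_neq_0 1); lra).
  replace (1 * (1 * ((0 - a) / (1 + a))))%C with (- a / (1 + a))%C by (field; auto).
  rewrite Cmod_div, Cmod_opp by auto.
  assert (H1 : 1 <= Cmod (1 + a)%C).
  { eapply Rle_trans; [|apply re_le_Cmod]. eapply Rle_trans; [|apply Rle_abs].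
    rewrite re_plus. change (Re 1%C) with 1. lra. }
  apply Rdiv_le_of_mult; [lra|]. generalize (Cmod_ge_0 a). nra.
Qed.

(** This is [Gamma(1 + a) / Gamma(- a)]. *)
Definition fcoef_lim (a : C) : C := Clim (fcoef_scaled a).

Definition fcoef_const (A : R) : R := A * exp (2 * slow_const A).

Lemma fcoef_scaled_bounded A a n : 0 < Re a -> Cmod a <= A -> (1 <= n)%nat ->
  Cmod (fcoef_scaled a n) <= fcoef_const A.
Proof.
  intros Ha HA Hn.
  assert (HA0 : 0 <= A) by (eapply Rle_trans; [apply Cmod_ge_0 | exact HA]).
  apply (slow_product_bounded (fcoef_scaled a) A (slow_const A)); auto.
  - apply slow_const_nonneg; auto.
  - eapply Rle_trans; [apply fcoef_scaled_1; auto | auto].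
  - intros. apply fcoef_scaled_slow; auto.
Qed.

Lemma fcoef_scaled_rate A a n : 0 < Re a -> Cmod a <= A -> (1 <= n)%nat ->
  Cmod (fcoef_scaled a n - fcoef_lim a) <= fcoef_const A * slow_const A * (2 / INR n).
Proof.
  intros Ha HA Hn.
  assert (HA0 : 0 <= A) by (eapply Rle_trans; [apply Cmod_ge_0 | exact HA]).
  apply (slow_product_rate (fcoef_scaled a) A (slow_const A)); auto.
  - apply slow_const_nonneg; auto.
  - eapply Rle_trans; [apply fcoef_scaled_1; auto | auto].
  - intros. apply fcoef_scaled_slow; auto.
Qed.

Lemma fcoef_scaled_cv a : 0 < Re a -> Ccv (fcoef_scaled a) (fcoef_lim a).
Proof.
  intros Ha. apply (slow_product_cv (fcoef_scaled a) (Cmod a) (slow_const (Cmod a))).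
  - apply slow_const_nonneg, Cmod_ge_0.
  - apply fcoef_scaled_1; auto.
  - intros. apply fcoef_scaled_slow; auto. lra.
Qed.

Lemma fcoef_lim_neq_0 a : 0 < Re a -> Im a <> 0 -> fcoef_lim a <> 0%C.
Proof.
  intros Ha Hi. apply (slow_product_neq_0 (fcoef_scaled a) (Cmod a) (slow_const (Cmod a))).
  - apply slow_const_nonneg, Cmod_ge_0.
  - apply fcoef_scaled_1; auto.
  - intros. apply fcoef_scaled_slow; auto. lra.
  - intros n _. apply Cmult_neq_0; [apply rpow_neq_0|].
    induction n; cbn [fcoef]; [apply C1_nz|].
    apply Cmult_neq_0; auto. apply Cmult_neq_0.
    + intro E. apply Hi. assert (E' := f_equal Im E). unfold Cminus in E'.
      rewrite im_plus, im_opp, im_RtoC in E'. change (Im 0%C) with 0 in E'. lra.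
    + intro E. assert (Hz := INR_S_shift_neq_0 n a Ha).
      assert (E' := Cinv_r _ Hz). rewrite E in E'. rewrite Cmult_0_r in E'.
      apply RtoC_inj in E'. lra.
Qed.

Lemma fcoef_scaled_inv a n : (1 <= n)%nat ->
  fcoef a n = (fcoef_scaled a n * rpow (INR n) (- (2 * a + 1)))%C.
Proof.
  intros Hn. unfold fcoef_scaled. rewrite rpow_opp. field. apply rpow_neq_0.
Qed.

Lemma Re_2a_1 a : Re (2 * a + 1)%C = 2 * Re a + 1.
Proof. rewrite re_plus, re_scal_l. reflexivity. Qed.

Lemma Re_opp_2a_1 a : Re (- (2 * a + 1))%C = - 1 - 2 * Re a.
Proof. rewrite re_opp, Re_2a_1. ring. Qed.

Lemma fcoef_bound A a n : 0 < Re a -> Cmod a <= A -> (1 <= n)%nat ->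
  Cmod (fcoef a n) <= fcoef_const A * Rpower (INR n) (- 1 - 2 * Re a).
Proof.
  intros Ha HA Hn. rewrite fcoef_scaled_inv by auto.
  rewrite Cmod_mult, Cmod_rpow, Re_opp_2a_1.
  apply Rmult_le_compat_r; [left; apply Rpower_pos | apply fcoef_scaled_bounded; auto].
Qed.

Lemma fcoef_const_nonneg A : 0 <= A -> 0 <= fcoef_const A.
Proof. intros. apply Rmult_le_pos; auto. left; apply exp_pos. Qed.

(** * The Fourier series of a complex power of the sine *)

Definition fterm (a : C) (x : R) (k : nat) : C :=
  (fcoef a (S k) * RtoC (cos (2 * PI * INR (S k) * x)))%C.

Definition fsum (a : C) (N : nat) (x : R) : C := (1 + 2 * csum (fterm a x) N)%C.

Definition fourier (a : C) (x : R) : C := (1 + 2 * Cser (fterm a x))%C.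

Definition fterm' (a : C) (x : R) (k : nat) : C :=
  (fcoef a (S k) * RtoC (- (2 * PI * INR (S k)) * sin (2 * PI * INR (S k) * x)))%C.

Lemma Cmod_mult_bounded (z : C) (x B : R) : Cmod z <= B -> Rabs x <= 1 -> Cmod (z * RtoC x) <= B.
Proof.
  intros Hz Hx. rewrite Cmod_mult, Cmod_R. generalize (Cmod_ge_0 z) (Rabs_pos x). nra.
Qed.

Lemma Rabs_cos_le_1 x : Rabs (cos x) <= 1.
Proof. apply Rabs_le. apply COS_bound. Qed.

Lemma Rabs_sin_le_1 x : Rabs (sin x) <= 1.
Proof. apply Rabs_le. apply SIN_bound. Qed.

Lemma fcoef_pdom A a : 0 < Re a -> Cmod a <= A ->
  pdom (fun k => fcoef a (S k)) (fcoef_const A) (2 * Re a).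
Proof. intros Ha HA k. apply fcoef_bound; auto; lia. Qed.

Lemma fterm_pdom A a x : 0 < Re a -> Cmod a <= A -> pdom (fterm a x) (fcoef_const A) (2 * Re a).
Proof.
  intros Ha HA k. apply Cmod_mult_bounded; [|apply Rabs_cos_le_1].
  apply (fcoef_pdom A a Ha HA k).
Qed.

Lemma Rpower_mult_nat (k : nat) (y : R) (j : nat) :
  INR (S k) ^ j * Rpower (INR (S k)) y = Rpower (INR (S k)) (INR j + y).
Proof. rewrite Rpower_plus, Rpower_pow by apply INR_S_pos. reflexivity. Qed.

Lemma fterm'_pdom A a x : 1 < Re a -> Cmod a <= A ->
  pdom (fterm' a x) (2 * PI * fcoef_const A) (2 * Re a - 1).
Proof.
  intros Ha HA k. unfold fterm'.
  assert (HP := PI_RGT_0). assert (Hk := INR_S_pos k).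
  rewrite Cmod_mult, Cmod_R, Rabs_mult, Rabs_Ropp, (Rabs_pos_eq (2 * PI * INR (S k))) by nra.
  assert (H1 := fcoef_bound A a (S k) ltac:(lra) HA ltac:(lia)).
  assert (H2 := Rabs_sin_le_1 (2 * PI * INR (S k) * x)).
  replace (- 1 - (2 * Re a - 1)) with (INR 1 + (- 1 - 2 * Re a)) by (simpl; ring).
  rewrite <- Rpower_mult_nat, pow_1.
  apply Rle_trans with ((fcoef_const A * Rpower (INR (S k)) (- 1 - 2 * Re a)) * (2 * PI * INR (S k) * 1)).
  - apply Rmult_le_compat; auto; [apply Cmod_ge_0| |].
    + apply Rmult_le_pos; [nra | apply Rabs_pos].
    + apply Rmult_le_compat_l; [nra|auto].
  - right; ring.
Qed.

Lemma fsum_cv a x : 0 < Re a -> Ccv (fun N => fsum a N x) (fourier a x).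
Proof.
  intros Ha. apply Ccv_plus; [apply Ccv_const|]. apply Ccv_scal.
  eapply pdom_cv; [|apply (fterm_pdom (Cmod a) a x); auto]; lra.
Qed.

(** For the full series this is the differential equation
    [g' sin (pi x) = 2 pi a cos (pi x) g] of [g = sin (pi x) ^ (2 a)], which is
    equivalent to the recursion of the coefficients; a partial sum telescopes to
    a single boundary term. *)
Lemma fsum_ode a N x : 0 < Re a ->
  (RtoC (sin (PI * x)) * (2 * csum (fterm' a x) N) - RtoC (2 * PI * cos (PI * x)) * a * fsum a N x
   = RtoC (2 * PI) * (RtoC (INR N) - a) * fcoef a N * RtoC (cos ((2 * INR N + 1) * (PI * x))))%C.
Proof.
  intros Ha. unfold fsum. induction N as [|N IH].
  - cbn [csum fcoef]. change (INR 0) with 0. replace ((2 * 0 + 1) * (PI * x)) with (PI * x) by ring.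
    rewrite !RtoC_mult. ring.
  - cbn [csum].
    set (s := sin (PI * x)) in *. set (c := cos (PI * x)) in *.
    set (S1 := csum (fterm a x) N) in *. set (S2 := csum (fterm' a x) N) in *.
    replace (RtoC s * (2 * (S2 + fterm' a x N)) - RtoC (2 * PI * c) * a * (1 + 2 * (S1 + fterm a x N)))%C
      with ((RtoC s * (2 * S2) - RtoC (2 * PI * c) * a * (1 + 2 * S1))
        + (RtoC s * 2 * fterm' a x N - RtoC (2 * PI * c) * a * 2 * fterm a x N))%C by ring.
    rewrite IH. unfold fterm, fterm'.
    set (y := 2 * PI * INR (S N) * x).
    assert (E1 : cos ((2 * INR N + 1) * (PI * x)) = cos y * c + sin y * s).
    { replace ((2 * INR N + 1) * (PI * x)) with (y - PI * x) by (unfold y; rewrite S_INR; ring).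
      apply cos_minus. }
    assert (E2 : cos ((2 * INR (S N) + 1) * (PI * x)) = cos y * c - sin y * s).
    { replace ((2 * INR (S N) + 1) * (PI * x)) with (y + PI * x) by (unfold y; ring).
      apply cos_plus. }
    rewrite E1, E2.
    replace (RtoC (2 * PI) * (RtoC (INR N) - a) * fcoef a N * RtoC (cos y * c + sin y * s))%C
      with (RtoC (2 * PI) * (fcoef a N * (RtoC (INR N) - a)) * RtoC (cos y * c + sin y * s))%C by ring.
    rewrite <- (fcoef_rec a N Ha).
    rewrite RtoC_plus, RtoC_minus, !RtoC_mult, RtoC_opp, !RtoC_mult. ring.
Qed.

Lemma fsum_ode_boundary a (y : nat -> R) : 0 < Re a ->
  (forall N, Rabs (y N) <= 1) ->
  Ccv (fun N => RtoC (2 * PI) * (RtoC (INR N) - a) * fcoef a N * RtoC (y N))%C 0.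
Proof.
  intros Ha Hy.
  apply (Ccv_bound _ _ (fun N => (2 * PI * (1 + Cmod a) * fcoef_const (Cmod a)) * Rpower (INR N) (- (2 * Re a)))).
  - apply is_lim_seq_scal_0, is_lim_seq_Rpower_neg; lra.
  - exists 1%nat. intros N HN.
    assert (H1 : 1 <= INR N) by (apply (le_INR 1); auto).
    replace (RtoC (2 * PI) * (RtoC (INR N) - a) * fcoef a N * RtoC (y N) - 0)%C
      with ((RtoC (2 * PI) * (RtoC (INR N) - a) * fcoef a N) * RtoC (y N))%C by ring.
    apply Cmod_mult_bounded; auto. rewrite !Cmod_mult.
    assert (HP := PI_RGT_0).
    rewrite Cmod_R, Rabs_pos_eq by lra.
    assert (Hf := fcoef_bound (Cmod a) a N Ha ltac:(lra) HN).
    replace (- (2 * Re a)) with (INR 1 + (- 1 - 2 * Re a)) by (simpl; ring).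
    rewrite Rpower_plus. simpl (INR 1). rewrite Rpower_1 by lra.
    assert (Hm : Cmod (RtoC (INR N) - a) <= INR N * (1 + Cmod a)).
    { eapply Rle_trans; [apply Cmod_triangle_minus|]. rewrite Cmod_R, Rabs_pos_eq by lra.
      generalize (Cmod_ge_0 a). nra. }
    apply Rle_trans with (2 * PI * (INR N * (1 + Cmod a)) * (fcoef_const (Cmod a) * Rpower (INR N) (-1 - 2 * Re a))).
    + apply Rmult_le_compat; auto; [|apply Cmod_ge_0|].
      * apply Rmult_le_pos; [lra | apply Cmod_ge_0].
      * apply Rmult_le_compat_l; [lra|auto].
    + right; ring.
Qed.

Lemma fourier_ode a x : 1 < Re a ->
  (RtoC (sin (PI * x)) * (2 * Cser (fterm' a x)) = RtoC (2 * PI * cos (PI * x)) * a * fourier a x)%C.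
Proof.
  intros Ha. apply Ceq_minus.
  apply (Ccv_unique (fun N => RtoC (sin (PI * x)) * (2 * csum (fterm' a x) N)
    - RtoC (2 * PI * cos (PI * x)) * a * fsum a N x)%C).
  - apply Ccv_minus.
    + apply Ccv_scal, Ccv_scal. eapply pdom_cv; [|apply (fterm'_pdom (Cmod a) a x)]; lra.
    + apply Ccv_scal, fsum_cv. lra.
  - eapply Ccv_ext; [intros n; symmetry; apply fsum_ode; lra|].
    apply fsum_ode_boundary; [lra|]. intros; apply Rabs_cos_le_1.
Qed.

(** At [x = 0] the telescoped identity [fsum_ode] evaluates the partial sums in
    closed form. *)
Lemma fourier_0 a : 0 < Re a -> fourier a 0 = 0%C.
Proof.
  intros Ha.
  assert (Ha0 : a <> 0%C). { intros ->. simpl in Ha. lra. }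
  assert (HP := PI_RGT_0).
  assert (E : (RtoC (2 * PI) * a * fourier a 0 = 0)%C).
  { apply (Ccv_unique (fun N => RtoC (2 * PI) * a * fsum a N 0)%C).
    - apply Ccv_scal, fsum_cv; auto.
    - apply (Ccv_ext (fun N => - (1) * (RtoC (2 * PI) * (RtoC (INR N) - a) * fcoef a N
        * RtoC (cos ((2 * INR N + 1) * (PI * 0)))))%C).
      + intros N. rewrite <- (fsum_ode a N 0 Ha). rewrite Rmult_0_r, sin_0, cos_0, Rmult_1_r. ring.
      + replace (RtoC 0) with (- (1) * 0)%C by ring. apply Ccv_scal.
        apply (fsum_ode_boundary a (fun N => cos ((2 * INR N + 1) * (PI * 0)))); auto.
        intros; apply Rabs_cos_le_1. }
  assert (HPC : RtoC (2 * PI) <> 0%C) by (intro E0; apply RtoC_inj in E0; lra).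
  replace (fourier a 0) with (/ (RtoC (2 * PI) * a) * (RtoC (2 * PI) * a * fourier a 0))%C
    by (field; auto).
  rewrite E. ring.
Qed.

Lemma cos_quadratic (y d : R) : Rabs (cos (y + d) - cos y + d * sin y) <= d ^ 2.
Proof.
  assert (Hsin : forall u v, Rabs (sin u - sin v) <= Rabs (u - v)).
  { intros u v. destruct (MVT_gen sin v u cos) as [c [_ E]].
    - intros. apply is_derive_Reals, derivable_pt_lim_sin.
    - intros. apply derivable_continuous_pt, derivable_pt_sin.
    - rewrite E, Rabs_mult. assert (H := Rabs_cos_le_1 c). generalize (Rabs_pos (u - v)). nra. }
  destruct (MVT_gen (fun u => cos (y + u) + u * sin y) 0 d (fun u => - sin (y + u) + sin y)) as [c [Hc E]].
  - intros u _. auto_derive; auto. ring.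
  - intros u _. apply derivable_continuous_pt. exists (- sin (y + u) + sin y).
    apply is_derive_Reals. auto_derive; auto. ring.
  - rewrite Rplus_0_r, Rmult_0_l, Rplus_0_r in E.
    replace (cos (y + d) - cos y + d * sin y) with ((- sin (y + c) + sin y) * (d - 0)) by (rewrite <- E; ring).
    rewrite Rminus_0_r, Rabs_mult.
    assert (H := Hsin y (y + c)).
    replace (- sin (y + c) + sin y) with (sin y - sin (y + c)) by ring.
    replace (Rabs (y - (y + c))) with (Rabs c) in H by (rewrite <- Rabs_Ropp; f_equal; ring).
    assert (Hcd : Rabs c <= Rabs d).
    { unfold Rmin, Rmax in Hc. destruct (Rle_dec 0 d).
      - rewrite !Rabs_pos_eq; lra.
      - rewrite !Rabs_left1; lra. }
    assert (Hd2 : Rabs d * Rabs d = d ^ 2).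
    { rewrite <- Rabs_mult, Rabs_pos_eq; nra. }
    rewrite <- Hd2. apply Rmult_le_compat_r; [apply Rabs_pos | lra].
Qed.

(** Allows a series to be differentiated termwise by summing second-order
    remainders. *)
Lemma quadratic_Cderiv (f : R -> C) (x : R) (l : C) (Q : R) :
  (forall h, Cmod (f (x + h)%R - f x - RtoC h * l) <= Q * h ^ 2) -> Cderiv f x l.
Proof.
  intros H.
  assert (HR : forall (p : C -> R) , (forall z w, p (z - w)%C = p z - p w) ->
     (forall h z, p (RtoC h * z)%C = h * p z) -> (forall z, Rabs (p z) <= Cmod z) ->
     is_derive (fun u => p (f u)) x (p l)).
  { intros p Hm Hs Hp. apply is_derive_Reals. intros e He.
    set (Q' := Rabs Q + 1).
    assert (HQ : 0 < Q') by (unfold Q'; generalize (Rabs_pos Q); lra).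
    assert (Hd : 0 < e / Q') by (apply Rdiv_lt_0_compat; auto).
    exists (mkposreal _ Hd). intros h Hh0 Hh. cbn [pos] in Hh.
    replace ((p (f (x + h)) - p (f x)) / h - p l) with (p (f (x + h)%R - f x - RtoC h * l)%C / h)
      by (rewrite !Hm, Hs; field; auto).
    unfold Rdiv. rewrite Rabs_mult.
    assert (Hha : 0 < Rabs h) by (apply Rabs_pos_lt; auto).
    rewrite Rabs_inv.
    apply Rle_lt_trans with (Q' * Rabs h ^ 2 * / Rabs h).
    - apply Rmult_le_compat_r; [left; apply Rinv_0_lt_compat; auto|].
      eapply Rle_trans; [apply Hp|]. eapply Rle_trans; [apply H|].
      rewrite <- (pow2_abs h). apply Rmult_le_compat_r; [apply pow2_ge_0|].
      unfold Q'. generalize (Rle_abs Q); lra.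
    - replace (Q' * Rabs h ^ 2 * / Rabs h) with (Q' * Rabs h) by (field; lra).
      apply Rlt_le_trans with (Q' * (e / Q')); [apply Rmult_lt_compat_l; auto|].
      right; field; lra. }
  split.
  - apply (HR Re).
    + intros. unfold Cminus. rewrite re_plus, re_opp. ring.
    + intros. apply re_scal_l.
    + apply re_le_Cmod.
  - apply (HR Im).
    + intros. unfold Cminus. rewrite im_plus, im_opp. ring.
    + intros. apply im_scal_l.
    + apply im_le_Cmod.
Qed.

Lemma fourier_Cderiv a x : 1 < Re a -> Cderiv (fourier a) x (2 * Cser (fterm' a x))%C.
Proof.
  intros Ha.
  assert (HP := PI_RGT_0).
  set (A := Cmod a). assert (HA0 : 0 <= A) by apply Cmod_ge_0.
  assert (HK := fcoef_const_nonneg A HA0).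
  set (d := 2 * Re a - 2). assert (Hd : 0 < d) by (unfold d; lra).
  set (B := (2 * PI) ^ 2 * fcoef_const A).
  apply (quadratic_Cderiv _ _ _ (2 * (B * (1 + / d)))).
  intros h.
  apply (Ccv_Cmod_le (fun N => fsum a N (x + h)%R - fsum a N x - RtoC h * (2 * csum (fterm' a x) N))%C _ _ 0%nat).
  - apply Ccv_minus; [apply Ccv_minus; apply fsum_cv; lra|].
    apply Ccv_scal, Ccv_scal. eapply pdom_cv; [|apply (fterm'_pdom (Cmod a) a x)]; lra.
  - intros N _. unfold fsum.
    replace (1 + 2 * csum (fterm a (x + h)) N - (1 + 2 * csum (fterm a x) N)
       - RtoC h * (2 * csum (fterm' a x) N))%C
      with (2 * (csum (fun k => fterm a (x + h)%R k - fterm a x k - RtoC h * fterm' a x k) N))%C.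
    2:{ rewrite csum_minus, csum_minus, csum_scal. ring. }
    rewrite Cmod_mult, Cmod_R, Rabs_pos_eq by lra. rewrite Rmult_assoc.
    apply Rmult_le_compat_l; [lra|].
    eapply Rle_trans; [apply Cmod_csum_le with (M := fun k => (B * h ^ 2) * Rpower (INR (S k)) (- 1 - d))|].
    + intros k _. unfold fterm, fterm'. assert (Hk := INR_S_pos k).
      set (y := 2 * PI * INR (S k) * x). set (t := 2 * PI * INR (S k)).
      replace (fcoef a (S k) * RtoC (cos (t * (x + h))) - fcoef a (S k) * RtoC (cos y)
        - RtoC h * (fcoef a (S k) * RtoC (- t * sin y)))%C with
        (fcoef a (S k) * RtoC (cos (y + t * h) - cos y + t * h * sin y))%C.
      2:{ replace (t * (x + h)) with (y + t * h) by (unfold y, t; ring).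
          rewrite RtoC_plus, RtoC_minus, !RtoC_mult, RtoC_opp. ring. }
      rewrite Cmod_mult, Cmod_R.
      assert (H1 := fcoef_bound A a (S k) ltac:(lra) (Rle_refl _) ltac:(lia)).
      assert (H2 := cos_quadratic y (t * h)).
      replace (- 1 - d) with (INR 2 + (- 1 - 2 * Re a)) by (unfold d; simpl; ring).
      rewrite <- Rpower_mult_nat.
      eapply Rle_trans; [apply Rmult_le_compat; [apply Cmod_ge_0 | apply Rabs_pos | exact H1 | exact H2]|].
      right. unfold B, t. ring.
    + rewrite rsum_scal. replace (B * (1 + / d) * h ^ 2) with (B * h ^ 2 * (1 + / d)) by ring.
      apply Rmult_le_compat_l.
      * apply Rmult_le_pos; [|apply pow2_ge_0]. apply Rmult_le_pos; auto. apply pow2_ge_0.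
      * apply rsum_Rpower_total; auto.
Qed.

Lemma sin_PI_mult_pos x : 0 < x < 1 -> 0 < sin (PI * x).
Proof. intros Hx. assert (HP := PI_RGT_0). apply sin_gt_0; nra. Qed.

(** The quotient by the power of the sine has zero derivative by the
    differential equation. *)
Lemma fourier_sine_power_large a x : 1 < Re a -> 0 < x < 1 ->
  fourier a x = (fourier a (1/2) * rpow (sin (PI * x)) (2 * a))%C.
Proof.
  intros Ha Hx.
  set (F := fun u => (fourier a u * rpow (sin (PI * u)) (- (2 * a)))%C).
  assert (HF : forall u, 0 < u < 1 -> Cderiv F u 0).
  { intros u Hu. assert (Hs := sin_PI_mult_pos u Hu).
    assert (HD : is_derive (fun u => sin (PI * u)) u (PI * cos (PI * u))).
    { auto_derive; auto. ring. }
    assert (H := Cderiv_mult _ _ u _ _ (fourier_Cderiv a u Ha)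
      (Cderiv_rpow_comp (- (2 * a)) _ u _ HD Hs)). cbv beta in H.
    replace (RtoC 0) with (2 * Cser (fterm' a u) * rpow (sin (PI * u)) (- (2 * a)) +
       fourier a u * (- (2 * a) * RtoC (PI * cos (PI * u)) * rpow (sin (PI * u)) (- (2 * a) - 1)))%C; auto.
    set (r := rpow (sin (PI * u)) (- (2 * a) - 1)).
    replace (- (2 * a))%C with (- (2 * a) - 1 + 1)%C at 1 by ring.
    rewrite rpow_plus, rpow_1 by auto. fold r.
    transitivity (r * (RtoC (sin (PI * u)) * (2 * Cser (fterm' a u)) - RtoC (2 * PI * cos (PI * u)) * a * fourier a u))%C.
    - rewrite !RtoC_mult. ring.
    - rewrite fourier_ode by auto. ring. }
  assert (HE : forall u v, 0 < u -> u <= v -> v < 1 -> F v = F u).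
  { intros u v Hu Huv Hv. apply Ceq_minus, Cmod_eq_0, Rle_antisym; [|apply Cmod_ge_0].
    replace 0 with (0 * (v - u)) by ring.
    apply (mean_value_bound F (fun _ => 0%C)); auto.
    - intros w Hw. apply HF; lra.
    - intros; rewrite Cmod_0; lra. }
  assert (Eh : F x = F (1/2)).
  { destruct (Rle_dec x (1/2)); [symmetry|]; apply HE; lra. }
  unfold F in Eh. replace (sin (PI * (1/2))) with 1 in Eh.
  2:{ replace (PI * (1/2)) with (PI / 2) by field. symmetry. apply sin_PI2. }
  rewrite rpow_1_l, Cmult_1_r in Eh. rewrite <- Eh, <- Cmult_assoc, <- rpow_plus.
  replace (- (2 * a) + 2 * a)%C with (RtoC 0) by ring. rewrite rpow_0. ring.
Qed.

(** The quotient of the mean values of [sin ^ (2 a + 2)] and [sin ^ (2 a)]. *)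
Definition kappa (a : C) : C := ((2 * a + 1) / (2 * (a + 1)))%C.

Lemma a_plus_1_neq_0 a : 0 < Re a -> (a + 1)%C <> 0%C.
Proof. intros H. rewrite Cplus_comm. apply (shift_neq_0 1). lra. Qed.

Lemma kappa_neq_0 a : 0 < Re a -> kappa a <> 0%C.
Proof.
  intros Ha. unfold kappa, Cdiv. apply Cmult_neq_0.
  - rewrite Cplus_comm. apply (shift_neq_0 1). rewrite re_scal_l. lra.
  - intro E. assert (H1 := a_plus_1_neq_0 a Ha).
    assert (H2 : (2 * (a + 1))%C <> 0%C).
    { apply Cmult_neq_0; auto. intro E2; apply RtoC_inj in E2; lra. }
    assert (E' := Cinv_r _ H2). rewrite E, Cmult_0_r in E'. apply RtoC_inj in E'. lra.
Qed.

Lemma Re_plus_1 a : Re (a + 1)%C = Re a + 1.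
Proof. rewrite re_plus. reflexivity. Qed.

Lemma fcoef_shift_parameter a k : 0 < Re a ->
  (fcoef (a + 1) (S k) * (RtoC (INR (S k)) + a) * (RtoC (INR (S (S k))) + a)
   = - (1 + a) * (1 + a) * fcoef a k)%C.
Proof.
  intros Ha. assert (Ha' : 0 < Re (a + 1)%C) by (rewrite Re_plus_1; lra).
  induction k as [|k IH].
  - cbn [fcoef]. replace (INR 2) with (1 + 1) by (simpl; ring). rewrite RtoC_plus.
    change (INR 1) with 1. change (INR 0) with 0.
    assert (H := shift_neq_0 2 a ltac:(lra)).
    field. intro E0. apply H. replace (2 + a)%C with (1 + (a + 1))%C by ring. exact E0.
  - assert (H1 := INR_S_shift_neq_0 k a Ha). assert (H2 := INR_S_shift_neq_0 (S k) a Ha).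
    assert (H3 := INR_S_shift_neq_0 (S (S k)) a Ha).
    assert (E1 := fcoef_rec (a + 1) (S k) Ha'). assert (E2 := fcoef_rec a k Ha).
    replace (RtoC (INR (S (S k))) + (a + 1))%C with (RtoC (INR (S (S (S k)))) + a)%C in E1
      by (rewrite (S_INR (S (S k))), RtoC_plus; ring).
    replace (RtoC (INR (S k)) - (a + 1))%C with (RtoC (INR k) - a)%C in E1
      by (rewrite (S_INR k), RtoC_plus; ring).
    assert (E : ((RtoC (INR (S k)) + a) * (fcoef (a + 1) (S (S k)) * (RtoC (INR (S (S k))) + a) * (RtoC (INR (S (S (S k)))) + a))
      = (RtoC (INR (S k)) + a) * (- (1 + a) * (1 + a) * fcoef a (S k)))%C).
    { transitivity ((RtoC (INR (S (S k))) + a) * (RtoC (INR (S k)) + a) *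
        (fcoef (a + 1) (S (S k)) * (RtoC (INR (S (S (S k)))) + a)))%C; [ring|].
      rewrite E1.
      transitivity ((RtoC (INR k) - a) * (fcoef (a + 1) (S k) * (RtoC (INR (S k)) + a) * (RtoC (INR (S (S k))) + a)))%C; [ring|].
      rewrite IH.
      transitivity (- (1 + a) * (1 + a) * (fcoef a k * (RtoC (INR k) - a)))%C; [ring|].
      rewrite <- E2. ring. }
    match goal with |- ?x = ?y =>
      replace x with (/ (RtoC (INR (S k)) + a) * ((RtoC (INR (S k)) + a) * x))%C by (field; auto);
      rewrite E; field; auto end.
Qed.

(** Multiplication by [sin (pi x) ^ 2 = (1 - cos (2 pi x)) / 2] mixes three
    neighbouring coefficients; the result is the coefficient for [a + 1]. *)
Lemma fcoef_times_sin2 a k : 0 < Re a ->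
  (fcoef a (S k) = 2 * kappa a * fcoef (a + 1) (S k) + / 2 * fcoef a (S (S k)) + / 2 * fcoef a k)%C.
Proof.
  intros Ha.
  assert (H0 := a_plus_1_neq_0 a Ha).
  assert (H1 := INR_S_shift_neq_0 k a Ha). assert (H2 := INR_S_shift_neq_0 (S k) a Ha).
  assert (E := fcoef_shift_parameter a k Ha).
  assert (E3 : fcoef (a + 1) (S k) = (- (1 + a) * (1 + a) * fcoef a k
     / ((RtoC (INR (S k)) + a) * (RtoC (INR (S (S k))) + a)))%C).
  { rewrite <- E. field. auto. }
  rewrite E3. unfold kappa. cbn [fcoef].
  assert (E4 : RtoC (INR (S (S k))) = (RtoC (INR k) + 1 + 1)%C) by (rewrite !S_INR, !RtoC_plus; ring).
  assert (E5 : RtoC (INR (S k)) = (RtoC (INR k) + 1)%C) by (rewrite !S_INR, !RtoC_plus; ring).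
  rewrite E4 in *. rewrite E5 in *. field. auto.
Qed.

Lemma fsum_times_sin2 a N x : 0 < Re a ->
  (RtoC (sin (PI * x) ^ 2) * fsum a N x = kappa a * fsum (a + 1) N x
    + / 2 * fcoef a (S N) * RtoC (cos (2 * PI * INR N * x))
    - / 2 * fcoef a N * RtoC (cos (2 * PI * INR (S N) * x)))%C.
Proof.
  intros Ha. assert (H0 := a_plus_1_neq_0 a Ha).
  assert (Es : sin (PI * x) ^ 2 = (1 - cos (2 * PI * 1 * x)) / 2).
  { replace (2 * PI * 1 * x) with (2 * (PI * x)) by ring. rewrite cos_2a_sin. field. }
  unfold fsum. induction N as [|N IH].
  - cbn [csum fcoef]. rewrite Es. change (INR 1) with 1. change (INR 0) with 0.
    rewrite Rmult_0_r, Rmult_0_l, cos_0. rewrite RtoC_div, RtoC_minus by lra.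
    unfold kappa. field. rewrite Cplus_comm. exact H0.
  - cbn [csum].
    set (S1 := csum (fterm a x) N) in *. set (S2 := csum (fterm (a + 1) x) N) in *.
    replace (RtoC (sin (PI * x) ^ 2) * (1 + 2 * (S1 + fterm a x N)))%C with
      (RtoC (sin (PI * x) ^ 2) * (1 + 2 * S1) + RtoC (sin (PI * x) ^ 2) * 2 * fterm a x N)%C by ring.
    rewrite IH. unfold fterm.
    assert (Et : 2 * cos (2 * PI * 1 * x) * cos (2 * PI * INR (S N) * x)
      = cos (2 * PI * INR N * x) + cos (2 * PI * INR (S (S N)) * x)).
    { replace (2 * PI * INR N * x) with (2 * PI * INR (S N) * x - 2 * PI * 1 * x) by (rewrite S_INR; ring).
      replace (2 * PI * INR (S (S N)) * x) with (2 * PI * INR (S N) * x + 2 * PI * 1 * x)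
        by (rewrite (S_INR (S N)); ring).
      rewrite cos_minus, cos_plus. ring. }
    set (c1 := cos (2 * PI * 1 * x)) in *. set (cN := cos (2 * PI * INR N * x)) in *.
    set (cM := cos (2 * PI * INR (S N) * x)) in *. set (cL := cos (2 * PI * INR (S (S N)) * x)) in *.
    assert (Et' : (RtoC cL = 2 * RtoC c1 * RtoC cM - RtoC cN)%C).
    { rewrite <- !RtoC_mult, <- RtoC_minus. f_equal. lra. }
    rewrite Et', Es, RtoC_div, RtoC_minus by lra.
    assert (E := fcoef_times_sin2 a N Ha).
    set (f0 := fcoef a N) in *. set (f1 := fcoef a (S N)) in *. set (f2 := fcoef a (S (S N))) in *.
    set (g1 := fcoef (a + 1) (S N)) in *. set (kp := kappa a) in *.
    transitivity (kp * (1 + 2 * S2) + / 2 * f1 * RtoC cN - / 2 * f0 * RtoC cM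
       + f1 * RtoC cM - RtoC c1 * f1 * RtoC cM)%C; [field|].
    replace (f1 * RtoC cM)%C with ((2 * kp * g1 + / 2 * f2 + / 2 * f0) * RtoC cM)%C at 1
      by (rewrite <- E; reflexivity).
    field.
Qed.

Lemma fcoef_cv_0 a : 0 < Re a -> Ccv (fcoef a) 0.
Proof.
  intros Ha. apply (Ccv_bound _ _ (fun N => fcoef_const (Cmod a) * Rpower (INR N) (- (1 + 2 * Re a)))).
  - apply is_lim_seq_scal_0, is_lim_seq_Rpower_neg; lra.
  - exists 1%nat. intros n Hn. replace (fcoef a n - 0)%C with (fcoef a n) by ring.
    replace (- (1 + 2 * Re a)) with (- 1 - 2 * Re a) by ring. apply fcoef_bound; auto. lra.
Qed.

Lemma Ccv_0_mult_bounded (u : nat -> C) (y : nat -> R) :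
  Ccv u 0 -> (forall n, Rabs (y n) <= 1) -> Ccv (fun n => u n * RtoC (y n))%C 0.
Proof.
  intros H Hy e He. destruct (H e He) as [N HN]. exists N. intros n Hn. specialize (HN n Hn).
  replace (u n * RtoC (y n) - 0)%C with ((u n - 0) * RtoC (y n))%C by ring.
  eapply Rle_lt_trans; [|exact HN]. apply Cmod_mult_bounded; auto. lra.
Qed.

Lemma fourier_times_sin2 a x : 0 < Re a ->
  (RtoC (sin (PI * x) ^ 2) * fourier a x = kappa a * fourier (a + 1) x)%C.
Proof.
  intros Ha.
  apply (Ccv_unique (fun N => RtoC (sin (PI * x) ^ 2) * fsum a N x)%C).
  - apply Ccv_scal, fsum_cv; auto.
  - eapply Ccv_ext; [intros n; symmetry; apply fsum_times_sin2; auto|].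
    replace (kappa a * fourier (a + 1) x)%C with (kappa a * fourier (a + 1) x + 0 - 0)%C by ring.
    assert (H0 := fcoef_cv_0 a Ha).
    assert (H1 : Ccv (fun n => fcoef a (S n)) 0) by (apply (Ccv_subseq _ _ S); auto; intros; lia).
    apply Ccv_minus; [apply Ccv_plus|].
    + apply Ccv_scal, fsum_cv. rewrite Re_plus_1. lra.
    + apply Ccv_0_mult_bounded; [|intros; apply Rabs_cos_le_1].
      replace (RtoC 0) with (/ 2 * 0)%C by ring. apply Ccv_scal; auto.
    + apply Ccv_0_mult_bounded; [|intros; apply Rabs_cos_le_1].
      replace (RtoC 0) with (/ 2 * 0)%C by ring. apply Ccv_scal; auto.
Qed.

(** For [Re a <= 1] the series cannot be differentiated termwise; multiplying
    it by [sin (pi x) ^ 2] raises the parameter by one. *)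
Theorem fourier_sine_power a x : 0 < Re a -> 0 < x < 1 ->
  fourier a x = (fourier a (1/2) * rpow (sin (PI * x)) (2 * a))%C.
Proof.
  intros Ha Hx.
  assert (Ha' : 1 < Re (a + 1)%C) by (rewrite Re_plus_1; lra).
  assert (H1 : forall y, 0 < y < 1 ->
    (rpow (sin (PI * y)) 2 * fourier a y = kappa a * fourier (a + 1) (1/2) * rpow (sin (PI * y)) (2 * (a + 1)))%C).
  { intros y Hy. rewrite <- Cmult_assoc, <- fourier_sine_power_large, <- fourier_times_sin2 by auto.
    f_equal. assert (Hs := sin_PI_mult_pos y Hy).
    rewrite rpow_real. f_equal. rewrite <- (Rpower_pow 2) by auto. reflexivity. }
  assert (H2 : forall y, 0 < y < 1 ->
    fourier a y = (kappa a * fourier (a + 1) (1/2) * rpow (sin (PI * y)) (2 * a))%C).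
  { intros y Hy. specialize (H1 y Hy).
    replace (2 * (a + 1))%C with (2 * a + 2)%C in H1 by ring. rewrite rpow_plus in H1.
    assert (Hn := rpow_neq_0 (sin (PI * y)) 2).
    replace (fourier a y) with (/ rpow (sin (PI * y)) 2 * (rpow (sin (PI * y)) 2 * fourier a y))%C by (field; auto).
    rewrite H1. field. auto. }
  rewrite (H2 x Hx), (H2 (1/2)) by lra.
  replace (PI * (1/2)) with (PI / 2) by field. rewrite sin_PI2, rpow_1_l. ring.
Qed.

Lemma fourier_half_shift a : 0 < Re a -> fourier a (1/2) = (kappa a * fourier (a + 1) (1/2))%C.
Proof.
  intros Ha. rewrite <- fourier_times_sin2 by auto.
  replace (PI * (1/2)) with (PI / 2) by field. rewrite sin_PI2. rewrite pow1. ring.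
Qed.

(** * Sampling the Fourier series at equidistant points *)

Lemma Ccv_csum (u : nat -> nat -> C) (v : nat -> C) (n : nat) :
  (forall j, (j < n)%nat -> Ccv (fun N => u N j) (v j)) ->
  Ccv (fun N => csum (u N) n) (csum v n).
Proof.
  induction n; intros H; cbn [csum]; [apply Ccv_const|].
  apply Ccv_plus; auto.
Qed.

Lemma cos_csum (L m : nat) : (0 < L)%nat ->
  csum (fun j => RtoC (cos (2 * PI * INR m * (INR j / INR L)))) L
   = if (m mod L =? 0)%nat then RtoC (INR L) else RtoC 0.
Proof.
  intros HL.
  assert (E : forall n, csum (fun j => RtoC (cos (2 * PI * INR m * (INR j / INR L)))) n
    = RtoC (Re (csum (fun j => (unity_root L ^ m) ^ j)%C n))).
  { induction n as [|n IH]; cbn [csum]; [reflexivity|].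
    rewrite IH, re_plus, RtoC_plus. do 2 f_equal.
    rewrite <- Cpow_mult_r, unity_root_pow, Cexp_Ci. simpl Re. f_equal.
    rewrite mult_INR. unfold Rdiv. ring. }
  rewrite E. destruct (Nat.eqb_spec (m mod L) 0).
  - rewrite unity_root_sum_dvd by auto. now rewrite re_RtoC.
  - rewrite unity_root_sum by auto. reflexivity.
Qed.

Lemma cos_plus_nat_PI (y : R) (j : nat) : (RtoC (cos (y + INR j * PI)) = (- (1)) ^ j * RtoC (cos y))%C.
Proof.
  induction j as [|j IH].
  - simpl. rewrite Rmult_0_l, Rplus_0_r. ring.
  - rewrite S_INR. replace (y + (INR j + 1) * PI) with (y + INR j * PI + PI) by ring.
    rewrite neg_cos, RtoC_opp, IH. simpl. ring.
Qed.

Lemma alternating_cos_csum (l k : nat) : (0 < l)%nat ->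
  csum (fun j => (- (1)) ^ j * RtoC (cos (2 * PI * INR k * (INR j / INR (2 * l)))))%C (2 * l)
   = if ((k + l) mod (2 * l) =? 0)%nat then RtoC (INR (2 * l)) else RtoC 0.
Proof.
  intros Hl. rewrite <- cos_csum by lia. apply csum_ext. intros j _.
  rewrite <- cos_plus_nat_PI. do 2 f_equal. rewrite plus_INR, mult_INR. simpl (INR 2).
  field. apply not_0_INR; lia.
Qed.

(** Weights orthogonal to all frequencies outside one residue class turn the
    sampled series into a subseries of its coefficients. *)
Lemma fourier_sampling a (L : nat) (w : nat -> C) (r : nat) (b c : C) : 0 < Re a -> (r < L)%nat ->
  csum w L = b ->
  (forall k, csum (fun j => w j * RtoC (cos (2 * PI * INR (S k) * (INR j / INR L))))%C L
     = if (k mod L =? r)%nat then c else 0%C) ->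
  csum (fun j => w j * fourier a (INR j / INR L))%C L
    = (b + 2 * c * Cser (fun q => fcoef a (S (L * q + r))))%C.
Proof.
  intros Ha Hr Hb Hc.
  assert (HE : forall N, csum (fun j => w j * fsum a N (INR j / INR L))%C L
     = (b + 2 * csum (fun k => fcoef a (S k) * (if (k mod L =? r)%nat then c else 0%C)) N)%C).
  { intros N. unfold fsum.
    rewrite (csum_ext _ (fun j => w j + 2 * csum (fun k => w j * fterm a (INR j / INR L) k) N)%C)
      by (intros; rewrite csum_scal; ring).
    rewrite csum_plus, csum_scal, Hb, csum_exchange. do 2 f_equal.
    apply csum_ext. intros k _. rewrite <- Hc, <- csum_scal. apply csum_ext. intros j _.
    unfold fterm. ring. }
  assert (Hd := fcoef_pdom (Cmod a) a Ha (Rle_refl _)).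
  set (u := fun k => (fcoef a (S k) * (if (k mod L =? r)%nat then 1 else 0))%C).
  assert (Hu : pdom u (fcoef_const (Cmod a)) (2 * Re a)).
  { intros k. unfold u. eapply Rle_trans; [|apply Hd].
    destruct (k mod L =? r)%nat.
    - rewrite Cmult_1_r. lra.
    - rewrite Cmult_0_r, Cmod_0. apply Cmod_ge_0. }
  assert (Hsp : Ccv (csum (fun q => u (L * q + r)%nat)) (Cser u)).
  { apply Ccv_csum_sparse; auto.
    - intros q j Hj Hne. unfold u.
      replace (L * q + j)%nat with (j + q * L)%nat by ring.
      rewrite Nat.Div0.mod_add, Nat.mod_small by auto.
      destruct (Nat.eqb_spec j r); [contradiction|]. ring.
    - eapply pdom_cv; [|exact Hu]. lra. }
  assert (Eser : Cser (fun q => fcoef a (S (L * q + r))) = Cser u).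
  { apply Cser_unique. eapply Ccv_ext; [|exact Hsp]. intros n. apply csum_ext. intros q _.
    unfold u. replace (L * q + r)%nat with (r + q * L)%nat by ring.
    rewrite Nat.Div0.mod_add, Nat.mod_small, Nat.eqb_refl by auto. ring. }
  rewrite Eser.
  apply (Ccv_unique (fun N => csum (fun j => w j * fsum a N (INR j / INR L))%C L)).
  - apply Ccv_csum. intros j _. apply Ccv_scal, fsum_cv; auto.
  - eapply Ccv_ext; [intros n; symmetry; apply HE|].
    apply Ccv_plus; [apply Ccv_const|].
    apply (Ccv_ext (fun n => 2 * c * csum u n)%C).
    + intros n. rewrite <- Cmult_assoc, <- (csum_scal c). f_equal. apply csum_ext.
      intros k _. unfold u. destruct (k mod L =? r)%nat; ring.
    + apply Ccv_scal. eapply pdom_cv; [|exact Hu]. lra.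
Qed.

Definition sine_mean (a : C) (L : nat) : C :=
  (/ RtoC (INR L) * csum (fun k => rpow (sin (PI * (INR (S k) / INR L))) (2 * a)) (L - 1))%C.

Lemma fraction_in_01 (k L : nat) : (k < L - 1)%nat -> 0 < INR (S k) / INR L < 1.
Proof.
  intros Hk. assert (H1 := INR_S_pos k). assert (H2 : INR (S k) < INR L) by (apply lt_INR; lia).
  split; [apply Rdiv_lt_0_compat; lra|].
  apply Rmult_lt_reg_r with (INR L); [lra|].
  replace (INR (S k) / INR L * INR L) with (INR (S k)) by (field; lra). lra.
Qed.

Lemma Rpower_le_1 (u y : R) : 0 < u <= 1 -> 0 <= y -> Rpower u y <= 1.
Proof.
  intros Hu Hy. rewrite <- (Rpower_1_base y). apply Rle_Rpower_l; auto.
Qed.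

Lemma sine_mean_le_1 a L : 0 < Re a -> (1 <= L)%nat -> Cmod (sine_mean a L) <= 1.
Proof.
  intros Ha HL. unfold sine_mean. assert (HL0 : 0 < INR L) by (apply lt_0_INR; lia).
  rewrite Cmod_mult, Cmod_inv, Cmod_R, Rabs_pos_eq by (try lra; intro E; apply RtoC_inj in E; lra).
  apply Rle_trans with (/ INR L * INR (L - 1)).
  - apply Rmult_le_compat_l; [left; apply Rinv_0_lt_compat; auto|].
    eapply Rle_trans; [apply Cmod_csum_le with (M := fun _ => 1)|].
    + intros k Hk. rewrite Cmod_rpow. assert (Hx := fraction_in_01 k L Hk).
      apply Rpower_le_1.
      * split; [apply sin_PI_mult_pos; auto | apply SIN_bound].
      * rewrite re_scal_l. lra.
    + rewrite rsum_const. lra.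
  - rewrite minus_INR by auto. simpl (INR 1).
    replace (/ INR L * (INR L - 1)) with (1 - / INR L) by (field; lra).
    assert (0 < / INR L) by (apply Rinv_0_lt_compat; auto). lra.
Qed.

Lemma fourier_sample_mean a L : 0 < Re a -> (1 <= L)%nat ->
  (fourier a (1/2) * sine_mean a L = 1 + 2 * Cser (fun q => fcoef a (S (L * q + (L - 1)))))%C.
Proof.
  intros Ha HL. assert (HL0 : 0 < INR L) by (apply lt_0_INR; lia).
  assert (HLC : RtoC (INR L) <> 0%C) by (intro E; apply RtoC_inj in E; lra).
  assert (H := fourier_sampling a L (fun _ => 1%C) (L - 1) (RtoC (INR L)) (RtoC (INR L)) Ha ltac:(lia)).
  rewrite csum_const in H. specialize (H ltac:(ring)).
  assert (Hc : forall k, csum (fun j => 1 * RtoC (cos (2 * PI * INR (S k) * (INR j / INR L))))%C L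
     = if (k mod L =? L - 1)%nat then RtoC (INR L) else 0%C).
  { intros k. rewrite (csum_ext _ (fun j => RtoC (cos (2 * PI * INR (S k) * (INR j / INR L)))))
      by (intros; ring).
    rewrite cos_csum by lia.
    assert (Ek := Nat.div_mod_eq k L). assert (Hb := Nat.mod_upper_bound k L ltac:(lia)).
    replace (S k) with ((k mod L + 1) + (k / L) * L)%nat by lia.
    rewrite Nat.Div0.mod_add.
    destruct (Nat.eqb_spec (k mod L) (L - 1)) as [E|E].
    - rewrite E. replace (L - 1 + 1)%nat with L by lia. rewrite Nat.Div0.mod_same. reflexivity.
    - rewrite Nat.mod_small by lia. rewrite Nat.add_1_r. reflexivity. }
  specialize (H Hc).
  set (F := fun j => (1 * fourier a (INR j / INR L))%C) in H.
  assert (HS : csum F L = (F 0%nat + csum (fun k => F (S k)) (L - 1))%C).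
  { replace L with (S (L - 1)) at 1 by lia. apply csum_shift. }
  rewrite HS in H. unfold F in H.
  replace (INR 0 / INR L) with 0 in H by (simpl; field; lra).
  rewrite fourier_0 in H by auto.
  rewrite (csum_ext _ (fun k => fourier a (1/2) * rpow (sin (PI * (INR (S k) / INR L))) (2 * a))%C) in H.
  2:{ intros k Hk. rewrite Cmult_1_l. apply fourier_sine_power; auto. apply fraction_in_01; auto. }
  rewrite csum_scal in H.
  unfold sine_mean.
  transitivity (/ RtoC (INR L) * (1 * 0 + fourier a (1/2) * csum (fun k => rpow (sin (PI * (INR (S k) / INR L))) (2 * a)) (L - 1)))%C;
    [ring|].
  rewrite H. field. auto.
Qed.

Lemma fcoef_subseries_cv_0 a : 0 < Re a ->
  Ccv (fun L => Cser (fun q => fcoef a (S (S L * q + L)))) 0.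
Proof.
  intros Ha.
  set (K := fcoef_const (Cmod a)). set (d := 2 * Re a).
  apply (Ccv_bound _ _ (fun L => (K * (1 + / d)) * Rpower (INR (L + 1)) (- (1 + d)))).
  - apply is_lim_seq_scal_0.
    apply (is_lim_seq_incr_n (fun L => Rpower (INR L) (- (1 + d))) 1).
    apply is_lim_seq_Rpower_neg. unfold d; lra.
  - exists 0%nat. intros L _.
    replace (Cser (fun q => fcoef a (S (S L * q + L))) - 0)%C
      with (Cser (fun q => fcoef a (S (S L * q + L)))) by ring.
    replace (K * (1 + / d) * Rpower (INR (L + 1)) (- (1 + d)))
      with ((K * Rpower (INR (S L)) (- 1 - d)) * (1 + / d)).
    2:{ rewrite Nat.add_1_r. replace (- (1 + d)) with (- 1 - d) by ring. ring. }
    apply pdom_total; [unfold d; lra|].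
    intros q. replace (S (S L * q + L)) with (S L * S q)%nat by lia.
    eapply Rle_trans; [apply fcoef_bound; [auto | apply Rle_refl | lia]|].
    rewrite mult_INR, <- Rpower_mult_distr by apply INR_S_pos. fold K d. right; ring.
Qed.

(** The Riemann sums of the Fourier series tend to its constant coefficient,
    all higher coefficients that survive the sampling being of index at least
    [L]. *)
Lemma sine_mean_cv_1 a : 0 < Re a -> Ccv (fun L => fourier a (1/2) * sine_mean a (S L))%C 1.
Proof.
  intros Ha.
  replace (RtoC 1) with (1 + 2 * 0)%C by ring.
  apply (Ccv_ext (fun L => 1 + 2 * Cser (fun q => fcoef a (S (S L * q + L))))%C).
  - intros L. rewrite fourier_sample_mean by (auto; lia). do 3 f_equal.
    simpl. rewrite Nat.sub_0_r. reflexivity.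
  - apply Ccv_plus; [apply Ccv_const|]. apply Ccv_scal, fcoef_subseries_cv_0; auto.
Qed.

(** The means of the power of the sine are at most one in modulus, and their
    products with this number tend to one.  In particular it does not vanish. *)
Lemma fourier_half_ge_1 a : 0 < Re a -> 1 <= Cmod (fourier a (1/2)).
Proof.
  intros Ha. replace 1 with (Cmod 1) at 1 by apply Cmod_1.
  apply (Ccv_Cmod_le _ _ _ 0%nat (sine_mean_cv_1 a Ha)).
  intros L _. rewrite Cmod_mult.
  assert (H := sine_mean_le_1 a (S L) Ha ltac:(lia)).
  generalize (Cmod_ge_0 (fourier a (1/2))). nra.
Qed.

Lemma fourier_half_neq_0 a : 0 < Re a -> fourier a (1/2) <> 0%C.
Proof. intros Ha. apply Cmod_gt_0. generalize (fourier_half_ge_1 a Ha). lra. Qed.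

(** The mean value of [sin (pi x) ^ (2 a)] over a period: [fourier a] has mean
    value one, and [fourier a (1/2)] is its factor of proportionality to the
    power of the sine. *)
Definition wallis (a : C) : C := (/ fourier a (1/2))%C.

Lemma wallis_neq_0 a : 0 < Re a -> wallis a <> 0%C.
Proof.
  intros Ha E. assert (H := fourier_half_neq_0 a Ha). assert (E' := Cinv_r _ H).
  unfold wallis in E. rewrite E, Cmult_0_r in E'. apply RtoC_inj in E'. lra.
Qed.

Lemma wallis_le_1 a : 0 < Re a -> Cmod (wallis a) <= 1.
Proof.
  intros Ha. unfold wallis. rewrite Cmod_inv by (apply fourier_half_neq_0; auto).
  apply Rle_trans with (/ 1); [|lra].
  apply Rinv_le_contravar; [lra | apply fourier_half_ge_1; auto].
Qed.

Lemma sine_mean_cv a : 0 < Re a -> Ccv (fun L => sine_mean a (S L)) (wallis a).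
Proof.
  intros Ha. assert (H := fourier_half_neq_0 a Ha).
  replace (wallis a) with (wallis a * 1)%C by ring.
  apply (Ccv_ext (fun L => wallis a * (fourier a (1/2) * sine_mean a (S L)))%C).
  - intros L. unfold wallis. field. auto.
  - apply Ccv_scal, sine_mean_cv_1; auto.
Qed.

Lemma wallis_rec a : 0 < Re a -> wallis (a + 1) = (kappa a * wallis a)%C.
Proof.
  intros Ha. unfold wallis. rewrite (fourier_half_shift a Ha).
  assert (H1 := kappa_neq_0 a Ha).
  assert (H2 := fourier_half_neq_0 (a + 1) ltac:(rewrite Re_plus_1; lra)).
  field. auto.
Qed.

Lemma rpow_minus_1_bound (u : R) (b : C) : 0 < u <= 1 -> 1 <= Re b ->
  Cmod (rpow u b - 1) <= Cmod b * (1 - u).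
Proof.
  intros Hu Hb. rewrite Cmod_minus_sym. rewrite <- (rpow_1_l b) at 1.
  apply (mean_value_bound (fun v => rpow v b) (fun v => b * RtoC 1 * rpow v (b - 1))%C); [lra| |].
  - intros v Hv. apply (Cderiv_rpow_comp b (fun v => v)); [apply (is_derive_id (K := R_AbsRing) v) | lra].
  - intros v Hv. rewrite Cmult_1_r, Cmod_mult, Cmod_rpow.
    assert (Rpower v (Re (b - 1)%C) <= 1).
    { apply Rpower_le_1; [lra|]. unfold Cminus. rewrite re_plus, re_opp. simpl. lra. }
    generalize (Cmod_ge_0 b). nra.
Qed.

Definition nC (n : nat) : C := RtoC (INR n).

Lemma Re_nC n : Re (nC n) = INR n.
Proof. reflexivity. Qed.

Lemma nC_S n : nC (S n) = (nC n + 1)%C.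
Proof. unfold nC. rewrite S_INR, RtoC_plus. reflexivity. Qed.

(** Adding a fixed [a] to a large exponent hardly changes the mean value: the
    powers differ only where [sin ^ 2] is far from one, which is measured by
    the difference of two consecutive mean values. *)
Lemma wallis_shift_bound a n : 0 < Re a -> (1 <= n)%nat ->
  Cmod (wallis (a + nC (S n)) - wallis (nC (S n)))
    <= (Cmod (a + 1) + 1) * Cmod (wallis (nC n) - wallis (nC (S n))).
Proof.
  intros Ha Hn.
  assert (Hn1 : 0 < INR n) by (apply lt_0_INR; lia).
  assert (HnS : 0 < INR (S n)) by apply INR_S_pos.
  set (K := Cmod (a + 1) + 1).
  assert (HK : 0 <= K) by (unfold K; generalize (Cmod_ge_0 (a + 1)); lra).
  assert (HL : forall L, Cmod (sine_mean (a + nC (S n)) (S L) - sine_mean (nC (S n)) (S L))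
     <= K * Cmod (sine_mean (nC n) (S L) - sine_mean (nC (S n)) (S L))).
  { intros L. unfold sine_mean.
    match goal with |- Cmod (?c * ?x - ?c * ?y) <= _ * Cmod (?c * ?z - ?c * ?y) =>
      replace (c * x - c * y)%C with (c * (x - y))%C by ring;
      replace (c * z - c * y)%C with (c * (z - y))%C by ring end.
    rewrite !Cmod_mult, <- Rmult_assoc, (Rmult_comm K), Rmult_assoc.
    apply Rmult_le_compat_l; [apply Cmod_ge_0|].
    rewrite <- !csum_minus.
    set (u := fun k => (sin (PI * (INR (S k) / INR (S L)))) ^ 2).
    assert (Hu : forall k, (k < S L - 1)%nat -> 0 < u k <= 1).
    { intros k Hk. assert (H0 := fraction_in_01 k (S L) Hk).
      assert (H1 := sin_PI_mult_pos _ H0). assert (H2 := SIN_bound (PI * (INR (S k) / INR (S L)))).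
      unfold u. split; [apply pow_lt; auto | nra]. }
    assert (Hp : forall k b, (k < S L - 1)%nat ->
       rpow (sin (PI * (INR (S k) / INR (S L)))) (2 * b) = rpow (u k) b).
    { intros k b Hk. assert (H1 := sin_PI_mult_pos _ (fraction_in_01 k (S L) Hk)).
      unfold rpow, u. cbn [pow]. rewrite Rmult_1_r, ln_mult by auto. f_equal.
      rewrite RtoC_plus. ring. }
    assert (HR : csum (fun k => rpow (sin (PI * (INR (S k) / INR (S L)))) (2 * nC n)
        - rpow (sin (PI * (INR (S k) / INR (S L)))) (2 * nC (S n)))%C (S L - 1)
       = RtoC (rsum (fun k => Rpower (u k) (INR n) * (1 - u k)) (S L - 1))).
    { rewrite <- csum_RtoC. apply csum_ext. intros k Hk. rewrite !Hp by auto.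
      destruct (Hu k Hk). rewrite nC_S, rpow_plus, rpow_1 by auto. unfold nC. rewrite rpow_real.
      rewrite RtoC_mult, RtoC_minus. ring. }
    rewrite HR, Cmod_R.
    apply Rle_trans with (rsum (fun k => K * (Rpower (u k) (INR n) * (1 - u k))) (S L - 1)).
    - apply Cmod_csum_le. intros k Hk. rewrite !Hp by auto. destruct (Hu k Hk) as [Hu0 Hu1].
      replace (a + nC (S n))%C with (nC n + (a + 1))%C by (rewrite nC_S; ring).
      rewrite nC_S, !rpow_plus, rpow_1 by auto.
      replace (rpow (u k) (nC n) * (rpow (u k) a * RtoC (u k)) - rpow (u k) (nC n) * RtoC (u k))%C
        with (rpow (u k) (nC n) * ((rpow (u k) (a + 1) - 1) + (1 - RtoC (u k))))%C
        by (rewrite rpow_plus, rpow_1 by auto; ring).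
      rewrite Cmod_mult, Cmod_rpow, Re_nC.
      replace (K * (Rpower (u k) (INR n) * (1 - u k))) with (Rpower (u k) (INR n) * (K * (1 - u k))) by ring.
      apply Rmult_le_compat_l; [left; apply Rpower_pos|].
      eapply Rle_trans; [apply Cmod_triangle|]. unfold K. rewrite Rmult_plus_distr_r.
      apply Rplus_le_compat.
      + apply rpow_minus_1_bound; [auto | rewrite Re_plus_1; lra].
      + rewrite <- RtoC_minus, Cmod_R, Rabs_pos_eq; lra.
    - rewrite rsum_scal. apply Rmult_le_compat_l; auto. apply Rle_abs. }
  assert (C1 : Ccv (fun L => sine_mean (a + nC (S n)) (S L) - sine_mean (nC (S n)) (S L))%C
     (wallis (a + nC (S n)) - wallis (nC (S n)))).
  { apply Ccv_minus; apply sine_mean_cv; [rewrite re_plus, Re_nC; lra | rewrite Re_nC; auto]. }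
  assert (C2 : Ccv (fun L => sine_mean (nC n) (S L) - sine_mean (nC (S n)) (S L))%C
     (wallis (nC n) - wallis (nC (S n)))).
  { apply Ccv_minus; apply sine_mean_cv; rewrite Re_nC; auto. }
  apply (is_lim_seq_le _ _ (Cmod (wallis (a + nC (S n)) - wallis (nC (S n))))
    (K * Cmod (wallis (nC n) - wallis (nC (S n)))) HL (Ccv_Cmod _ _ C1)).
  apply (is_lim_seq_scal_l _ K (Cmod (wallis (nC n) - wallis (nC (S n))))), Ccv_Cmod, C2.
Qed.

Lemma kappa_nC n : kappa (nC n) = RtoC ((2 * INR n + 1) / (2 * INR n + 2)).
Proof.
  unfold kappa, nC. assert (H := pos_INR n). rewrite RtoC_div by lra.
  rewrite !RtoC_plus, !RtoC_mult.
  replace (2 * (RtoC (INR n) + 1))%C with (2 * RtoC (INR n) + 2)%C by ring. reflexivity.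
Qed.

(** Consecutive mean values with integral exponents differ by a relative
    [O(1 / n)], so [wallis_shift_bound] applies.  Together with [wallis_rec] this
    expresses [wallis a] as an infinite product. *)
Lemma wallis_ratio_cv a : 0 < Re a -> Ccv (fun n => wallis (a + nC n) / wallis (nC n))%C 1.
Proof.
  intros Ha.
  set (K := Cmod (a + 1) + 1).
  assert (HK : 0 <= K) by (unfold K; generalize (Cmod_ge_0 (a + 1)); lra).
  apply (Ccv_bound _ _ (fun n => K * (2 / INR n))).
  - apply is_lim_seq_inv_INR.
  - exists 2%nat. intros n Hn. destruct n as [|n]; [lia|].
    assert (Hn1 : 1 <= INR n) by (apply (le_INR 1); lia).
    assert (H0 := wallis_neq_0 (nC n) ltac:(rewrite Re_nC; lra)).
    assert (HnS := INR_S_pos n).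
    assert (H1 := wallis_neq_0 (nC (S n)) ltac:(rewrite Re_nC; lra)).
    assert (Hb := wallis_shift_bound a n Ha ltac:(lia)). fold K in Hb.
    assert (Hr := wallis_rec (nC n) ltac:(rewrite Re_nC; lra)). rewrite <- nC_S in Hr.
    replace (wallis (a + nC (S n)) / wallis (nC (S n)) - 1)%C
      with ((wallis (a + nC (S n)) - wallis (nC (S n))) / wallis (nC (S n)))%C by (field; auto).
    rewrite Cmod_div by auto. apply Rdiv_le_of_mult; [apply Cmod_gt_0; auto|].
    eapply Rle_trans; [exact Hb|]. rewrite Rmult_assoc. apply Rmult_le_compat_l; auto.
    rewrite Hr. replace (wallis (nC n) - kappa (nC n) * wallis (nC n))%C
      with ((1 - kappa (nC n)) * wallis (nC n))%C by ring.
    rewrite !Cmod_mult, <- Rmult_assoc. apply Rmult_le_compat_r; [apply Cmod_ge_0|].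
    rewrite kappa_nC, <- RtoC_minus, !Cmod_R, S_INR.
    replace (1 - (2 * INR n + 1) / (2 * INR n + 2)) with (/ (2 * INR n + 2)) by (field; lra).
    assert (0 < (2 * INR n + 1) / (2 * INR n + 2)) by (apply Rdiv_lt_0_compat; lra).
    rewrite !Rabs_pos_eq by (left; auto; apply Rinv_0_lt_compat; lra).
    apply Rmult_le_reg_r with ((2 * INR n + 2) * (INR n + 1)); [nra|].
    replace (/ (2 * INR n + 2) * ((2 * INR n + 2) * (INR n + 1))) with (INR n + 1) by (field; lra).
    replace (2 / (INR n + 1) * ((2 * INR n + 1) / (2 * INR n + 2)) * ((2 * INR n + 2) * (INR n + 1)))
      with (2 * (2 * INR n + 1)) by (field; lra). lra.
Qed.

(** * Comparison of the gamma factors at a and at 2 a *)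

Fixpoint rprod (u : nat -> R) (n : nat) : R :=
  match n with O => 1 | S m => rprod u m * u m end.

Lemma rprod_le u v n : (forall i, (i < n)%nat -> 0 <= u i <= v i) -> 0 <= rprod u n <= rprod v n.
Proof.
  induction n; intros H; cbn [rprod]; [lra|].
  assert (H1 := H n ltac:(lia)). assert (H2 := IHn ltac:(auto)).
  split; [apply Rmult_le_pos; lra | apply Rmult_le_compat; lra].
Qed.

Lemma rprod_mult u v n : rprod (fun i => u i * v i) n = rprod u n * rprod v n.
Proof. induction n; cbn [rprod]; [ring|]. rewrite IHn. ring. Qed.

Lemma rprod_one_minus (x : nat -> R) n : (forall i, (i < n)%nat -> 0 <= x i <= 1) ->
  1 - rsum x n <= rprod (fun i => 1 - x i) n <= 1.
Proof.
  induction n; intros H; cbn [rsum rprod]; [lra|].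
  assert (H1 := H n ltac:(lia)). assert (H2 := IHn ltac:(auto)).
  assert (0 <= rsum x n) by (apply rsum_nonneg; intros; apply H; lia).
  assert (H3 : 0 <= rprod (fun i => 1 - x i) n).
  { apply (rprod_le (fun i => 1 - x i) (fun i => 1 - x i)). intros. specialize (H i ltac:(lia)). lra. }
  nra.
Qed.

(** This is [Gamma(a + 1/2) / (sqrt pi Gamma(- a))]. *)
Definition gamma_factor (a : C) : C := (fcoef_lim a * wallis a)%C.

(** The moduli of the factors of the product for [gamma_factor a]. *)
Definition gquot (a : C) (i : nat) : R := Cmod (nC i - a) / Cmod (a + nC i + RtoC (1/2)).

Lemma shift_half_neq_0 a x : 0 < Re a -> 0 <= x -> (a + RtoC x)%C <> 0%C.
Proof. intros Ha Hx. rewrite Cplus_comm. apply shift_neq_0. lra. Qed.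

Lemma fcoef_wallis_product a n : 0 < Re a ->
  Cmod (fcoef a n) * Cmod (wallis a) = rprod (gquot a) n * Cmod (wallis (a + nC n)).
Proof.
  intros Ha. induction n as [|n IH]; cbn [rprod fcoef].
  - rewrite Cmod_1. unfold nC. simpl (INR 0). do 3 f_equal. ring.
  - assert (Hn := pos_INR n).
    assert (H0 : 0 < Re (a + nC n)%C) by (rewrite re_plus, Re_nC; lra).
    replace (a + nC (S n))%C with (a + nC n + 1)%C by (rewrite nC_S; ring).
    rewrite wallis_rec by auto.
    assert (H1 := a_plus_1_neq_0 _ H0).
    assert (H2 : (a + nC n + RtoC (1/2))%C <> 0%C) by (apply shift_half_neq_0; lra).
    assert (Hk : kappa (a + nC n) = ((a + nC n + RtoC (1/2)) / (a + nC n + 1))%C).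
    { unfold kappa. rewrite RtoC_div by lra. field. auto. }
    rewrite Hk.
    replace (fcoef a n * ((RtoC (INR n) - a) / (RtoC (INR (S n)) + a)))%C
      with (fcoef a n * ((nC n - a) / (a + nC n + 1)))%C.
    2:{ unfold nC. rewrite S_INR, RtoC_plus. do 2 f_equal. ring. }
    rewrite !Cmod_mult, !Cmod_div by auto.
    change (gquot a n) with (Cmod (nC n - a) / Cmod (a + nC n + RtoC (1/2))).
    assert (P1 := proj1 (Cmod_gt_0 _) H1). assert (P2 := proj1 (Cmod_gt_0 _) H2).
    transitivity (Cmod (fcoef a n) * Cmod (wallis a) * (Cmod (nC n - a) / Cmod (a + nC n + 1)));
      [unfold Rdiv; ring|].
    rewrite IH. field. lra.
Qed.

(** Euler's limit formula for the gamma factor, in moduli. *)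
Lemma gamma_factor_modulus a : 0 < Re a ->
  is_lim_seq (fun n => Rpower (INR n) (2 * Re a + 1) * Cmod (wallis (nC n)) * rprod (gquot a) n)
    (Cmod (gamma_factor a)).
Proof.
  intros Ha.
  apply (is_lim_seq_ext_loc (fun n => Cmod (fcoef_scaled a n) * Cmod (wallis a) / Cmod (wallis (a + nC n) / wallis (nC n))%C)).
  - exists 1%nat. intros n Hn.
    assert (Hn1 : 0 < INR n) by (apply lt_0_INR; lia).
    assert (H1 := wallis_neq_0 (a + nC n) ltac:(rewrite re_plus, Re_nC; lra)).
    assert (H2 := wallis_neq_0 (nC n) ltac:(rewrite Re_nC; lra)).
    assert (P1 := proj1 (Cmod_gt_0 _) H1). assert (P2 := proj1 (Cmod_gt_0 _) H2).
    unfold fcoef_scaled. rewrite Cmod_mult, Cmod_rpow, Re_2a_1, Cmod_div by auto.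
    replace (Rpower (INR n) (2 * Re a + 1) * Cmod (fcoef a n) * Cmod (wallis a))
      with (Rpower (INR n) (2 * Re a + 1) * (Cmod (fcoef a n) * Cmod (wallis a))) by ring.
    rewrite fcoef_wallis_product by auto. field. lra.
  - unfold gamma_factor. rewrite Cmod_mult.
    replace (Cmod (fcoef_lim a) * Cmod (wallis a)) with (Cmod (fcoef_lim a) * Cmod (wallis a) / 1) by field.
    assert (H1 : is_lim_seq (fun n => Cmod (wallis (a + nC n) / wallis (nC n))%C) 1).
    { rewrite <- Cmod_1. apply Ccv_Cmod, wallis_ratio_cv; auto. }
    apply (is_lim_seq_div' (fun n => Cmod (fcoef_scaled a n) * Cmod (wallis a)) _
      (Cmod (fcoef_lim a) * Cmod (wallis a)) 1); [|exact H1|lra].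
    apply (is_lim_seq_mult' (fun n => Cmod (fcoef_scaled a n)) (fun _ => Cmod (wallis a))).
    + apply Ccv_Cmod, fcoef_scaled_cv; auto.
    + apply is_lim_seq_const.
Qed.

Lemma gamma_factor_neq_0 a : 0 < Re a -> Im a <> 0 -> gamma_factor a <> 0%C.
Proof.
  intros Ha Hi. apply Cmult_neq_0; [apply fcoef_lim_neq_0 | apply wallis_neq_0]; auto.
Qed.

Lemma Cmod_sqr_minus_const (w : C) (e : R) : 0 <= e ->
  Cmod w ^ 2 - e ^ 2 <= Cmod (w - RtoC e) * Cmod (w + RtoC e).
Proof.
  intros He. rewrite <- Cmod_mult, <- Cmod_pow.
  replace ((w - RtoC e) * (w + RtoC e))%C with (w ^ 2 - RtoC (e ^ 2))%C
    by (rewrite RtoC_pow; ring).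
  replace (e ^ 2) with (Cmod (RtoC (e ^ 2))) at 1; [apply Cmod_triangle_rev|].
  rewrite Cmod_R. apply Rabs_pos_eq, pow2_ge_0.
Qed.

Section RatioBound.
Variable a : C.
Hypothesis Ha : 0 < Re a.
Hypothesis Hi : Im a <> 0.

Let p i := Cmod (nC i - a).
Let q i := Cmod (nC i + RtoC (1/2) - a).
Let r i := Cmod (a + nC i + RtoC (1/4)).
Let s i := Cmod (a + nC i + RtoC (3/4)).
Let m i := Cmod (a + nC i + RtoC (1/2)).

Lemma real_minus_a_pos (z : C) : Im z = 0 -> 0 < Cmod (z - a).
Proof.
  intros Hz. apply Cmod_gt_0. intro E. apply Hi. assert (E' := f_equal Im E).
  unfold Cminus in E'. rewrite im_plus, im_opp, Hz in E'. change (Im 0%C) with 0 in E'. lra.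
Qed.

Lemma p_pos i : 0 < p i. Proof. apply real_minus_a_pos. reflexivity. Qed.
Lemma q_pos i : 0 < q i.
Proof. apply real_minus_a_pos. rewrite im_plus, im_RtoC. unfold nC. rewrite im_RtoC. ring. Qed.
Lemma plus_a_pos i x : 0 < x -> 0 < Cmod (a + nC i + RtoC x).
Proof.
  intros Hx. apply Cmod_gt_0. apply shift_half_neq_0; [|lra].
  rewrite re_plus, Re_nC. generalize (pos_INR i); lra.
Qed.

(** The duplication formula at the level of partial products: the factors of
    even and of odd index are collected separately. *)
Lemma gquot_double n :
  rprod (gquot (2 * a)) (2 * n) = rprod (fun i => p i * q i / (r i * s i)) n.
Proof.
  induction n as [|n IH]; [reflexivity|].
  replace (2 * S n)%nat with (S (S (2 * n))) by lia. cbn [rprod]. rewrite IH.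
  assert (E1 : gquot (2 * a) (2 * n) = p n / r n).
  { unfold gquot, p, r, nC. rewrite mult_INR. change (INR 2) with 2.
    replace (RtoC (2 * INR n) - 2 * a)%C with (2 * (RtoC (INR n) - a))%C by (rewrite RtoC_mult; ring).
    replace (2 * a + RtoC (2 * INR n) + RtoC (1/2))%C with (2 * (a + RtoC (INR n) + RtoC (1/4)))%C
      by (rewrite RtoC_mult, !RtoC_div by lra; field).
    rewrite !Cmod_mult, Cmod_R, Rabs_pos_eq by lra.
    assert (H := plus_a_pos n (1/4) ltac:(lra)). unfold nC in H. field. lra. }
  assert (E2 : gquot (2 * a) (S (2 * n)) = q n / s n).
  { unfold gquot, q, s, nC. rewrite S_INR, mult_INR. change (INR 2) with 2.
    replace (RtoC (2 * INR n + 1) - 2 * a)%C with (2 * (RtoC (INR n) + RtoC (1/2) - a))%C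
      by (rewrite RtoC_plus, RtoC_mult, !RtoC_div by lra; field).
    replace (2 * a + RtoC (2 * INR n + 1) + RtoC (1/2))%C with (2 * (a + RtoC (INR n) + RtoC (3/4)))%C
      by (rewrite RtoC_plus, RtoC_mult, !RtoC_div by lra; field).
    rewrite !Cmod_mult, Cmod_R, Rabs_pos_eq by lra.
    assert (H := plus_a_pos n (3/4) ltac:(lra)). unfold nC in H. field. lra. }
  rewrite E1, E2.
  assert (H1 := plus_a_pos n (1/4) ltac:(lra)). assert (H2 := plus_a_pos n (3/4) ltac:(lra)).
  fold (r n) in H1. fold (s n) in H2. field. lra.
Qed.

Lemma gquot_square n : rprod (gquot a) n ^ 2
  = rprod (gquot (2 * a)) (2 * n) * rprod (fun i => p i / q i) n * rprod (fun i => r i * s i / m i ^ 2) n.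
Proof.
  rewrite gquot_double. induction n as [|n IH]; cbn [rprod]; [ring|].
  rewrite Rpow_mult_distr, IH. unfold gquot at 1. fold (p n) (m n).
  assert (H1 := plus_a_pos n (1/4) ltac:(lra)). assert (H2 := plus_a_pos n (3/4) ltac:(lra)).
  assert (H3 := plus_a_pos n (1/2) ltac:(lra)).
  fold (r n) in H1. fold (s n) in H2. fold (m n) in H3. assert (H4 := q_pos n).
  field. lra.
Qed.

(** With [w = a + i + 1/2] the factor is [|w ^ 2 - 1/16| / |w| ^ 2], which is
    within a summable distance of one. *)
Lemma even_odd_product_bound n : 1 / 2 <= rprod (fun i => r i * s i / m i ^ 2) n.
Proof.
  set (x := fun i => / (16 * (INR i + 1/2) ^ 2)).
  assert (Hx : forall i, 0 <= x i <= 1).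
  { intros i. assert (H := pos_INR i). unfold x. split.
    - left. apply Rinv_0_lt_compat. nra.
    - apply Rinv_le_1. nra. }
  assert (Hs : rsum x n <= 1 / 2).
  { destruct n as [|n]; [cbn [rsum]; lra|].
    assert (E : rsum x (S n) = x 0%nat + rsum (fun i => x (1 + i)%nat) n).
    { replace (S n) with (1 + n)%nat by lia. rewrite rsum_add. cbn [rsum]. ring. }
    rewrite E.
    assert (H1 : x 0%nat = 1/4) by (unfold x; simpl; field).
    assert (H2 : rsum (fun i => x (1 + i)%nat) n <= rsum (fun i => 1/16 * / INR (1 + i) ^ 2) n).
    { apply rsum_le. intros i _. unfold x. assert (H := INR_S_pos i). change (1 + i)%nat with (S i).
      replace (1/16 * / INR (S i) ^ 2) with (/ (16 * INR (S i) ^ 2)) by (field; lra).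
      apply Rinv_le_contravar; nra. }
    rewrite rsum_scal in H2.
    assert (H3 := Rinv_sqr_sum_tail 1 n (le_n 1)).
    assert (0 < 2 / INR (1 + n)) by (apply Rdiv_lt_0_compat; [lra | apply INR_S_pos]).
    change (INR 1) with 1 in H3. lra. }
  apply Rle_trans with (rprod (fun i => 1 - x i) n).
  - destruct (rprod_one_minus x n ltac:(auto)). lra.
  - apply rprod_le. intros i _. assert (Hxi := Hx i). split; [lra|].
    assert (Hm := plus_a_pos i (1/2) ltac:(lra)). fold (m i) in Hm.
    assert (H := Cmod_sqr_minus_const (a + nC i + RtoC (1/2)) (1/4) ltac:(lra)).
    fold (m i) in H.
    replace (a + nC i + RtoC (1/2) - RtoC (1/4))%C with (a + nC i + RtoC (1/4))%C in H
      by (rewrite !RtoC_div by lra; field).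
    replace (a + nC i + RtoC (1/2) + RtoC (1/4))%C with (a + nC i + RtoC (3/4))%C in H
      by (rewrite !RtoC_div by lra; field).
    fold (r i) (s i) in H.
    assert (Hmi : INR i + 1/2 <= m i).
    { unfold m. eapply Rle_trans; [|apply re_le_Cmod]. eapply Rle_trans; [|apply Rle_abs].
      rewrite !re_plus, Re_nC, re_RtoC. lra. }
    assert (Hii := pos_INR i).
    assert (Hx2 : / (16 * m i ^ 2) <= x i).
    { unfold x. apply Rinv_le_contravar; nra. }
    apply Rle_trans with (1 - / (16 * m i ^ 2)); [lra|].
    apply Rmult_le_reg_r with (m i ^ 2); [nra|].
    replace ((1 - / (16 * m i ^ 2)) * m i ^ 2) with (m i ^ 2 - (1/4) ^ 2) by (field; lra).
    replace (r i * s i / m i ^ 2 * m i ^ 2) with (r i * s i) by (field; lra). exact H.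
Qed.

(** A half step is compared with the geometric mean of a full step: with
    [v = i + 1/2 - a] one has [|v - 1/2| |v + 1/2| >= |v| ^ 2 - 1/4], and the
    full steps telescope.  The errors [1 / (4 |v| ^ 2)] have sum less than one
    because [Im a] is large. *)
Lemma half_step_product_bound (A n : nat) : Re a <= INR A -> INR A + 1 <= Im a ^ 2 ->
  Cmod a / (4 * p n) <= rprod (fun i => p i / q i) n ^ 2.
Proof.
  intros HA HI.
  assert (Hq : forall i, (INR i + 1/2 - Re a) ^ 2 + Im a ^ 2 = q i ^ 2).
  { intros i. unfold q. rewrite Cmod2_alt. unfold Cminus.
    rewrite !re_plus, !im_plus, re_opp, im_opp, !re_RtoC, !im_RtoC. unfold nC.
    rewrite re_RtoC, im_RtoC. ring. }
  assert (HA0 := pos_INR A).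
  set (x := fun i => / (4 * q i ^ 2)).
  assert (Hx : forall i, 0 <= x i <= 1).
  { intros i. assert (H := q_pos i). unfold x. split.
    - left. apply Rinv_0_lt_compat. nra.
    - apply Rinv_le_1. rewrite <- Hq. generalize (pow2_ge_0 (INR i + 1/2 - Re a)). lra. }
  assert (Hs : forall N, rsum x N <= 3 / 4).
  { assert (Hsmall : forall k, (k <= A + 1)%nat -> rsum x k <= 1/4).
    { intros k Hk. apply Rle_trans with (rsum (fun _ => / (4 * (INR A + 1))) k).
      - apply rsum_le. intros i _. unfold x. apply Rinv_le_contravar; [lra|].
        rewrite <- Hq. generalize (pow2_ge_0 (INR i + 1/2 - Re a)). lra.
      - rewrite rsum_const. assert (INR k <= INR A + 1).
        { replace (INR A + 1) with (INR (A + 1)) by (rewrite plus_INR; reflexivity). apply le_INR; auto. }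
        apply Rmult_le_reg_r with (4 * (INR A + 1)); [lra|].
        replace (INR k * / (4 * (INR A + 1)) * (4 * (INR A + 1))) with (INR k) by (field; lra). lra. }
    intros N. destruct (Nat.le_gt_cases N (A + 1)) as [HN|HN]; [specialize (Hsmall N HN); lra|].
    replace N with ((A + 1) + (N - (A + 1)))%nat by lia. rewrite rsum_add.
    assert (H2 : rsum (fun k => x (A + 1 + k)%nat) (N - (A + 1))
       <= rsum (fun i => 1/4 * / INR (1 + i) ^ 2) (N - (A + 1))).
    { apply rsum_le. intros i _. unfold x. assert (H := INR_S_pos i). change (1 + i)%nat with (S i).
      replace (1/4 * / INR (S i) ^ 2) with (/ (4 * INR (S i) ^ 2)) by (field; lra).
      apply Rinv_le_contravar; [nra|]. rewrite <- Hq.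
      assert (INR (A + 1 + i) + 1/2 - Re a >= INR (S i)).
      { replace (A + 1 + i)%nat with (S (A + i)) by lia. rewrite !S_INR, plus_INR. lra. }
      nra. }
    rewrite rsum_scal in H2.
    assert (H3 := Rinv_sqr_sum_tail 1 (N - (A + 1)) (le_n 1)).
    assert (0 < 2 / INR (1 + (N - (A + 1)))) by (apply Rdiv_lt_0_compat; [lra | apply INR_S_pos]).
    change (INR 1) with 1 in H3. specialize (Hsmall (A + 1)%nat ltac:(lia)). lra. }
  assert (Htel : rprod (fun i => p i / p (S i)) n = Cmod a / p n).
  { induction n as [|k IH]; cbn [rprod].
    - unfold p, nC. simpl (INR 0). replace (0 - a)%C with (- a)%C by ring. rewrite Cmod_opp.
      field. assert (H := p_pos 0). unfold p, nC in H. simpl (INR 0) in H.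
      replace (0 - a)%C with (- a)%C in H by ring. rewrite Cmod_opp in H. lra.
    - rewrite IH. assert (H1 := p_pos k). assert (H2 := p_pos (S k)). field. lra. }
  assert (Hpn := p_pos n).
  assert (E2 : rprod (fun i => p i / q i) n ^ 2 = rprod (fun i => (p i / q i) ^ 2) n).
  { clear Htel Hpn. induction n as [|k IH]; cbn [rprod]; [ring|]. rewrite Rpow_mult_distr, IH. reflexivity. }
  rewrite E2.
  apply Rle_trans with (rprod (fun i => p i / p (S i) * (1 - x i)) n).
  - rewrite rprod_mult, Htel. destruct (rprod_one_minus x n ltac:(auto)) as [H _].
    specialize (Hs n). assert (Ha0 := Cmod_ge_0 a).
    replace (Cmod a / (4 * p n)) with (Cmod a / p n * (1/4)) by (field; lra).
    apply Rmult_le_compat_l; [apply Rdiv_le_0_compat; auto | lra].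
  - apply rprod_le. intros i _. assert (H1 := p_pos i). assert (H2 := p_pos (S i)). assert (H3 := q_pos i).
    specialize (Hx i). split.
    + apply Rmult_le_pos; [apply Rdiv_le_0_compat; lra | lra].
    + assert (H := Cmod_sqr_minus_const (nC i + RtoC (1/2) - a) (1/2) ltac:(lra)).
      fold (q i) in H.
      replace (nC i + RtoC (1/2) - a - RtoC (1/2))%C with (nC i - a)%C in H by ring.
      replace (nC i + RtoC (1/2) - a + RtoC (1/2))%C with (nC (S i) - a)%C in H
        by (rewrite nC_S, !RtoC_div by lra; field).
      fold (p i) (p (S i)) in H. unfold x.
      apply Rmult_le_reg_r with (p (S i) * q i ^ 2); [apply Rmult_lt_0_compat; nra|].
      replace (p i / p (S i) * (1 - / (4 * q i ^ 2)) * (p (S i) * q i ^ 2))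
        with (p i * (q i ^ 2 - (1/2) ^ 2)) by (field; lra).
      replace ((p i / q i) ^ 2 * (p (S i) * q i ^ 2)) with (p i * (p i * p (S i))) by (field; lra).
      apply Rmult_le_compat_l; lra.
Qed.

End RatioBound.

Lemma wallis_nC_rec n : (1 <= n)%nat ->
  Cmod (wallis (nC (S n))) = (2 * INR n + 1) / (2 * INR n + 2) * Cmod (wallis (nC n)).
Proof.
  intros Hn. assert (H : 0 < INR n) by (apply lt_0_INR; lia).
  rewrite nC_S, wallis_rec by (rewrite Re_nC; auto).
  rewrite Cmod_mult, kappa_nC, Cmod_R, Rabs_pos_eq; [reflexivity|].
  apply Rdiv_le_0_compat; lra.
Qed.

(** Wallis: [n w ^ 2] increases and [(2 n + 1) w ^ 2] decreases along the mean
    values [w] with integral exponents. *)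
Lemma wallis_nC_bounds n : (1 <= n)%nat ->
  Cmod (wallis (nC 1)) ^ 2 <= Cmod (wallis (nC n)) ^ 2 * INR n /\
  Cmod (wallis (nC n)) ^ 2 * (2 * INR n + 1) <= 3 * Cmod (wallis (nC 1)) ^ 2.
Proof.
  intros Hn. induction n as [|n IH]; [lia|].
  destruct (Nat.eq_dec n 0) as [->|Hn0].
  - change (INR 1) with 1. split; right; ring.
  - destruct (IH ltac:(lia)) as [H1 H2].
    assert (Hn1 : 1 <= INR n) by (apply (le_INR 1); lia).
    rewrite (wallis_nC_rec n), (S_INR n) by lia.
    set (w := Cmod (wallis (nC n))) in *. set (M := Cmod (wallis (nC 1)) ^ 2) in *.
    set (x := INR n) in *.
    assert (Hw : 0 <= w ^ 2) by apply pow2_ge_0.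
    split.
    + apply Rle_trans with (w ^ 2 * x); auto.
      replace (((2 * x + 1) / (2 * x + 2) * w) ^ 2 * (x + 1)) with
        (w ^ 2 * ((2 * x + 1) ^ 2 / (4 * (x + 1)))) by (field; lra).
      apply Rmult_le_compat_l; auto.
      apply Rmult_le_reg_r with (4 * (x + 1)); [lra|].
      replace ((2 * x + 1) ^ 2 / (4 * (x + 1)) * (4 * (x + 1))) with ((2 * x + 1) ^ 2) by (field; lra). nra.
    + apply Rle_trans with (w ^ 2 * (2 * x + 1)); auto.
      replace (((2 * x + 1) / (2 * x + 2) * w) ^ 2 * (2 * (x + 1) + 1)) with
        (w ^ 2 * ((2 * x + 1) ^ 2 * (2 * x + 3) / (4 * (x + 1) ^ 2))) by (field; lra).
      apply Rmult_le_compat_l; auto.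
      apply Rdiv_le_of_mult; [nra|]. nra.
Qed.

Definition ratio_const (A : nat) : R :=
  Cmod (wallis (nC 1)) ^ 2 / 64 / Rpower 2 (4 * INR A + 1) ^ 2.

Lemma ratio_const_pos A : 0 < ratio_const A.
Proof.
  unfold ratio_const.
  assert (0 < Cmod (wallis (nC 1))).
  { apply Cmod_gt_0, wallis_neq_0. rewrite Re_nC. simpl; lra. }
  apply Rdiv_lt_0_compat; [nra|]. apply pow_lt, Rpower_pos.
Qed.

(** By [gquot_square] the quotient of [|P(a)| ^ 2] by [|P(2 a)|] is a product of
    half steps, of order [|a| ^ (1/2)], times factors bounded from below.  This
    power of [|a|] decides the theorem.  Fourth powers avoid the square roots. *)
Theorem gamma_factor_ratio (A : nat) (a : C) :
  0 < Re a -> Re a <= INR A -> INR A + 1 <= Im a ^ 2 ->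
  ratio_const A * Cmod a * Cmod (gamma_factor (2 * a)) ^ 2 <= Cmod (gamma_factor a) ^ 4.
Proof.
  intros Ha HA HI.
  assert (HA0 := pos_INR A).
  assert (Hi : Im a <> 0) by (intro E; rewrite E in HI; simpl in HI; lra).
  assert (Ha2 : 0 < Re (2 * a)%C) by (rewrite re_scal_l; lra).
  set (u := fun n => Rpower (INR n) (2 * Re a + 1) * Cmod (wallis (nC n)) * rprod (gquot a) n).
  set (v := fun n => Rpower (INR n) (2 * Re (2 * a)%C + 1) * Cmod (wallis (nC n)) * rprod (gquot (2 * a)) n).
  assert (Lu : is_lim_seq (fun n => u n ^ 4) (Cmod (gamma_factor a) ^ 4)).
  { assert (H : is_lim_seq u (Cmod (gamma_factor a))) by (apply gamma_factor_modulus; auto).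
    simpl. repeat (apply is_lim_seq_mult'; auto). apply is_lim_seq_const. }
  assert (Lv : is_lim_seq (fun n => ratio_const A * Cmod a * v (2 * n)%nat ^ 2)
     (ratio_const A * Cmod a * Cmod (gamma_factor (2 * a)) ^ 2)).
  { assert (H : is_lim_seq (fun n => v (2 * n)%nat) (Cmod (gamma_factor (2 * a)))).
    { apply (is_lim_seq_subseq v).
      - apply eventually_subseq. intros n. lia.
      - apply gamma_factor_modulus; auto. }
    apply is_lim_seq_mult'; [apply is_lim_seq_const|].
    simpl. repeat (apply is_lim_seq_mult'; auto). apply is_lim_seq_const. }
  apply (is_lim_seq_le_loc (fun n => ratio_const A * Cmod a * v (2 * n)%nat ^ 2) (fun n => u n ^ 4)
    (ratio_const A * Cmod a * Cmod (gamma_factor (2 * a)) ^ 2) (Cmod (gamma_factor a) ^ 4)); auto.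
  destruct (INR_unbounded (Cmod a)) as [N0 HN0].
  exists (S N0). intros n Hn.
  assert (Hn1 : 1 <= INR n) by (apply (le_INR 1); lia).
  assert (HNa : Cmod a <= INR n) by (assert (INR N0 <= INR n) by (apply le_INR; lia); lra).
  destruct (wallis_nC_bounds n ltac:(lia)) as [W1 _].
  destruct (wallis_nC_bounds (2 * n) ltac:(lia)) as [_ W2].
  assert (Hsq := gquot_square a Ha Hi n).
  assert (HY := even_odd_product_bound a Ha n).
  assert (HX := half_step_product_bound a Ha Hi A n HA HI).
  cbv beta in Hsq, HY, HX.
  unfold u, v, ratio_const. rewrite mult_INR in *. change (INR 2) with 2 in *.
  rewrite re_scal_l.
  replace (2 * (2 * Re a) + 1) with (4 * Re a + 1) by ring.
  rewrite <- Rpower_mult_distr by lra.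
  assert (ET : Rpower (INR n) (2 * Re a + 1) ^ 2 = Rpower (INR n) (4 * Re a + 1) * INR n).
  { simpl. rewrite Rmult_1_r, <- Rpower_plus.
    replace (2 * Re a + 1 + (2 * Re a + 1)) with (4 * Re a + 1 + 1) by ring.
    rewrite Rpower_plus, Rpower_1 by lra. reflexivity. }
  set (T1 := Rpower (INR n) (2 * Re a + 1)) in *.
  set (T := Rpower (INR n) (4 * Re a + 1)) in *.
  assert (HB : Rpower 2 (4 * Re a + 1) <= Rpower 2 (4 * INR A + 1)) by (apply Rle_Rpower; lra).
  assert (HB0 : 0 < Rpower 2 (4 * Re a + 1)) by apply Rpower_pos.
  assert (HBA : 0 < Rpower 2 (4 * INR A + 1)) by apply Rpower_pos.
  set (b := Rpower 2 (4 * Re a + 1)) in *. set (B := Rpower 2 (4 * INR A + 1)) in *.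
  set (M := Cmod (wallis (nC 1))) in *. set (w := Cmod (wallis (nC n))) in *.
  set (w2 := Cmod (wallis (nC (2 * n)))) in *.
  set (X := rprod (fun i => Cmod (nC i - a) / Cmod (nC i + RtoC (1/2) - a)) n) in *.
  match type of HY with _ <= ?y => set (Y := y) in * end.
  set (g := rprod (gquot a) n) in *. set (g2 := rprod (gquot (2 * a)) (2 * n)) in *.
  set (x := INR n) in *.
  assert (Hp : Cmod (nC n - a) <= 2 * x).
  { eapply Rle_trans; [apply Cmod_triangle_minus|]. unfold nC. rewrite Cmod_R, Rabs_pos_eq; unfold x in *; lra. }
  assert (Hp0 : 0 < Cmod (nC n - a)) by (apply real_minus_a_pos; auto).
  assert (Ha0 := Cmod_ge_0 a).
  assert (HX2 : Cmod a / (8 * x) <= X ^ 2).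
  { eapply Rle_trans; [|exact HX]. unfold Rdiv. apply Rmult_le_compat_l; auto.
    apply Rinv_le_contravar; lra. }
  assert (HY2 : 1/4 <= Y ^ 2) by nra.
  assert (Hg4 : g2 ^ 2 * (Cmod a / (32 * x)) <= g ^ 4).
  { replace (g ^ 4) with ((g ^ 2) ^ 2) by ring. rewrite Hsq.
    replace ((g2 * X * Y) ^ 2) with (g2 ^ 2 * (X ^ 2 * Y ^ 2)) by ring.
    apply Rmult_le_compat_l; [apply pow2_ge_0|].
    replace (Cmod a / (32 * x)) with (Cmod a / (8 * x) * (1/4)) by (field; lra).
    apply Rmult_le_compat; auto; [|lra]. apply Rdiv_le_0_compat; lra. }
  assert (Hw : M ^ 2 * w2 ^ 2 * (1 / 2) <= x * w ^ 4).
  { assert (x * w2 ^ 2 <= M ^ 2).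
    { assert (0 <= w2 ^ 2) by apply pow2_ge_0. nra. }
    assert (M ^ 2 * M ^ 2 <= (w ^ 2 * x) * (w ^ 2 * x)).
    { apply Rmult_le_compat; auto; apply pow2_ge_0. }
    assert (0 <= M ^ 2) by apply pow2_ge_0.
    assert (M ^ 2 * (x * w2 ^ 2) <= M ^ 2 * M ^ 2) by (apply Rmult_le_compat_l; auto).
    apply Rmult_le_reg_r with x; [lra|].
    assert (0 <= M ^ 2 * w2 ^ 2 * x).
    { apply Rmult_le_pos; [apply Rmult_le_pos; apply pow2_ge_0 | lra]. }
    nra. }
  assert (HT : 0 <= T ^ 2) by apply pow2_ge_0.
  replace ((T1 * w * g) ^ 4) with ((T1 ^ 2) ^ 2 * w ^ 4 * g ^ 4) by ring. rewrite ET.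
  replace (M ^ 2 / 64 / B ^ 2 * Cmod a * (b * T * w2 * g2) ^ 2) with
    (T ^ 2 * ((M ^ 2 * w2 ^ 2 * (1/2)) * (g2 ^ 2 * (Cmod a / 32)) * (b ^ 2 / B ^ 2))) by (field; lra).
  replace ((T * x) ^ 2 * w ^ 4 * g ^ 4) with (T ^ 2 * ((x * w ^ 4) * (x * g ^ 4))) by ring.
  apply Rmult_le_compat_l; auto.
  assert (Hb1 : 0 <= b ^ 2 / B ^ 2 <= 1).
  { split; [apply Rdiv_le_0_compat; [apply pow2_ge_0 | nra]|]. apply Rdiv_le_of_mult; nra. }
  assert (Hg5 : g2 ^ 2 * (Cmod a / 32) <= x * g ^ 4).
  { replace (g2 ^ 2 * (Cmod a / 32)) with (x * (g2 ^ 2 * (Cmod a / (32 * x)))) by (field; lra).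
    apply Rmult_le_compat_l; lra. }
  assert (Z1 : 0 <= M ^ 2 * w2 ^ 2 * (1/2)).
  { apply Rmult_le_pos; [apply Rmult_le_pos; apply pow2_ge_0 | lra]. }
  assert (Z2 : 0 <= g2 ^ 2 * (Cmod a / 32)).
  { apply Rmult_le_pos; [apply pow2_ge_0 | lra]. }
  apply Rle_trans with (M ^ 2 * w2 ^ 2 * (1/2) * (g2 ^ 2 * (Cmod a / 32)) * 1).
  - apply Rmult_le_compat_l; [apply Rmult_le_pos; auto | lra].
  - rewrite Rmult_1_r. apply Rmult_le_compat; auto.
Qed.

(** * Alternating sine sums in the left half-plane *)

(** A substitute for [x], accurate when [x] is small against [l], whose powers
    are sampled values of a periodic function. *)
Definition hsin (l : nat) (x : R) : R := 2 * INR l / PI * sin (PI * x / (2 * INR l)).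

(** The last index has weight one half because it is the centre of symmetry of
    the sum over a whole period, see [alternating_reflection]. *)
Definition alt_sum (f : nat -> C) (m : nat) : C :=
  (csum (fun k => (- (1)) ^ k * f (S k)) m + / 2 * (- (1)) ^ m * f (S m))%C.

Definition sine_sum (m : nat) (s : C) : C :=
  alt_sum (fun j => rpow (hsin (S m) (INR j)) (- s)) m.

Definition odd_zeta (w : C) : C := Cser (fun q => rpow (INR (2 * q + 1)) (- w)).

Lemma Cpow_m1_parity (i j : nat) : (exists k, i + 2 * k = j)%nat -> ((- (1)) ^ j = (- (1)) ^ i)%C.
Proof.
  intros [k <-]. rewrite Cpow_add_r, Cpow_mult_r.
  replace ((- (1)) ^ 2)%C with (RtoC 1) by (simpl; ring). rewrite Cpow_1_l. ring.
Qed.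

Lemma alternating_reflection (f : nat -> C) (m : nat) :
  (forall i, (i < m)%nat -> f (2 * m + 1 - i)%nat = f (S i)) ->
  csum (fun k => (- (1)) ^ (S k) * f (S k))%C (2 * m + 1) = (- (2) * alt_sum f m)%C.
Proof.
  intros Hf. replace (2 * m + 1)%nat with (m + S m)%nat by lia.
  rewrite csum_add, csum_shift, csum_rev with (n := m) (u := fun k => ((- (1)) ^ S (m + S k) * f (S (m + S k)))%C).
  rewrite Nat.add_0_r.
  rewrite (csum_ext (fun k => (- (1)) ^ S (m + S (m - 1 - k)) * f (S (m + S (m - 1 - k))))%C
    (fun k => (- (1)) ^ S k * f (S k))%C).
  - unfold alt_sum. rewrite (csum_ext (fun k => (- (1)) ^ S k * f (S k))%C
      (fun k => - (1) * ((- (1)) ^ k * f (S k)))%C) by (intros; simpl; ring).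
    rewrite csum_scal. simpl Cpow. field.
  - intros i Hi. replace (S (m + S (m - 1 - i))) with (2 * m + 1 - i)%nat by lia.
    rewrite Hf by auto. f_equal. apply Cpow_m1_parity. exists (m - i)%nat. lia.
Qed.

Lemma odd_index (m q : nat) : S (2 * S m * q + m) = (S m * (2 * q + 1))%nat.
Proof. lia. Qed.

Lemma hsin_sin_rpow (m j : nat) (b : C) : (S j <= S m)%nat ->
  rpow (hsin (S m) (INR (S j))) b
   = (rpow (2 * INR (S m) / PI) b * rpow (sin (PI * (INR (S j) / INR (2 * S m)))) b)%C.
Proof.
  intros Hj. assert (HP := PI_RGT_0). assert (Hm := INR_S_pos m).
  assert (Hx := fraction_in_01 j (2 * S m) ltac:(lia)).
  unfold hsin. rewrite rpow_mult_base.
  - do 3 f_equal. rewrite mult_INR. change (INR 2) with 2. unfold Rdiv. ring.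
  - apply Rdiv_lt_0_compat; lra.
  - replace (PI * INR (S j) / (2 * INR (S m))) with (PI * (INR (S j) / INR (2 * S m))).
    + apply sin_PI_mult_pos; auto.
    + rewrite mult_INR. change (INR 2) with 2. unfold Rdiv. ring.
Qed.

Lemma csum_alternating_0 l : (0 < l)%nat -> csum (fun j => (- (1)) ^ j)%C (2 * l) = 0%C.
Proof.
  intros Hl. assert (H := alternating_cos_csum l 0 Hl).
  rewrite Nat.add_0_l, Nat.mod_small in H by lia.
  destruct (Nat.eqb_spec l 0); [lia|]. rewrite <- H. apply csum_ext. intros j _.
  replace (2 * PI * INR 0 * (INR j / INR (2 * l))) with 0 by (simpl; ring). rewrite cos_0. ring.
Qed.

(** The alternating signs shift the frequencies by half the number of sample
    points, so exactly the coefficients of index an odd multiple of [S m]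
    survive. *)
Lemma sine_sum_fourier (a : C) (m : nat) : 0 < Re a ->
  sine_sum m (- (2 * a)) = (- (2) * rpow (2 / PI) (2 * a) * wallis a *
     Cser (fun q => fcoef_scaled a (S m * (2 * q + 1)) * rpow (INR (2 * q + 1)) (- (2 * a + 1))))%C.
Proof.
  intros Ha. assert (HP := PI_RGT_0). assert (Hm := INR_S_pos m).
  set (l := S m) in *.
  assert (H := fourier_sampling a (2 * l) (fun j => (- (1)) ^ j)%C m 0 (RtoC (INR (2 * l))) Ha ltac:(unfold l; lia)).
  specialize (H (csum_alternating_0 l ltac:(unfold l; lia))).
  assert (Hc : forall k, csum (fun j => (- (1)) ^ j * RtoC (cos (2 * PI * INR (S k) * (INR j / INR (2 * l)))))%C (2 * l)
     = if (k mod (2 * l) =? m)%nat then RtoC (INR (2 * l)) else 0%C).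
  { intros k. rewrite alternating_cos_csum by (unfold l; lia).
    assert (Ek := Nat.div_mod_eq k (2 * l)). assert (Hb := Nat.mod_upper_bound k (2 * l) ltac:(unfold l; lia)).
    set (t := (k mod (2 * l))%nat) in *.
    replace (S k + l)%nat with ((t + 1 + l) + (k / (2 * l)) * (2 * l))%nat by lia.
    rewrite Nat.Div0.mod_add.
    destruct (Nat.eqb_spec t m) as [E|E].
    - rewrite E. replace (m + 1 + l)%nat with (2 * l)%nat by (unfold l; lia). rewrite Nat.Div0.mod_same. reflexivity.
    - destruct (Nat.lt_ge_cases t m).
      + rewrite Nat.mod_small by (unfold l in *; lia). destruct (Nat.eqb_spec (t + 1 + l) 0); [lia|reflexivity].
      + replace (t + 1 + l)%nat with ((t - m) + 1 * (2 * l))%nat by (unfold l; lia).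
        rewrite Nat.Div0.mod_add, Nat.mod_small by lia.
        destruct (Nat.eqb_spec (t - m) 0); [lia|reflexivity]. }
  specialize (H Hc).
  set (g := fun j => rpow (sin (PI * (INR j / INR (2 * l)))) (2 * a)).
  set (F := fun j => ((- (1)) ^ j * fourier a (INR j / INR (2 * l)))%C) in H.
  assert (HS : csum F (2 * l) = (F 0%nat + csum (fun k => F (S k)) (2 * m + 1))%C).
  { replace (2 * l)%nat with (S (2 * m + 1)) at 1 by (unfold l; lia). apply csum_shift. }
  assert (HF0 : F 0%nat = 0%C).
  { unfold F. replace (INR 0 / INR (2 * l)) with 0.
    - rewrite fourier_0 by auto. ring.
    - simpl (INR 0). unfold Rdiv. ring. }
  assert (HFS : csum (fun k => F (S k)) (2 * m + 1) = (fourier a (1/2) * (- (2) * alt_sum g m))%C).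
  { rewrite <- alternating_reflection, <- csum_scal.
    - apply csum_ext. intros k Hk. unfold F, g.
      rewrite fourier_sine_power; [ring | auto | apply fraction_in_01; unfold l; lia].
    - intros i Hi. unfold g. f_equal.
      replace (2 * m + 1 - i)%nat with (2 * l - S i)%nat by (unfold l; lia).
      rewrite minus_INR by (unfold l; lia).
      rewrite <- sin_PI_x. f_equal. field. apply not_0_INR. unfold l; lia. }
  rewrite HS, HF0, HFS, Cplus_0_l, Cplus_0_l in H.
  assert (HK := fourier_half_neq_0 a Ha).
  assert (Hg : alt_sum g m = (- RtoC (INR (2 * l)) * wallis a * Cser (fun q => fcoef a (S (2 * l * q + m))))%C).
  { transitivity (- / 2 * wallis a * (fourier a (1/2) * (- (2) * alt_sum g m)))%C.
    - unfold wallis. field. auto.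
    - rewrite H. field. }
  assert (HE : sine_sum m (- (2 * a)) = (rpow (2 * INR l / PI) (2 * a) * alt_sum g m)%C).
  { unfold sine_sum, alt_sum. replace (- - (2 * a))%C with (2 * a)%C by ring.
    rewrite Cmult_plus_distr_l, <- csum_scal. unfold g. f_equal.
    - apply csum_ext. intros k Hk. rewrite hsin_sin_rpow by lia. fold l. ring.
    - rewrite hsin_sin_rpow by lia. fold l. ring. }
  rewrite HE, Hg.
  assert (Ec : forall q, fcoef a (S (2 * l * q + m)) =
    (rpow (INR l) (- (2 * a + 1)) * (fcoef_scaled a (l * (2 * q + 1)) * rpow (INR (2 * q + 1)) (- (2 * a + 1))))%C).
  { intros q. unfold l. rewrite odd_index, fcoef_scaled_inv by lia. fold l.
    rewrite mult_INR, rpow_mult_base by (try apply lt_0_INR; unfold l; lia). ring. }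
  set (v := fun q => (fcoef_scaled a (l * (2 * q + 1)) * rpow (INR (2 * q + 1)) (- (2 * a + 1)))%C).
  assert (Ev : Cser (fun q => fcoef a (S (2 * l * q + m))) = (rpow (INR l) (- (2 * a + 1)) * Cser v)%C).
  { apply Cser_unique. apply (Ccv_ext (fun n => rpow (INR l) (- (2 * a + 1)) * csum v n)%C).
    - intros n. rewrite <- csum_scal. apply csum_ext. intros q _. rewrite Ec. reflexivity.
    - apply Ccv_scal. apply (pdom_cv v (fcoef_const (Cmod a)) (2 * Re a)); [lra|].
      intros q. unfold v. rewrite Cmod_mult, Cmod_rpow, Re_opp_2a_1.
      apply Rmult_le_compat; try apply Cmod_ge_0; [left; apply Rpower_pos| |].
      + apply fcoef_scaled_bounded; auto; [lra | unfold l; lia].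
      + replace (- 1 - 2 * Re a) with (- (1 + 2 * Re a)) by ring.
        apply Rpower_antitone_base; [|lra]. split; [apply INR_S_pos | apply le_INR; lia]. }
  rewrite Ev.
  replace (2 * INR l / PI) with ((2 / PI) * INR l) by (field; lra).
  rewrite rpow_mult_base by (try apply Rdiv_lt_0_compat; lra).
  assert (El : (rpow (INR l) (2 * a) * (RtoC (INR (2 * l)) * rpow (INR l) (- (2 * a + 1))) = 2)%C).
  { rewrite mult_INR, RtoC_mult. change (INR 2) with 2.
    rewrite <- (rpow_1 (INR l)) by auto.
    transitivity (2 * (rpow (INR l) (2 * a) * rpow (INR l) 1 * rpow (INR l) (- (2 * a + 1))))%C; [ring|].
    rewrite <- !rpow_plus. replace (2 * a + 1 + - (2 * a + 1))%C with (RtoC 0) by ring.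
    rewrite rpow_0. ring. }
  transitivity (- (rpow (INR l) (2 * a) * (RtoC (INR (2 * l)) * rpow (INR l) (- (2 * a + 1))))
     * rpow (2 / PI) (2 * a) * wallis a * Cser v)%C; [ring|].
  rewrite El. reflexivity.
Qed.

Lemma Cser_minus u v B B' d : 0 < d -> pdom u B d -> pdom v B' d ->
  Cser (fun k => u k - v k)%C = (Cser u - Cser v)%C.
Proof.
  intros Hd Hu Hv. apply Cser_unique.
  apply (Ccv_ext (fun n => csum u n - csum v n)%C); [intros; now rewrite csum_minus|].
  apply Ccv_minus; eapply pdom_cv; eauto.
Qed.

Lemma Cser_scal c u B d : 0 < d -> pdom u B d -> Cser (fun k => c * u k)%C = (c * Cser u)%C.
Proof.
  intros Hd Hu. apply Cser_unique.
  apply (Ccv_ext (fun n => c * csum u n)%C); [intros; now rewrite csum_scal|].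
  apply Ccv_scal; eapply pdom_cv; eauto.
Qed.

Lemma pdom_scal c u B d : pdom u B d -> pdom (fun k => c * u k)%C (Cmod c * B) d.
Proof.
  intros H k. rewrite Cmod_mult, Rmult_assoc. apply Rmult_le_compat_l; [apply Cmod_ge_0 | apply H].
Qed.

Lemma odd_zeta_pdom w d : 0 < d -> 1 + d <= Re w -> pdom (fun q => rpow (INR (2 * q + 1)) (- w)) 1 d.
Proof.
  intros Hd Hw q. rewrite Cmod_rpow, re_opp, Rmult_1_l.
  apply Rle_trans with (Rpower (INR (S q)) (- Re w)).
  - apply Rpower_antitone_base; [|lra]. split; [apply INR_S_pos | apply le_INR; lia].
  - apply Rle_Rpower; [apply (le_INR 1); lia | lra].
Qed.

(** The right-hand side of the functional equation at [s = - 2 a], so that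
    [2 a + 1 = 1 - s]. *)
Definition left_limit (a : C) : C :=
  (- (2) * rpow (2 / PI) (2 * a) * gamma_factor a * odd_zeta (2 * a + 1))%C.

Lemma two_div_PI : 0 < 2 / PI <= 1.
Proof.
  assert (HP := PI_RGT_0). assert (H := PI2_1). split; [apply Rdiv_lt_0_compat; lra|].
  apply Rdiv_le_of_mult; lra.
Qed.

Lemma sine_sum_left (A d : R) : 0 < d ->
  ucv (fun a => Cmod a <= A /\ d <= Re a) (fun m a => sine_sum m (- (2 * a))) left_limit.
Proof.
  intros Hd. set (K := fcoef_const A * slow_const A).
  apply (ucv_bound _ _ _ (fun m => 2 * (K * (1 + / (2 * d))) * (2 / INR (S m)))).
  - apply (is_lim_seq_incr_1 (fun m => 2 * (K * (1 + / (2 * d))) * (2 / INR m))).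
    apply is_lim_seq_inv_INR.
  - exists 0%nat. intros m a _ [HA Hda].
    assert (HA0 : 0 <= A) by (eapply Rle_trans; [apply Cmod_ge_0 | exact HA]).
    assert (HK : 0 <= K) by (apply Rmult_le_pos; [apply fcoef_const_nonneg | apply slow_const_nonneg]; auto).
    assert (Hm := INR_S_pos m).
    assert (Ha : 0 < Re a) by lra.
    rewrite sine_sum_fourier by auto. unfold left_limit, gamma_factor.
    set (r := fun q => rpow (INR (2 * q + 1)) (- (2 * a + 1))).
    assert (Hr : pdom r 1 (2 * d)) by (apply odd_zeta_pdom; [lra | rewrite Re_2a_1; lra]).
    set (u := fun q => (fcoef_scaled a (S m * (2 * q + 1)) * r q)%C).
    assert (Hu : pdom u (fcoef_const A) (2 * d)).
    { intros q. unfold u. rewrite Cmod_mult. apply Rmult_le_compat; try apply Cmod_ge_0.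
      - apply fcoef_scaled_bounded; auto; lia.
      - specialize (Hr q). lra. }
    change (odd_zeta (2 * a + 1)) with (Cser r).
    change (Cser (fun q => fcoef_scaled a (S m * (2 * q + 1)) * rpow (INR (2 * q + 1)) (- (2 * a + 1)))%C) with (Cser u).
    replace (- (2) * rpow (2 / PI) (2 * a) * wallis a * Cser u
        - - (2) * rpow (2 / PI) (2 * a) * (fcoef_lim a * wallis a) * Cser r)%C
      with (- (2) * rpow (2 / PI) (2 * a) * wallis a * (Cser u - fcoef_lim a * Cser r))%C by ring.
    rewrite <- (Cser_scal (fcoef_lim a) r 1 (2 * d)) by (auto; lra).
    rewrite <- (Cser_minus u (fun k => fcoef_lim a * r k)%C _ _ (2 * d) ltac:(lra) Hu (pdom_scal _ _ _ _ Hr)).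
    assert (HD : pdom (fun k => u k - fcoef_lim a * r k)%C (K * (2 / INR (S m))) (2 * d)).
    { intros q. unfold u. replace (fcoef_scaled a (S m * (2 * q + 1)) * r q - fcoef_lim a * r q)%C
        with ((fcoef_scaled a (S m * (2 * q + 1)) - fcoef_lim a) * r q)%C by ring.
      rewrite Cmod_mult. apply Rmult_le_compat; try apply Cmod_ge_0; [|specialize (Hr q); lra].
      eapply Rle_trans; [apply (fcoef_scaled_rate A); auto; lia|]. fold K.
      apply Rmult_le_compat_l; auto. apply Rmult_le_compat_l; [lra|].
      apply Rinv_le_contravar; auto. apply le_INR. nia. }
    assert (Hd2 : 0 < 2 * d) by lra. assert (HT := pdom_total _ _ _ Hd2 HD).
    rewrite !Cmod_mult.
    replace (Cmod (- (2))) with 2 by (rewrite Cmod_opp, Cmod_R, Rabs_pos_eq; lra).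
    assert (H1 : Cmod (rpow (2 / PI) (2 * a)) <= 1).
    { rewrite Cmod_rpow, re_scal_l. apply Rpower_le_1; [apply two_div_PI | lra]. }
    assert (H2 := wallis_le_1 a Ha).
    replace (2 * (K * (1 + / (2 * d))) * (2 / INR (S m))) with
      ((2 * 1 * 1) * (K * (2 / INR (S m)) * (1 + / (2 * d)))) by ring.
    assert (G1 := Cmod_ge_0 (rpow (2 / PI) (2 * a))). assert (G2 := Cmod_ge_0 (wallis a)).
    apply Rmult_le_compat; auto; [|apply Cmod_ge_0|].
    + repeat apply Rmult_le_pos; lra.
    + apply Rmult_le_compat; lra.
Qed.

(** * Alternating sine sums to the right of the line of real part minus one *)

Definition diff2 (f : nat -> C) (j : nat) : C := (f j - 2 * f (S j) + f (S (S j)))%C.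

Lemma alt_sum_by_parts (f : nat -> C) (m : nat) :
  alt_sum f m = (/ 2 * f 1%nat + / 2 * csum (fun k => (- (1)) ^ k * (f (S k) - f (S (S k)))) m)%C.
Proof.
  unfold alt_sum. induction m as [|m IH].
  - cbn [csum]. simpl Cpow. ring.
  - cbn [csum].
    set (S1 := csum (fun k => (- (1)) ^ k * f (S k))%C m) in *.
    set (S2 := csum (fun k => (- (1)) ^ k * (f (S k) - f (S (S k))))%C m) in *.
    set (e := ((- (1)) ^ m)%C) in *.
    assert (E : S1 = (/ 2 * f 1%nat + / 2 * S2 - / 2 * e * f (S m))%C) by (rewrite <- IH; ring).
    rewrite E. change ((- (1)) ^ S m)%C with (- (1) * e)%C. field.
Qed.

(** Second differences of [j ^ (- s)] are of order [j ^ (- Re s - 2)], so the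
    remaining sum converges absolutely as soon as [Re s > -1]. *)
Lemma alt_sum_by_parts_twice (f : nat -> C) (n : nat) :
  alt_sum f (S n) = (/ 2 * f 1%nat + / 4 * (f 1%nat - f 2%nat)
    + / 4 * csum (fun k => (- (1)) ^ k * diff2 f (S k)) n
    + / 4 * (- (1)) ^ n * (f (S n) - f (S (S n))))%C.
Proof.
  rewrite alt_sum_by_parts.
  assert (H := alt_sum_by_parts (fun j => f j - f (S j))%C n). unfold alt_sum in H. cbn [csum].
  set (S1 := csum (fun k => (- (1)) ^ k * (f (S k) - f (S (S k))))%C n) in *.
  assert (E : S1 = (/ 2 * (f 1%nat - f 2%nat) + / 2 * csum (fun k => (- (1)) ^ k * (f (S k) - f (S (S k)) - (f (S (S k)) - f (S (S (S k)))))) n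
     - / 2 * (- (1)) ^ n * (f (S n) - f (S (S n))))%C) by (rewrite <- H; ring).
  rewrite E.
  rewrite (csum_ext (fun k => (- (1)) ^ k * diff2 f (S k))%C
    (fun k => (- (1)) ^ k * (f (S k) - f (S (S k)) - (f (S (S k)) - f (S (S (S k))))))%C)
    by (intros; unfold diff2; ring).
  field.
Qed.

Lemma sin_lower y : 0 <= y -> y - y ^ 3 / 6 <= sin y.
Proof.
  intros Hy.
  assert (Hsin : forall u, 0 <= u -> sin u <= u).
  { intros u [Hu|<-]; [left; apply sin_lt_x; auto | rewrite sin_0; lra]. }
  assert (Hsin' : forall u, 0 <= u -> - u <= sin u).
  { intros u Hu. destruct (Rle_dec u PI).
    - assert (0 <= sin u) by (apply sin_ge_0; auto). lra.
    - assert (H := PI2_1). generalize (SIN_bound u). lra. }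
  assert (Hcos : forall u, 0 <= u -> 1 - u ^ 2 / 2 <= cos u).
  { intros u Hu. replace u with (2 * (u / 2)) at 2 by field. rewrite cos_2a_sin.
    assert (H1 := Hsin (u / 2) ltac:(lra)). assert (H2 := Hsin' (u / 2) ltac:(lra)). nra. }
  destruct (MVT_gen (fun u => sin u - (u - u ^ 3 / 6)) 0 y (fun u => cos u - (1 - u ^ 2 / 2))) as [c [Hc E]].
  - intros u _. auto_derive; auto. field.
  - intros u _. apply derivable_continuous_pt. exists (cos u - (1 - u ^ 2 / 2)).
    apply is_derive_Reals. auto_derive; auto. field.
  - rewrite Rmin_left, Rmax_right in Hc by lra. rewrite sin_0 in E.
    specialize (Hcos c ltac:(lra)). nra.
Qed.

Section SineSample.
Variable l : nat.
Hypothesis Hl : (1 <= l)%nat.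

Let N := INR l.

Lemma sample_size_ge_1 : 1 <= N. Proof. apply (le_INR 1); auto. Qed.

Lemma hsin_arg_bound x : 0 < x <= N -> 0 < PI * x / (2 * N) <= 2.
Proof.
  intros Hx. assert (HN := sample_size_ge_1). assert (HP := PI_RGT_0). assert (H4 := PI_4).
  split; [apply Rdiv_lt_0_compat; nra|].
  apply Rdiv_le_of_mult; nra.
Qed.

Lemma hsin_eq x : 0 < x -> hsin l x = x * (sin (PI * x / (2 * N)) / (PI * x / (2 * N))).
Proof.
  intros Hx. assert (HN := sample_size_ge_1). assert (HP := PI_RGT_0). unfold hsin. fold N. field. lra.
Qed.

Lemma hsin_bounds x : 0 < x <= N ->
  x / 3 <= hsin l x <= x /\ x * (1 - (PI * x / (2 * N)) ^ 2) <= hsin l x.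
Proof.
  intros Hx. rewrite hsin_eq by lra. assert (Hy := hsin_arg_bound x Hx).
  set (y := PI * x / (2 * N)) in *.
  assert (H1 := sin_lower y ltac:(lra)). assert (H2 : sin y < y) by (apply sin_lt_x; lra).
  assert (Hq : 1 - y ^ 2 / 6 <= sin y / y <= 1).
  { split.
    - apply Rmult_le_reg_r with y; [lra|]. replace (sin y / y * y) with (sin y) by (field; lra). nra.
    - apply Rdiv_le_of_mult; lra. }
  set (q := sin y / y) in *.
  assert (Hy2 : y ^ 2 <= 4) by nra.
  assert (0 <= y ^ 2) by apply pow2_ge_0.
  repeat split.
  - replace (x / 3) with (x * (1/3)) by field. apply Rmult_le_compat_l; lra.
  - rewrite <- (Rmult_1_r x) at 2. apply Rmult_le_compat_l; lra.
  - apply Rmult_le_compat_l; lra.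
Qed.

Variables (s : C) (T d : R).
Hypothesis Hd : 0 < d.
Hypothesis HT : Cmod s <= T.
Hypothesis Hs : -1 + d <= Re s.

Let f (x : R) : C := rpow (hsin l x) (- s).
Let fd (x : R) : C := (- s * RtoC (cos (PI * x / (2 * N))) * rpow (hsin l x) (- s - 1))%C.
Let fdd (x : R) : C :=
  (- s * RtoC (- (PI / (2 * N)) * sin (PI * x / (2 * N))) * rpow (hsin l x) (- s - 1)
   + - s * (- s - 1) * RtoC (cos (PI * x / (2 * N)) ^ 2) * rpow (hsin l x) (- s - 1 - 1))%C.

Lemma hsin_derive x : is_derive (hsin l) x (cos (PI * x / (2 * N))).
Proof.
  assert (HN := sample_size_ge_1). assert (HP := PI_RGT_0). unfold hsin. fold N.
  auto_derive; [lra|]. unfold Rdiv. field. lra.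
Qed.

Lemma sample_Cderiv x : 0 < x <= N -> Cderiv f x (fd x).
Proof.
  intros Hx. destruct (hsin_bounds x Hx) as [[H1 _] _].
  apply (Cderiv_rpow_comp (- s) (hsin l)); [apply hsin_derive | lra].
Qed.

Lemma sample_deriv_Cderiv x : 0 < x <= N -> Cderiv fd x (fdd x).
Proof.
  intros Hx. destruct (hsin_bounds x Hx) as [[H1 _] _]. assert (HN := sample_size_ge_1).
  assert (Hc : Cderiv (fun x => - s * RtoC (cos (PI * x / (2 * N))))%C x
    (- s * RtoC (- (PI / (2 * N)) * sin (PI * x / (2 * N))))%C).
  { apply Cderiv_scal, Cderiv_real. auto_derive; [lra|]. unfold Rdiv. field. lra. }
  assert (Hr := Cderiv_rpow_comp (- s - 1) (hsin l) x _ (hsin_derive x) ltac:(lra)).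
  assert (H := Cderiv_mult _ _ x _ _ Hc Hr). cbv beta in H.
  unfold fd, fdd.
  match type of H with Cderiv _ _ ?z => match goal with |- Cderiv _ _ ?w => replace w with z; auto end end.
  rewrite RtoC_pow. ring.
Qed.

Definition diff2_const : R := (T * (T + 1) + T) * Rpower 3 (T + 2).

Lemma diff2_const_nonneg : 0 <= diff2_const.
Proof.
  assert (0 <= T) by (eapply Rle_trans; [apply Cmod_ge_0 | exact HT]).
  apply Rmult_le_pos; [nra | left; apply Rpower_pos].
Qed.

(** The term coming from the curvature of the sine has the same order as the
    other one because [(pi / (2 l)) h] is itself a sine. *)
Lemma sample_second_deriv_bound j x : 1 <= j -> j <= x <= N -> Cmod (fdd x) <= diff2_const * Rpower j (- 1 - d).
Proof.
  intros Hj Hx. destruct (hsin_bounds x ltac:(lra)) as [[H1 H2] _].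
  assert (HN := sample_size_ge_1). assert (HP := PI_RGT_0).
  assert (HT0 : 0 <= T) by (eapply Rle_trans; [apply Cmod_ge_0 | exact HT]).
  set (h := hsin l x) in *.
  assert (Hh : 0 < h) by lra.
  set (y := PI * x / (2 * N)).
  set (R0 := Cmod (rpow h (- s - 1 - 1))).
  assert (HR0 : R0 <= Rpower 3 (T + 2) * Rpower j (- 1 - d)).
  { unfold R0. rewrite Cmod_rpow.
    replace (Re (- s - 1 - 1)%C) with (- (Re s + 2)) by (unfold Cminus; rewrite !re_plus, !re_opp; simpl; ring).
    apply Rle_trans with (Rpower (x / 3) (- (Re s + 2))).
    { apply Rpower_antitone_base; lra. }
    replace (x / 3) with (/ 3 * x) by field.
    rewrite <- Rpower_mult_distr by lra.
    apply Rmult_le_compat; try (left; apply Rpower_pos).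
    - rewrite Rpower_Ropp, <- Rpower_Ropp. unfold Rpower. rewrite ln_Rinv by lra.
      replace (- (Re s + 2) * - ln 3) with ((Re s + 2) * ln 3) by ring.
      apply (Rle_Rpower 3 (Re s + 2) (T + 2)); [lra|].
      assert (H := re_le_Cmod s). assert (H' := Rle_abs (Re s)). lra.
    - apply Rle_trans with (Rpower j (- (Re s + 2))).
      + apply Rpower_antitone_base; lra.
      + apply Rle_Rpower; lra. }
  assert (HR0' := Cmod_ge_0 (rpow h (- s - 1 - 1))). fold R0 in HR0'.
  assert (E1 : rpow h (- s - 1) = (rpow h (- s - 1 - 1) * RtoC h)%C).
  { rewrite <- (rpow_1 h) by auto. rewrite <- rpow_plus. f_equal. ring. }
  assert (Hsin : sin y = PI / (2 * N) * h).
  { unfold h, hsin, y. fold N. field. lra. }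
  assert (Hs2 : (sin y) ^ 2 <= 1) by (generalize (SIN_bound y); nra).
  assert (Hc2 : (cos y) ^ 2 <= 1) by (generalize (COS_bound y); nra).
  assert (B1 : Cmod (- s * RtoC (- (PI / (2 * N)) * sin y) * rpow h (- s - 1)) <= T * R0).
  { rewrite E1.
    replace (- s * RtoC (- (PI / (2 * N)) * sin y) * (rpow h (- s - 1 - 1) * RtoC h))%C
      with (s * rpow h (- s - 1 - 1) * (RtoC (sin y ^ 2)))%C.
    - rewrite !Cmod_mult, Cmod_R, Rabs_pos_eq by apply pow2_ge_0. fold R0.
      assert (0 <= Cmod s) by apply Cmod_ge_0.
      apply Rle_trans with (T * R0 * 1); [|lra].
      apply Rmult_le_compat; auto; [apply Rmult_le_pos; auto | apply pow2_ge_0 | apply Rmult_le_compat_r; auto].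
    - replace (sin y ^ 2) with (- (PI / (2 * N)) * sin y * - h).
      + rewrite (RtoC_mult _ (- h)), RtoC_opp. ring.
      + simpl. rewrite Rmult_1_r. rewrite Hsin at 2. ring. }
  assert (B2 : Cmod (- s * (- s - 1) * RtoC (cos y ^ 2) * rpow h (- s - 1 - 1)) <= T * (T + 1) * R0).
  { rewrite !Cmod_mult, Cmod_opp, Cmod_R, (Rabs_pos_eq (cos y ^ 2)) by apply pow2_ge_0. fold R0.
    assert (Hs1 : Cmod (- s - 1) <= T + 1).
    { eapply Rle_trans; [apply Cmod_triangle_minus|]. rewrite Cmod_opp, Cmod_1. lra. }
    assert (0 <= Cmod s) by apply Cmod_ge_0. assert (0 <= Cmod (- s - 1)) by apply Cmod_ge_0.
    apply Rmult_le_compat_r; auto.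
    apply Rle_trans with (T * (T + 1) * 1); [|lra].
    apply Rmult_le_compat; auto; [apply Rmult_le_pos; auto | apply pow2_ge_0 | apply Rmult_le_compat; auto]. }
  unfold fdd. fold y h. eapply Rle_trans; [apply Cmod_triangle|].
  unfold diff2_const. rewrite Rmult_assoc.
  apply Rle_trans with ((T * (T + 1) + T) * R0); [lra|].
  apply Rmult_le_compat_l; auto. nra.
Qed.

Lemma sample_deriv_increment j x y : 1 <= j -> j <= x <= y -> y <= N -> y <= x + 1 ->
  Cmod (fd y - fd x) <= diff2_const * Rpower j (- 1 - d).
Proof.
  intros Hj Hx Hy Hyx.
  assert (HB : 0 <= diff2_const * Rpower j (- 1 - d)).
  { apply Rmult_le_pos; [apply diff2_const_nonneg | left; apply Rpower_pos]. }
  apply Rle_trans with (diff2_const * Rpower j (- 1 - d) * (y - x)).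
  - apply (mean_value_bound fd fdd); [lra| |].
    + intros z Hz. apply sample_deriv_Cderiv; lra.
    + intros z Hz. apply sample_second_deriv_bound; lra.
  - assert (0 <= y - x <= 1) by lra. nra.
Qed.

(** Two applications of the mean value inequality; the bound does not involve
    [l]. *)
Lemma sample_diff2_bound j : (1 <= j)%nat -> (j + 2 <= l)%nat ->
  Cmod (diff2 (fun i => f (INR i)) j) <= diff2_const * Rpower (INR j) (- 1 - d).
Proof.
  intros Hj Hjl.
  assert (H1 : 1 <= INR j) by (apply (le_INR 1); auto).
  assert (H2 : INR j + 2 <= N).
  { replace 2 with (INR 2) by reflexivity. rewrite <- plus_INR. apply le_INR; auto. }
  set (B := diff2_const * Rpower (INR j) (- 1 - d)).
  unfold diff2. rewrite !S_INR.
  replace (f (INR j) - 2 * f (INR j + 1) + f (INR j + 1 + 1)%R)%C with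
    ((f (INR j + 1 + 1)%R - f (INR j + 1)%R) - (f (INR j + 1)%R - f (INR j)))%C by ring.
  replace B with (B * (INR j + 1 - INR j)) by ring.
  apply (mean_value_bound (fun x => f (x + 1)%R - f x)%C (fun x => fd (x + 1)%R - fd x)%C); [lra| |].
  - intros x Hx. apply Cderiv_minus; [|apply sample_Cderiv; lra].
    destruct (sample_Cderiv (x + 1) ltac:(lra)) as [D1 D2].
    split.
    + apply is_derive_Reals. apply is_derive_Reals in D1.
      replace (Re (fd (x + 1))) with (Re (fd (x + 1)) * 1) by ring.
      apply (derivable_pt_lim_comp (fun x => x + 1) (fun x => Re (f x))); auto.
      apply is_derive_Reals. auto_derive; auto.
    + apply is_derive_Reals. apply is_derive_Reals in D2.
      replace (Im (fd (x + 1))) with (Im (fd (x + 1)) * 1) by ring.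
      apply (derivable_pt_lim_comp (fun x => x + 1) (fun x => Im (f x))); auto.
      apply is_derive_Reals. auto_derive; auto.
  - intros x Hx. apply sample_deriv_increment; lra.
Qed.

(** The sample function has a critical point at [l], so its last increment is
    as small as a second difference. *)
Lemma last_increment_bound j : (1 <= j)%nat -> l = S j ->
  Cmod (f (INR j) - f (INR l)) <= diff2_const * Rpower (INR j) (- 1 - d).
Proof.
  intros Hj E. assert (H1 : 1 <= INR j) by (apply (le_INR 1); auto).
  assert (HN : N = INR j + 1) by (unfold N; rewrite E, S_INR; reflexivity).
  set (B := diff2_const * Rpower (INR j) (- 1 - d)).
  assert (HfdN : fd N = 0%C).
  { unfold fd. replace (PI * N / (2 * N)) with (PI / 2) by (field; lra). rewrite cos_PI2. ring. }
  fold N. rewrite Cmod_minus_sym. replace B with (B * (N - INR j)) by (rewrite HN; ring).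
  apply (mean_value_bound f fd); [lra| |].
  - intros x Hx. apply sample_Cderiv; lra.
  - intros x Hx. replace (fd x) with (- (fd N - fd x))%C by (rewrite HfdN; ring). rewrite Cmod_opp.
    apply sample_deriv_increment; lra.
Qed.

End SineSample.

Lemma rpow_close (T h j : R) (s : C) : 0 < h <= j -> 1 <= j -> Cmod s <= T ->
  ln j - ln h <= 1 ->
  Cmod (rpow h (- s) - rpow j (- s)) <= Rpower j T * exp T * T * (ln j - ln h).
Proof.
  intros Hh Hj HT Hln.
  assert (HT0 : 0 <= T) by (eapply Rle_trans; [apply Cmod_ge_0 | exact HT]).
  set (e := ln j - ln h) in *.
  assert (He : 0 <= e).
  { unfold e. assert (ln h <= ln j) by (apply ln_le; lra). lra. }
  assert (E : rpow h (- s) = (rpow j (- s) * Cexp (s * RtoC e))%C).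
  { unfold rpow. rewrite <- Cexp_plus. f_equal. unfold e. rewrite RtoC_minus. ring. }
  rewrite E. replace (rpow j (- s) * Cexp (s * RtoC e) - rpow j (- s))%C
    with (rpow j (- s) * (Cexp (s * RtoC e) - 1))%C by ring.
  rewrite Cmod_mult, Cmod_rpow, re_opp.
  assert (Hse : Cmod (s * RtoC e) <= T * e).
  { rewrite Cmod_mult, Cmod_R, Rabs_pos_eq by auto. apply Rmult_le_compat_r; auto. }
  assert (Hse0 := Cmod_ge_0 (s * RtoC e)).
  replace (Rpower j T * exp T * T * e) with (Rpower j T * (exp T * (T * e))) by ring.
  apply Rmult_le_compat; [left; apply Rpower_pos | apply Cmod_ge_0 | |].
  - apply Rle_Rpower; auto. assert (H := re_le_Cmod s). apply Rabs_le_between in H. lra.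
  - eapply Rle_trans; [apply Cexp_minus_1_bound|].
    apply Rmult_le_compat; auto; [left; apply exp_pos|].
    assert (Hle : Cmod (s * RtoC e) <= T) by nra.
    apply exp_monotone; exact Hle.
Qed.

Lemma sine_sample_cv (T : R) (j : nat) : (1 <= j)%nat ->
  ucv (fun s => Cmod s <= T) (fun l s => rpow (hsin l (INR j)) (- s)) (fun s => rpow (INR j) (- s)).
Proof.
  intros Hj. assert (Hj1 : 1 <= INR j) by (apply (le_INR 1); auto).
  assert (HP := PI_RGT_0).
  set (K := Rpower (INR j) T * exp T * T).
  apply (ucv_bound _ _ _ (fun l => K * (2 * (PI * INR j / 2) ^ 2 * (/ INR l * / INR l)))).
  - do 2 apply is_lim_seq_scal_0.
    replace 0 with (0 * 0) by ring.
    assert (H : is_lim_seq (fun n => / INR n) 0).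
    { apply (is_lim_seq_inv (fun n => INR n) p_infty); [apply is_lim_seq_INR | discriminate]. }
    apply is_lim_seq_mult'; auto.
  - destruct (INR_unbounded (PI * INR j * 2)) as [N0 HN0].
    exists (max (S N0) j). intros l s Hl Hs.
    assert (HT0 : 0 <= T) by (eapply Rle_trans; [apply Cmod_ge_0 | exact Hs]).
    assert (HlN : PI * INR j * 2 < INR l).
    { eapply Rlt_le_trans; [apply HN0|]. apply le_INR; lia. }
    assert (Hlj : INR j <= INR l) by (apply le_INR; lia).
    destruct (hsin_bounds l ltac:(lia) (INR j) ltac:(lra)) as [[H1 H2] H3].
    set (y := PI * INR j / (2 * INR l)) in *.
    set (h := hsin l (INR j)) in *.
    assert (Hy : 0 <= y <= 1/4).
    { unfold y. split; [apply Rdiv_le_0_compat; nra|]. apply Rdiv_le_of_mult; lra. }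
    assert (Ey : 2 * (PI * INR j / 2) ^ 2 * (/ INR l * / INR l) = 2 * y ^ 2) by (unfold y; field; lra).
    rewrite Ey.
    assert (Hln : ln (INR j) - ln h <= 2 * y ^ 2).
    { assert (Ht : 0 < 1 - y ^ 2) by nra.
      assert (Hlnt : - (2 * y ^ 2) <= ln (1 - y ^ 2)).
      { assert (H := exp_ineq1_le (- ln (1 - y ^ 2))). rewrite exp_Ropp, exp_ln in H by auto.
        assert (/ (1 - y ^ 2) <= 1 + 2 * y ^ 2); [|lra].
        apply Rmult_le_reg_r with (1 - y ^ 2); auto. rewrite Rinv_l by lra.
        assert (Hz : 0 <= y ^ 2 <= 1/16) by nra. set (z := y ^ 2) in *. nra. }
      assert (ln (INR j) + ln (1 - y ^ 2) <= ln h); [|lra].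
      rewrite <- ln_mult by lra. apply ln_le; auto. apply Rmult_lt_0_compat; lra. }
    eapply Rle_trans; [apply (rpow_close T h (INR j)); auto; try lra; nra|].
    fold K. apply Rmult_le_compat_l; auto.
    unfold K. repeat apply Rmult_le_pos; auto; left; [apply Rpower_pos | apply exp_pos].
Qed.

Definition power_fun (s : C) (j : nat) : C := rpow (INR j) (- s).

(** What is left of [alt_sum_by_parts_twice] as the number of terms grows. *)
Definition right_limit (s : C) : C :=
  (/ 2 * power_fun s 1 + / 4 * (power_fun s 1 - power_fun s 2)
   + / 4 * Cser (fun k => (- (1)) ^ k * diff2 (power_fun s) (S k)))%C.

Lemma Cser_finite (u : nat -> C) n : (forall k, (n <= k)%nat -> u k = 0%C) -> Cser u = csum u n.
Proof.
  intros H. apply Cser_unique. apply (Ccv_ext_loc (fun _ => csum u n) (csum u) (csum u n) n); [|apply Ccv_const].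
  intros m Hm. symmetry. apply csum_zero_tail; auto.
Qed.

Lemma ucv_shift {X : Type} (D : X -> Prop) u f : ucv D (fun n => u (S n)) f -> ucv D u f.
Proof.
  intros H e He. destruct (H e He) as [N HN]. exists (S N). intros n x Hn Hx.
  destruct n as [|n]; [lia|]. apply HN; auto; lia.
Qed.

Lemma Cmod_m1_pow k : Cmod ((- (1)) ^ k) = 1.
Proof. rewrite Cmod_pow, Cmod_opp, Cmod_1. apply pow1. Qed.

Lemma sine_sum_right (T d : R) : 0 < d ->
  ucv (fun s => Cmod s <= T /\ -1 + d <= Re s) sine_sum right_limit.
Proof.
  intros Hd. apply ucv_shift.
  set (D := fun s : C => Cmod s <= T /\ -1 + d <= Re s).
  set (f := fun n s j => rpow (hsin (S (S n)) (INR j)) (- s)).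
  assert (Hf : forall j, (1 <= j)%nat -> ucv D (fun n s => f n s j) (fun s => power_fun s j)).
  { intros j Hj. apply (ucv_subseq D (fun l s => rpow (hsin l (INR j)) (- s)) _ (fun n => S (S n))).
    - intros; lia.
    - apply (ucv_mono (fun s => Cmod s <= T)); [intros s [H _]; auto|]. apply sine_sample_cv; auto. }
  set (u := fun n k s => if (k <? n)%nat then ((- (1)) ^ k * diff2 (f n s) (S k))%C else 0%C).
  apply (ucv_ext D (fun n s => / 2 * f n s 1%nat + / 4 * (f n s 1%nat + - (1) * f n s 2%nat)
      + / 4 * Cser (fun k => u n k s) + / 4 * (- (1)) ^ n * (f n s (S n) - f n s (S (S n))))%C
    _ (fun s => / 2 * power_fun s 1 + / 4 * (power_fun s 1 + - (1) * power_fun s 2)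
      + / 4 * Cser (fun k => (- (1)) ^ k * diff2 (power_fun s) (S k)) + 0)%C).
  - exists 0%nat. intros n s _ _. unfold sine_sum. rewrite alt_sum_by_parts_twice.
    change (fun j => rpow (hsin (S (S n)) (INR j)) (- s)) with (f n s).
    rewrite (Cser_finite (fun k => u n k s) n).
    + rewrite (csum_ext (fun k => u n k s) (fun k => (- (1)) ^ k * diff2 (f n s) (S k))%C).
      * unfold f. ring.
      * intros k Hk. unfold u. destruct (Nat.ltb_spec k n); [auto|lia].
    + intros k Hk. unfold u. destruct (Nat.ltb_spec k n); [lia|auto].
  - intros s _. unfold right_limit. ring.
  - apply ucv_plus; [apply ucv_plus; [apply ucv_plus|]|].
    + apply ucv_scal, Hf; lia.
    + apply ucv_scal. apply ucv_plus; [|apply ucv_scal]; apply Hf; lia.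
    + apply ucv_scal. apply (ucv_Cser D u _ (diff2_const T) d); auto.
      * intros n s [HT Hs] k. unfold u.
        assert (HK := diff2_const_nonneg s T HT).
        destruct (Nat.ltb_spec k n).
        -- rewrite Cmod_mult, Cmod_m1_pow, Rmult_1_l.
           apply (sample_diff2_bound (S (S n)) ltac:(lia) s T d Hd HT Hs (S k)); lia.
        -- rewrite Cmod_0. apply Rmult_le_pos; auto. left; apply Rpower_pos.
      * intros k. apply (ucv_ext D (fun n s => (- (1)) ^ k * (f n s (S k) + - (2) * f n s (S (S k)) + f n s (S (S (S k)))))%C
          _ (fun s => (- (1)) ^ k * (power_fun s (S k) + - (2) * power_fun s (S (S k)) + power_fun s (S (S (S k)))))%C).
        -- exists (S k). intros n s Hn _. unfold u, diff2. destruct (Nat.ltb_spec k n); [ring|lia].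
        -- intros s _. unfold diff2. ring.
        -- apply ucv_scal. apply ucv_plus; [apply ucv_plus; [|apply ucv_scal]|]; apply Hf; lia.
    + apply (ucv_bound _ _ _ (fun n => diff2_const T * Rpower (INR (S n)) (- (1 + d)))).
      * apply is_lim_seq_scal_0.
        apply (is_lim_seq_incr_1 (fun n => Rpower (INR n) (- (1 + d)))).
        apply is_lim_seq_Rpower_neg; lra.
      * exists 0%nat. intros n s _ [HT Hs].
        replace (/ 4 * (- (1)) ^ n * (f n s (S n) - f n s (S (S n))) - 0)%C
          with (/ 4 * (- (1)) ^ n * (f n s (S n) - f n s (S (S n))))%C by ring.
        rewrite !Cmod_mult, Cmod_m1_pow.
        replace (Cmod (/ 4)) with (1/4).
        2:{ rewrite Cmod_inv by (intro E; apply RtoC_inj in E; lra). rewrite Cmod_R, Rabs_pos_eq; lra. }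
        assert (H := last_increment_bound (S (S n)) ltac:(lia) s T d Hd HT Hs (S n) ltac:(lia) eq_refl).
        replace (- (1 + d)) with (- 1 - d) by ring.
        unfold f. assert (H0 := Cmod_ge_0 (rpow (hsin (S (S n)) (INR (S n))) (- s)
          - rpow (hsin (S (S n)) (INR (S (S n)))) (- s))).
        lra.
Qed.

(** * The zeta function in the half-plane of absolute convergence *)

Definition zeta (w : C) : C := Cser (fun k => power_fun w (S k)).

Definition zeta_sum (w : C) (n : nat) : C := csum (fun k => power_fun w (S k)) n.

Lemma Cmod_power_fun w n : Cmod (power_fun w n) = Rpower (INR n) (- Re w).
Proof. unfold power_fun. rewrite Cmod_rpow, re_opp. reflexivity. Qed.

Lemma power_fun_mult w m n : (1 <= m)%nat -> (1 <= n)%nat ->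
  power_fun w (m * n) = (power_fun w m * power_fun w n)%C.
Proof.
  intros Hm Hn. unfold power_fun. rewrite mult_INR. apply rpow_mult_base; apply lt_0_INR; lia.
Qed.

Lemma power_fun_1 w : power_fun w 1 = 1%C.
Proof. unfold power_fun. simpl (INR 1). apply rpow_1_l. Qed.

Lemma zeta_pdom w : 1 < Re w -> pdom (fun k => power_fun w (S k)) 1 (Re w - 1).
Proof. intros Hw k. rewrite Cmod_power_fun. replace (- 1 - (Re w - 1)) with (- Re w) by ring. lra. Qed.

Lemma zeta_cv w : 1 < Re w -> Ccv (zeta_sum w) (zeta w).
Proof. intros Hw. apply (pdom_cv _ 1 (Re w - 1)); [lra | apply zeta_pdom; auto]. Qed.

Lemma double_ge (n : nat) : (n <= 2 * n)%nat.
Proof. lia. Qed.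

Lemma Cpow_m1_even n : ((- (1)) ^ (2 * n) = 1)%C.
Proof. rewrite (Cpow_m1_parity 0 (2 * n)); [reflexivity | exists n; lia]. Qed.

Lemma alternating_sum_even w n :
  csum (fun k => (- (1)) ^ k * power_fun w (S k))%C (2 * n)
   = (zeta_sum w (2 * n) - 2 * power_fun w 2 * zeta_sum w n)%C.
Proof.
  unfold zeta_sum. induction n as [|n IH].
  - simpl. cbn [csum]. ring.
  - replace (2 * S n)%nat with (S (S (2 * n))) by lia. cbn [csum]. rewrite IH.
    assert (E1 := Cpow_m1_even n).
    change ((- (1)) ^ S (2 * n))%C with (- (1) * (- (1)) ^ (2 * n))%C. rewrite E1.
    assert (E2 : power_fun w (S (S (2 * n))) = (power_fun w 2 * power_fun w (S n))%C).
    { rewrite <- power_fun_mult by lia. f_equal. lia. }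
    rewrite E2. ring.
Qed.

Lemma odd_sum w n :
  csum (fun q => rpow (INR (2 * q + 1)) (- w)) n = (zeta_sum w (2 * n) - power_fun w 2 * zeta_sum w n)%C.
Proof.
  unfold zeta_sum. induction n as [|n IH].
  - simpl. cbn [csum]. ring.
  - replace (2 * S n)%nat with (S (S (2 * n))) by lia. cbn [csum]. rewrite IH.
    assert (E2 : power_fun w (S (S (2 * n))) = (power_fun w 2 * power_fun w (S n))%C).
    { rewrite <- power_fun_mult by lia. f_equal. lia. }
    rewrite E2. replace (2 * n + 1)%nat with (S (2 * n)) by lia.
    change (rpow (INR (S (2 * n))) (- w)) with (power_fun w (S (2 * n))). ring.
Qed.

Lemma odd_zeta_eq w : 1 < Re w -> odd_zeta w = ((1 - power_fun w 2) * zeta w)%C.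
Proof.
  intros Hw. apply Cser_unique.
  apply (Ccv_ext (fun n => zeta_sum w (2 * n) - power_fun w 2 * zeta_sum w n)%C).
  - intros n. symmetry. apply odd_sum.
  - replace ((1 - power_fun w 2) * zeta w)%C with (zeta w - power_fun w 2 * zeta w)%C by ring.
    apply Ccv_minus; [|apply Ccv_scal, zeta_cv; auto].
    apply (Ccv_subseq (zeta_sum w) _ (fun n => (2 * n)%nat)); [apply double_ge | apply zeta_cv; auto].
Qed.

Definition eta_factor (w : C) : C := (1 - 2 * power_fun w 2)%C.

Lemma power_fun_cv_0 w : 0 < Re w -> Ccv (power_fun w) 0.
Proof.
  intros Hw. apply Ccv_0_Cmod.
  apply (is_lim_seq_ext (fun n => Rpower (INR n) (- Re w))); [intros; now rewrite Cmod_power_fun|].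
  apply is_lim_seq_Rpower_neg; auto.
Qed.

Lemma Ccv_0_signs (u : nat -> C) : Ccv u 0 -> Ccv (fun n => (- (1)) ^ n * u n)%C 0.
Proof.
  intros H e He. destruct (H e He) as [N HN]. exists N. intros n Hn. specialize (HN n Hn).
  replace ((- (1)) ^ n * u n - 0)%C with ((- (1)) ^ n * (u n - 0))%C by ring.
  rewrite Cmod_mult, Cmod_m1_pow, Rmult_1_l. auto.
Qed.

(** The alternating series and the zeta series are compared along the even
    partial sums, and the summation by parts is undone. *)
Lemma right_limit_eta s : 1 < Re s -> right_limit s = (eta_factor s * zeta s)%C.
Proof.
  intros Hs. set (f := power_fun s). set (E := (eta_factor s * zeta s)%C).
  assert (Hf0 : Ccv f 0) by (apply power_fun_cv_0; lra).
  assert (Hf1 : Ccv (fun n => f (S n)) 0) by (apply (Ccv_subseq f _ S); auto; intros; lia).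
  assert (Hf2 : Ccv (fun n => f (S (S n))) 0) by (apply (Ccv_subseq f _ (fun n => S (S n))); auto; intros; lia).
  assert (Halt : Ccv (csum (fun k => (- (1)) ^ k * f (S k))%C) E).
  { assert (Hp : pdom (fun k => (- (1)) ^ k * f (S k))%C 1 (Re s - 1)).
    { intros k. rewrite Cmod_mult, Cmod_m1_pow, Rmult_1_l. apply zeta_pdom; auto. }
    assert (Hd : 0 < Re s - 1) by lra. assert (Hc := pdom_cv _ _ _ Hd Hp).
    replace E with (Cser (fun k => (- (1)) ^ k * f (S k))%C); auto.
    apply (Ccv_unique (fun n => csum (fun k => (- (1)) ^ k * f (S k))%C (2 * n))).
    - apply (Ccv_subseq _ _ (fun n => (2 * n)%nat) double_ge Hc).
    - eapply Ccv_ext; [intros n; symmetry; apply alternating_sum_even|].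
      unfold E, eta_factor. replace ((1 - 2 * power_fun s 2) * zeta s)%C with (zeta s - 2 * power_fun s 2 * zeta s)%C by ring.
      apply Ccv_minus; [|apply Ccv_scal, zeta_cv; auto].
      apply (Ccv_subseq (zeta_sum s) _ (fun n => (2 * n)%nat)); [apply double_ge | apply zeta_cv; auto]. }
  assert (Hsum : Ccv (alt_sum f) E).
  { replace E with (E + / 2 * 0)%C by ring. unfold alt_sum. apply Ccv_plus; auto.
    apply (Ccv_ext (fun n => / 2 * ((- (1)) ^ n * f (S n)))%C); [intros; ring|].
    apply Ccv_scal, Ccv_0_signs; auto. }
  assert (Hd : Cser (fun k => (- (1)) ^ k * diff2 f (S k))%C
     = (4 * (E - (/ 2 * f 1%nat + / 4 * (f 1%nat - f 2%nat))) - 0)%C).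
  { apply Cser_unique.
    apply (Ccv_ext (fun n => 4 * (alt_sum f (S n) - (/ 2 * f 1%nat + / 4 * (f 1%nat - f 2%nat)))
      - (- (1)) ^ n * (f (S n) - f (S (S n))))%C).
    - intros n. rewrite alt_sum_by_parts_twice. field.
    - apply Ccv_minus.
      + apply Ccv_scal, Ccv_minus; [|apply Ccv_const].
        apply (Ccv_subseq (alt_sum f) _ S); auto; intros; lia.
      + apply Ccv_0_signs. replace (RtoC 0) with (0 - 0)%C by ring. apply Ccv_minus; auto. }
  unfold right_limit. fold f. rewrite Hd. field.
Qed.

(** On the diagonal, the double series runs over the pairs [n1 < n2], half of
    the off-diagonal part of the square of the simple series. *)
Lemma zeta2_diagonal s z : 1 < Re s -> is_zeta2_series s s z ->
  (2 * z = zeta s ^ 2 - zeta (2 * s))%C.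
Proof.
  intros Hs (r & Hr & Hz). set (f := power_fun s). set (P := zeta_sum s).
  assert (Hri : forall i, r i = (f (S i) * (zeta s - P (S i)))%C).
  { intros i. specialize (Hr i). apply is_series_Ccv in Hr.
    apply (Ccv_unique (csum (zeta2_term s s i))); auto.
    apply (Ccv_ext (fun n => f (S i) * (P (S i + n)%nat - P (S i)))%C).
    - intros n. unfold P, zeta_sum. rewrite csum_add.
      match goal with |- (_ * (?x + ?y - ?x))%C = _ => replace (x + y - x)%C with y by ring end.
      rewrite <- csum_scal. apply csum_ext. intros j _. unfold zeta2_term.
      rewrite !ncpow_rpow. unfold f, power_fun. rewrite !rpow_opp.
      replace (S (S i + j)) with (S i + S j)%nat by lia. field.
      split; apply rpow_neq_0.
    - apply Ccv_scal, Ccv_minus; [|apply Ccv_const].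
      apply (Ccv_subseq P _ (fun n => (S i + n)%nat)); [intros; lia | apply zeta_cv; auto]. }
  assert (Hsum : forall n, csum r n = (zeta s * P n - / 2 * (P n * P n + zeta_sum (2 * s) n))%C).
  { induction n as [|n IH].
    - unfold P, zeta_sum. cbn [csum]. ring.
    - cbn [csum]. rewrite IH, Hri. unfold P, zeta_sum. cbn [csum].
      replace (power_fun (2 * s) (S n)) with (f (S n) * f (S n))%C.
      + unfold f. field.
      + unfold f, power_fun. rewrite <- rpow_plus. f_equal. ring. }
  apply is_series_Ccv in Hz.
  assert (E : z = (zeta s * zeta s - / 2 * (zeta s * zeta s + zeta (2 * s)))%C).
  { apply (Ccv_unique (csum r)); auto.
    eapply Ccv_ext; [intros n; symmetry; apply Hsum|].
    assert (HP : Ccv P (zeta s)) by (apply zeta_cv; auto).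
    apply Ccv_minus; [apply Ccv_scal; auto|]. apply Ccv_scal, Ccv_plus; [apply Ccv_mult; auto|].
    apply zeta_cv. rewrite re_scal_l. lra. }
  rewrite E. simpl. field.
Qed.

(** * Logarithmic bounds to the right of the line of real part one *)

Lemma Rpower_neg_nat_le (n : nat) (y : R) (j : nat) : (1 <= n)%nat -> y <= - INR j ->
  Rpower (INR n) y <= / INR n ^ j.
Proof.
  intros Hn Hy. assert (H : 1 <= INR n) by (apply (le_INR 1); auto).
  rewrite <- Rpower_pow by lra. rewrite <- Rpower_Ropp. apply Rle_Rpower; auto.
Qed.

Lemma Re_1_minus w : Re (1 - w)%C = 1 - Re w.
Proof. unfold Cminus. rewrite re_plus, re_opp. reflexivity. Qed.

(** The quotient on the left is the integral of [u ^ (- w)] over a unit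
    interval, which is compared with the value at its left end. *)
Lemma power_integral_comparison w n : 1 <= Re w -> (w - 1)%C <> 0%C -> (1 <= n)%nat ->
  Cmod ((rpow (INR n) (1 - w) - rpow (INR (S n)) (1 - w)) / (w - 1) - power_fun w n) <= Cmod w * / INR n ^ 2.
Proof.
  intros Hw Hw1 Hn. assert (H : 1 <= INR n) by (apply (le_INR 1); auto).
  set (B := Cmod w * / INR n ^ 2).
  assert (HB : 0 <= B).
  { apply Rmult_le_pos; [apply Cmod_ge_0 | left; apply Rinv_0_lt_compat; nra]. }
  assert (Hloc : forall u, INR n <= u <= INR n + 1 -> Cmod (rpow u (- w) - rpow (INR n) (- w)) <= B).
  { intros u Hu. apply Rle_trans with (B * (u - INR n)); [|assert (0 <= u - INR n <= 1) by lra; nra].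
    apply (mean_value_bound (fun v => rpow v (- w)) (fun v => - w * RtoC 1 * rpow v (- w - 1))%C); [lra| |].
    - intros v Hv. apply (Cderiv_rpow_comp (- w) (fun v => v)); [apply (is_derive_id (K := R_AbsRing) v) | lra].
    - intros v Hv. rewrite Cmult_1_r, Cmod_mult, Cmod_opp, Cmod_rpow. apply Rmult_le_compat_l; [apply Cmod_ge_0|].
      unfold Cminus. rewrite re_plus, !re_opp. change (Re 1%C) with 1.
      apply Rle_trans with (Rpower (INR n) (- (Re w + 1))).
      + replace (- Re w + - (1)) with (- (Re w + 1)) by ring. apply Rpower_antitone_base; lra.
      + apply Rpower_neg_nat_le; auto. simpl (INR 2). lra. }
  set (phi := fun u => (- / (w - 1) * rpow u (1 - w) - power_fun w n * RtoC u)%C).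
  replace ((rpow (INR n) (1 - w) - rpow (INR (S n)) (1 - w)) / (w - 1) - power_fun w n)%C
    with (phi (INR n + 1)%R - phi (INR n))%C.
  2:{ unfold phi. rewrite S_INR, RtoC_plus. field. auto. }
  replace B with (B * (INR n + 1 - INR n)) by ring.
  apply (mean_value_bound phi (fun u => rpow u (- w) - power_fun w n)%C); [lra| |].
  - intros u Hu. unfold phi. apply Cderiv_minus.
    + replace (rpow u (- w)) with (- / (w - 1) * ((1 - w) * RtoC 1 * rpow u (1 - w - 1)))%C.
      * apply Cderiv_scal. apply (Cderiv_rpow_comp (1 - w) (fun v => v)); [apply (is_derive_id (K := R_AbsRing) u) | lra].
      * replace (1 - w - 1)%C with (- w)%C by ring. field. auto.
    + assert (Hlin : Cderiv (fun u => power_fun w n * RtoC u)%C u (power_fun w n * RtoC 1)%C).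
      { apply Cderiv_scal, Cderiv_real. apply (is_derive_id (K := R_AbsRing) u). }
      rewrite Cmult_1_r in Hlin. exact Hlin.
  - intros u Hu. apply Hloc. auto.
Qed.

Lemma im_bound_minus_1 w : Rabs (Im w) <= Cmod (w - 1).
Proof.
  eapply Rle_trans; [|apply im_le_Cmod]. unfold Cminus. rewrite im_plus, im_opp. change (Im 1%C) with 0.
  right. f_equal. ring.
Qed.

Lemma zeta_tail_bound w n : 1 < Re w -> Im w <> 0 ->
  Cmod (zeta w - zeta_sum w n) <= 2 / Rabs (Im w) + 2 * Cmod w / INR (S n).
Proof.
  intros Hw Hi. assert (Hy : 0 < Rabs (Im w)) by (apply Rabs_pos_lt; auto).
  assert (Hw1 : (w - 1)%C <> 0%C).
  { apply Cmod_gt_0. assert (H := im_bound_minus_1 w). lra. }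
  assert (Hn := INR_S_pos n).
  apply (Ccv_Cmod_le (fun m => zeta_sum w (n + m) - zeta_sum w n)%C _ _ 0%nat).
  { apply Ccv_minus; [|apply Ccv_const]. apply (Ccv_subseq (zeta_sum w) _ (fun m => (n + m)%nat)).
    - intros; lia.
    - apply zeta_cv; auto. }
  intros m _. unfold zeta_sum. rewrite csum_add.
  match goal with |- Cmod (?x + ?y - ?x) <= _ => replace (x + y - x)%C with y by ring end.
  set (g := fun k => ((rpow (INR (S (n + k))) (1 - w) - rpow (INR (S (S (n + k)))) (1 - w)) / (w - 1))%C).
  assert (Htel : csum g m = ((rpow (INR (S n)) (1 - w) - rpow (INR (S (n + m))) (1 - w)) / (w - 1))%C).
  { induction m as [|m IH]; cbn [csum].
    - rewrite Nat.add_0_r. field. auto.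
    - rewrite IH, Nat.add_succ_r. unfold g. field. auto. }
  replace (csum (fun k => power_fun w (S (n + k))) m) with
    (csum g m - csum (fun k => g k - power_fun w (S (n + k)))%C m)%C by (rewrite csum_minus; ring).
  eapply Rle_trans; [apply Cmod_triangle_minus|]. apply Rplus_le_compat.
  - rewrite Htel, Cmod_div by auto.
    assert (H1 : forall k, Cmod (rpow (INR (S k)) (1 - w)) <= 1).
    { intros k. rewrite Cmod_rpow, Re_1_minus. replace (1 - Re w) with (- (Re w - 1)) by ring.
      apply Rle_trans with (Rpower 1 (- (Re w - 1))); [|rewrite Rpower_1_base; lra].
      apply Rpower_antitone_base; [|lra]. split; [lra | apply (le_INR 1); lia]. }
    apply Rle_trans with (2 / Cmod (w - 1)).
    + apply Rmult_le_compat_r; [left; apply Rinv_0_lt_compat, Cmod_gt_0; auto|].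
      eapply Rle_trans; [apply Cmod_triangle_minus|].
      assert (Ha := H1 n). assert (Hb := H1 (n + m)%nat). lra.
    + apply Rmult_le_compat_l; [lra|]. apply Rinv_le_contravar; auto. apply im_bound_minus_1.
  - eapply Rle_trans; [apply Cmod_csum_le with (M := fun k => Cmod w * / INR (S n + k) ^ 2)|].
    + intros k _. apply (power_integral_comparison w (S n + k)); auto; [lra | lia].
    + rewrite rsum_scal. assert (H := Rinv_sqr_sum_tail (S n) m ltac:(lia)).
      assert (0 < 2 / INR (S n + m)) by (apply Rdiv_lt_0_compat; [lra | apply lt_0_INR; lia]).
      replace (2 * Cmod w / INR (S n)) with (Cmod w * (2 / INR (S n))) by (field; lra).
      apply Rmult_le_compat_l; [apply Cmod_ge_0 | lra].
Qed.

Lemma ln_ge_1_minus_inv z : 0 < z -> 1 - / z <= ln z.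
Proof.
  intros Hz. assert (H := exp_ineq1_le (- ln z)). rewrite exp_Ropp, exp_ln in H by auto. lra.
Qed.

Lemma harmonic_bound n : (1 <= n)%nat -> rsum (fun k => / INR (S k)) n <= 1 + ln (INR n).
Proof.
  intros Hn. induction n as [|n IH]; [lia|].
  destruct (Nat.eq_dec n 0) as [->|Hne].
  - cbn [rsum]. simpl (INR 1). rewrite ln_1. lra.
  - cbn [rsum]. specialize (IH ltac:(lia)).
    assert (H1 : 0 < INR n) by (apply lt_0_INR; lia).
    assert (H2 := ln_ge_1_minus_inv (INR (S n) / INR n) ltac:(apply Rdiv_lt_0_compat; [apply INR_S_pos | auto])).
    rewrite ln_div in H2 by (auto; apply INR_S_pos).
    replace (1 - / (INR (S n) / INR n)) with (/ INR (S n)) in H2; [lra|].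
    rewrite S_INR. field. lra.
Qed.

Lemma power_fun_le_inv w k : 1 <= Re w -> Cmod (power_fun w (S k)) <= / INR (S k).
Proof.
  intros Hw. rewrite Cmod_power_fun. rewrite <- (pow_1 (INR (S k))) at 2.
  apply Rpower_neg_nat_le; [lia | simpl (INR 1); lra].
Qed.

Lemma zeta_sum_bound w n : 1 <= Re w -> (1 <= n)%nat -> Cmod (zeta_sum w n) <= 1 + ln (INR n).
Proof.
  intros Hw Hn. eapply Rle_trans; [|apply harmonic_bound; auto].
  apply Cmod_csum_le. intros k _. apply power_fun_le_inv; auto.
Qed.

Lemma zeta_sum_increment w e n : 1 <= Re w -> 0 <= e -> (1 <= n)%nat ->
  Cmod (zeta_sum w n - zeta_sum (w + RtoC e) n) <= e * ln (INR n) * (1 + ln (INR n)).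
Proof.
  intros Hw He Hn. unfold zeta_sum. rewrite <- csum_minus.
  assert (Hl0 : 0 <= ln (INR n)).
  { apply ln_nonneg, (le_INR 1). auto. }
  eapply Rle_trans; [apply Cmod_csum_le with (M := fun k => e * ln (INR n) * / INR (S k))|].
  - intros k Hk. assert (Hk0 := INR_S_pos k).
    assert (Hlk : 0 <= ln (INR (S k)) <= ln (INR n)).
    { split.
      - apply ln_nonneg, (le_INR 1). lia.
      - apply ln_le; auto. apply le_INR; lia. }
    replace (power_fun w (S k) - power_fun (w + RtoC e) (S k))%C
      with (power_fun w (S k) * RtoC (1 - Rpower (INR (S k)) (- e)))%C.
    + rewrite Cmod_mult, Cmod_R, Rmult_comm.
      apply Rmult_le_compat; [apply Rabs_pos | apply Cmod_ge_0 | | apply power_fun_le_inv; auto].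
      unfold Rpower. assert (H := exp_ineq1_le (- e * ln (INR (S k)))).
      assert (H2 : exp (- e * ln (INR (S k))) <= 1).
      { rewrite <- exp_0. assert (Hle : - e * ln (INR (S k)) <= 0) by nra.
        apply exp_monotone; exact Hle. }
      rewrite Rabs_pos_eq by lra. nra.
    + unfold power_fun. replace (- (w + RtoC e))%C with (- w + RtoC (- e))%C by (rewrite RtoC_opp; ring).
      rewrite rpow_plus, rpow_real, RtoC_minus. ring.
  - rewrite rsum_scal. apply Rmult_le_compat_l; [nra|]. apply harmonic_bound; auto.
Qed.

(** * A lower bound for zeta to the right of the line of real part one *)

Fixpoint rough (k n : nat) : bool :=
  match k with
  | O => true
  | S j => andb (rough j n) (negb (n mod (j + 2) =? 0)%nat)
  end.

Lemma rough_spec k n : rough k n = true <-> forall d, (2 <= d <= k + 1)%nat -> ~ Nat.divide d n.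
Proof.
  induction k as [|k IH]; cbn [rough].
  - split; [intros _ d Hd; lia | auto].
  - rewrite Bool.andb_true_iff, IH, Bool.negb_true_iff, Nat.eqb_neq. split.
    + intros [H1 H2] d Hd. destruct (Nat.eq_dec d (k + 2)) as [->|].
      * intro E. apply H2. apply Nat.Lcm0.mod_divide; auto.
      * apply H1. lia.
    + intros H. split.
      * intros d Hd. apply H. lia.
      * intro E. apply (H (k + 2)%nat); [lia|]. apply Nat.Lcm0.mod_divide; auto.
Qed.

Lemma rough_composite k n : rough k (k + 2) = false -> rough k n = true -> (n mod (k + 2) =? 0)%nat = false.
Proof.
  intros Hc Hn. apply Nat.eqb_neq. intro E. apply Nat.Lcm0.mod_divide in E.
  assert (rough k (k + 2) = true); [|congruence].
  apply rough_spec. intros d Hd Hdiv. apply (proj1 (rough_spec k n) Hn d Hd).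
  eapply Nat.divide_trans; eauto.
Qed.

(** The number [k + 2] has no divisor between [2] and [k + 1], hence it is
    coprime to every number in that range. *)
Lemma rough_mult k m : rough k (k + 2) = true -> rough k ((k + 2) * m) = rough k m.
Proof.
  intros Hp. apply Bool.eq_iff_eq_true. rewrite !rough_spec. split; intros H d Hd Hdiv.
  - apply (H d Hd). apply Nat.divide_mul_r. auto.
  - apply (H d Hd). apply (Nat.gauss d (k + 2)); auto.
    assert (Hg1 := Nat.gcd_divide_l d (k + 2)). assert (Hg2 := Nat.gcd_divide_r d (k + 2)).
    set (g := Nat.gcd d (k + 2)) in *.
    assert (Hgd : (g <= d)%nat) by (apply Nat.divide_pos_le; [lia | auto]).
    destruct (Nat.eq_dec g 0) as [E|]; [rewrite E in Hg1; apply Nat.divide_0_l in Hg1; lia|].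
    destruct (Nat.eq_dec g 1); auto. exfalso.
    apply (proj1 (rough_spec k (k + 2)) Hp g); [lia | auto].
Qed.

Definition rough_zeta (k : nat) (w : C) : C :=
  Cser (fun j => if rough k (S j) then power_fun w (S j) else RtoC 0).

Lemma rough_pdom k w : 1 < Re w ->
  pdom (fun j => if rough k (S j) then power_fun w (S j) else RtoC 0) 1 (Re w - 1).
Proof.
  intros Hw j. destruct (rough k (S j)); [apply zeta_pdom; auto|].
  rewrite Cmod_0, Rmult_1_l. left; apply Rpower_pos.
Qed.

(** Sieving out the multiples of [k + 2] multiplies the series by an Euler
    factor, provided that [k + 2] has survived so far, that is, is a prime. *)
Lemma rough_zeta_step k w : 1 < Re w ->
  rough_zeta (S k) w = if rough k (k + 2) then ((1 - power_fun w (k + 2)) * rough_zeta k w)%C else rough_zeta k w.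
Proof.
  intros Hw. set (q := (k + 2)%nat).
  set (u := fun j => if rough k (S j) then power_fun w (S j) else RtoC 0).
  destruct (rough k q) eqn:Hq.
  - set (v := fun j => if (S j mod q =? 0)%nat then u j else RtoC 0).
    assert (Hu : pdom u 1 (Re w - 1)) by (apply rough_pdom; auto).
    assert (Hv : pdom v 1 (Re w - 1)).
    { intros j. unfold v. destruct (S j mod q =? 0)%nat; [apply Hu|].
      rewrite Cmod_0, Rmult_1_l. left; apply Rpower_pos. }
    assert (Hd : 0 < Re w - 1) by lra.
    assert (Hsp : Ccv (csum (fun i => v (q * i + (q - 1))%nat)) (Cser v)).
    { apply Ccv_csum_sparse; [unfold q; lia| |apply (pdom_cv _ _ _ Hd Hv)].
      intros i j Hj Hne. unfold v. destruct (Nat.eqb_spec (S (q * i + j) mod q) 0) as [E|E]; auto.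
      exfalso. replace (S (q * i + j)) with (S j + i * q)%nat in E by ring.
      rewrite Nat.Div0.mod_add in E.
      rewrite Nat.mod_small in E by lia. lia. }
    assert (Ev : Cser v = (power_fun w q * rough_zeta k w)%C).
    { apply (Ccv_unique _ _ _ Hsp).
      apply (Ccv_ext (fun n => power_fun w q * csum u n)%C).
      - intros n. rewrite <- csum_scal. apply csum_ext. intros i _. unfold v, u.
        replace (S (q * i + (q - 1))) with (q * S i)%nat by (unfold q; lia).
        rewrite Nat.mul_comm, Nat.Div0.mod_mul, Nat.eqb_refl, Nat.mul_comm.
        unfold q. rewrite rough_mult by exact Hq. fold q.
        destruct (rough k (S i)); [|ring]. rewrite power_fun_mult by (unfold q; lia). reflexivity.
      - apply Ccv_scal, (pdom_cv _ _ _ Hd Hu). }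
    assert (E : rough_zeta (S k) w = (Cser u - Cser v)%C).
    { rewrite <- (Cser_minus u v 1 1 (Re w - 1) Hd Hu Hv). unfold rough_zeta. f_equal.
      apply functional_extensionality. intros j.
      cbn [rough]. fold q. unfold v, u.
      destruct (rough k (S j)); cbn [andb]; destruct (S j mod q =? 0)%nat; cbn [negb]; ring. }
    rewrite E, Ev. change (Cser u) with (rough_zeta k w). ring.
  - unfold rough_zeta. f_equal. apply functional_extensionality. intros j.
    cbn [rough]. destruct (rough k (S j)) eqn:Hj; [|reflexivity].
    rewrite (rough_composite k (S j) Hq Hj). reflexivity.
Qed.

Lemma rough_zeta_cv w : 1 < Re w -> Ccv (fun k => rough_zeta k w) 1.
Proof.
  intros Hw. set (d := Re w - 1). assert (Hd : 0 < d) by (unfold d; lra).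
  apply (Ccv_bound _ _ (fun k => 1 * (Rpower (INR (S k)) (- d) / d))).
  - apply (is_lim_seq_incr_1 (fun k => 1 * (Rpower (INR k) (- d) / d))).
    apply is_lim_seq_pdom_tail; auto.
  - exists 0%nat. intros k _.
    assert (H := pdom_tail _ 1 d Hd (rough_pdom k w Hw) (S k) ltac:(lia)).
    replace (csum (fun j => if rough k (S j) then power_fun w (S j) else RtoC 0) (S k)) with (RtoC 1) in H; auto.
    symmetry. rewrite (csum_single _ (S k) 0); [|lia|].
    + replace (rough k 1) with true; [apply power_fun_1|].
      symmetry. apply rough_spec. intros e He Hdiv. apply Nat.divide_1_r in Hdiv. lia.
    + intros j Hj Hne. destruct (rough k (S j)) eqn:E; auto.
      exfalso. apply (proj1 (rough_spec k (S j)) E (S j)); [lia | apply Nat.divide_refl].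
Qed.

(** The cosine inequality [3 + 4 cos t + cos 2t >= 0] for one Euler factor; the
    quadratic error is harmless since the sum of [p ^ (-2)] converges. *)
Lemma three_four_one_factor (r t : R) : 0 <= r ->
  Rabs (1 - r) ^ 3 * Cmod (1 - RtoC r * Cexp (Ci * RtoC t)) ^ 4 * Cmod (1 - RtoC r * Cexp (Ci * RtoC (2 * t)))
    <= exp (4 * r ^ 2).
Proof.
  intros Hr0.
  assert (Hm : forall y, Cmod (1 - RtoC r * Cexp (Ci * RtoC y)) ^ 2 = 1 - 2 * r * cos y + r ^ 2).
  { intros y. rewrite Cexp_Ci, Cmod2_alt. simpl. assert (H := sin2_cos2 y). unfold Rsqr in H.
    replace (1 - 2 * r * cos y + r * (r * 1)) with (1 - 2 * r * cos y + r * (r * (sin y * sin y + cos y * cos y)))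
      by (rewrite H; ring). ring. }
  set (A := Rabs (1 - r)). set (B := Cmod (1 - RtoC r * Cexp (Ci * RtoC t))).
  set (D := Cmod (1 - RtoC r * Cexp (Ci * RtoC (2 * t)))).
  assert (HA : A ^ 2 = (1 - r) ^ 2) by (unfold A; apply pow2_abs).
  assert (HB := Hm t). fold B in HB. assert (HD := Hm (2 * t)). fold D in HD.
  assert (HA0 : 0 <= A) by apply Rabs_pos. assert (HB0 : 0 <= B) by apply Cmod_ge_0.
  assert (HD0 : 0 <= D) by apply Cmod_ge_0.
  assert (Hexp : forall u, u <= exp (u - 1)) by (intros u; generalize (exp_ineq1_le (u - 1)); lra).
  assert (Hsq : (A ^ 3 * B ^ 4 * D) ^ 2 <= exp (4 * r ^ 2) ^ 2).
  { replace ((A ^ 3 * B ^ 4 * D) ^ 2) with ((A ^ 2) ^ 3 * (B ^ 2) ^ 4 * D ^ 2) by ring.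
    assert (PA : 0 <= A ^ 2) by apply pow2_ge_0. assert (PB : 0 <= B ^ 2) by apply pow2_ge_0.
    assert (PD : 0 <= D ^ 2) by apply pow2_ge_0.
    apply Rle_trans with (exp (A ^ 2 - 1) ^ 3 * exp (B ^ 2 - 1) ^ 4 * exp (D ^ 2 - 1)).
    - apply Rmult_le_compat; auto; [apply Rmult_le_pos; apply pow_le; auto|].
      apply Rmult_le_compat; try (apply pow_le; auto); apply pow_incr; auto.
    - assert (Hpow : forall x n, exp x ^ n = exp (INR n * x)).
      { intros x n. induction n as [|n IH]; [simpl; rewrite Rmult_0_l, exp_0; ring|].
        rewrite S_INR. simpl. rewrite IH, <- exp_plus. f_equal. ring. }
      rewrite !Hpow, <- !exp_plus, HA, HB, HD, cos_2a_cos. simpl (INR _).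
      match goal with |- exp ?x <= exp ?y => assert (Hle : x <= y) end.
      { assert (0 <= r * (1 + cos t) ^ 2) by (apply Rmult_le_pos; [auto | apply pow2_ge_0]). nra. }
      apply exp_monotone; exact Hle. }
  apply Rsqr_incr_0_var; [rewrite !Rsqr_pow2; exact Hsq | left; apply exp_pos].
Qed.

Lemma power_fun_vertical x y n : power_fun (RtoC x + Ci * RtoC y) n
   = (RtoC (Rpower (INR n) (- x)) * Cexp (Ci * RtoC (- y * ln (INR n))))%C.
Proof.
  unfold power_fun. replace (- (RtoC x + Ci * RtoC y))%C with (RtoC (- x) + Ci * RtoC (- y))%C
    by (rewrite !RtoC_opp; ring).
  rewrite rpow_plus, rpow_real. f_equal. unfold rpow. f_equal. rewrite RtoC_mult. ring.
Qed.

Lemma Re_vertical x y : Re (RtoC x + Ci * RtoC y) = x.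
Proof. rewrite re_plus, re_RtoC, re_scal_r. simpl. ring. Qed.

Lemma Im_vertical x y : Im (RtoC x + Ci * RtoC y) = y.
Proof. rewrite im_plus, im_RtoC, im_scal_r. simpl. ring. Qed.

Lemma Cmod_vertical_le x y : 0 <= x -> Cmod (RtoC x + Ci * RtoC y) <= x + Rabs y.
Proof.
  intros Hx. eapply Rle_trans; [apply Cmod_le_Re_Im|]. rewrite Re_vertical, Im_vertical.
  rewrite (Rabs_pos_eq x) by auto. lra.
Qed.

(** The sieved series tend to one, and each step of the sieve changes the
    product by a factor that [three_four_one_factor] controls. *)
Theorem three_four_one x y : 1 < x ->
  exp (-4) <= Cmod (zeta (RtoC x)) ^ 3 * Cmod (zeta (RtoC x + Ci * RtoC y)) ^ 4
     * Cmod (zeta (RtoC x + Ci * RtoC (2 * y))).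
Proof.
  intros Hx.
  set (w1 := RtoC x). set (w2 := (RtoC x + Ci * RtoC y)%C). set (w3 := (RtoC x + Ci * RtoC (2 * y))%C).
  assert (H1 : 1 < Re w1) by auto.
  assert (H2 : 1 < Re w2) by (unfold w2; rewrite Re_vertical; auto).
  assert (H3 : 1 < Re w3) by (unfold w3; rewrite Re_vertical; auto).
  set (V := fun k => Cmod (rough_zeta k w1) ^ 3 * Cmod (rough_zeta k w2) ^ 4 * Cmod (rough_zeta k w3)).
  assert (HV0 : forall k, 0 <= V k).
  { intros k. unfold V. repeat apply Rmult_le_pos; try apply pow_le; try lra; apply Cmod_ge_0. }
  assert (Hstep : forall k, V (S k) <= V k * exp (4 * / INR (2 + k) ^ 2)).
  { intros k. unfold V. rewrite !rough_zeta_step by auto.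
    assert (Hq : 0 < INR (2 + k)) by (apply lt_0_INR; lia).
    destruct (rough k (k + 2)).
    - rewrite !Cmod_mult, !Rpow_mult_distr. rewrite (Nat.add_comm k 2).
      set (q := (2 + k)%nat) in *. set (r := Rpower (INR q) (- x)). set (t := - y * ln (INR q)).
      assert (E1 : Cmod (1 - power_fun w1 q) = Rabs (1 - r)).
      { unfold power_fun, w1. rewrite <- RtoC_opp, rpow_real, <- RtoC_minus. apply Cmod_R. }
      assert (E2 : power_fun w2 q = (RtoC r * Cexp (Ci * RtoC t))%C) by apply power_fun_vertical.
      assert (E3 : power_fun w3 q = (RtoC r * Cexp (Ci * RtoC (2 * t)))%C).
      { unfold w3. rewrite power_fun_vertical. unfold r, t. do 4 f_equal. ring. }
      rewrite E1, E2, E3.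
      assert (Hr0 : 0 < r) by apply Rpower_pos.
      assert (Hr : r <= / INR q).
      { rewrite <- (pow_1 (INR q)). apply Rpower_neg_nat_le; [unfold q; lia | simpl (INR 1); lra]. }
      assert (Hf := three_four_one_factor r t ltac:(lra)).
      assert (Hf2 : exp (4 * r ^ 2) <= exp (4 * / INR q ^ 2)).
      { assert (Hle : 4 * r ^ 2 <= 4 * / INR q ^ 2).
        { rewrite <- pow_inv. assert (r ^ 2 <= (/ INR q) ^ 2) by (apply pow_incr; lra). lra. }
        apply exp_monotone; exact Hle. }
      match goal with |- ?a * ?b * (?c * ?d) * (?e * ?f) <= ?rhs =>
        replace (a * b * (c * d) * (e * f)) with ((b * d * f) * (a * c * e)) by ring end.
      apply Rmult_le_compat_l; [apply HV0 | lra].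
    - fold (V k). assert (H := HV0 k).
      assert (1 <= exp (4 * / INR (2 + k) ^ 2)); [|nra].
      rewrite <- exp_0. left. apply exp_increasing. apply Rmult_lt_0_compat; [lra|].
      apply Rinv_0_lt_compat, pow_lt; auto. }
  assert (HVk : forall k, V k <= V 0%nat * exp (4 * rsum (fun i => / INR (2 + i) ^ 2) k)).
  { induction k as [|k IH]; cbn [rsum].
    - rewrite Rmult_0_r, exp_0. lra.
    - eapply Rle_trans; [apply Hstep|]. rewrite Rmult_plus_distr_l, exp_plus, <- Rmult_assoc.
      apply Rmult_le_compat_r; auto. left; apply exp_pos. }
  assert (HVb : forall k, V k <= V 0%nat * exp 4).
  { intros k. eapply Rle_trans; [apply HVk|]. apply Rmult_le_compat_l; auto.
    assert (H := Rinv_sqr_sum_tail 2 k ltac:(lia)).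
    assert (0 < 2 / INR (2 + k)) by (apply Rdiv_lt_0_compat; [lra | apply lt_0_INR; lia]).
    simpl (INR 2) in H.
    assert (Hle : 4 * rsum (fun i => / INR (2 + i) ^ 2) k <= 4) by lra.
    apply exp_monotone; exact Hle. }
  assert (Hlim : is_lim_seq V 1).
  { assert (L : forall w, 1 < Re w -> is_lim_seq (fun k => Cmod (rough_zeta k w)) 1).
    { intros w Hw. rewrite <- Cmod_1. apply Ccv_Cmod, rough_zeta_cv; auto. }
    unfold V. replace 1 with (1 * (1 * (1 * 1)) * (1 * (1 * (1 * (1 * 1)))) * 1) by ring.
    simpl. repeat apply is_lim_seq_mult'; auto; apply is_lim_seq_const. }
  assert (H : 1 <= V 0%nat * exp 4).
  { apply (is_lim_seq_le V (fun _ => V 0%nat * exp 4) 1 (V 0%nat * exp 4)); auto. apply is_lim_seq_const. }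
  change (V 0%nat) with (Cmod (zeta w1) ^ 3 * Cmod (zeta w2) ^ 4 * Cmod (zeta w3)) in H.
  replace (-4) with (- (4)) by ring. rewrite exp_Ropp.
  apply Rmult_le_reg_r with (exp 4); [apply exp_pos|]. rewrite Rinv_l by (generalize (exp_pos 4); lra). exact H.
Qed.

Lemma zeta_real_bound x : 1 < x -> Cmod (zeta (RtoC x)) <= 1 + / (x - 1).
Proof.
  intros Hx. assert (Hd : 0 < x - 1) by lra.
  assert (H := pdom_total _ _ _ Hd (zeta_pdom (RtoC x) Hx)). rewrite Rmult_1_l in H. exact H.
Qed.

Section LogBounds.
Variables (X y : R) (n : nat).
Hypothesis HX : 1 <= X.
Hypothesis HXy : X <= Rabs y.
Hypothesis Hy : 7 <= Rabs y.
Hypothesis Hn : y ^ 2 <= INR n.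

Let L := 3 + ln (INR n).
Let T := Rabs y.

Lemma n_ge : T ^ 2 <= INR n.
Proof. unfold T. rewrite pow2_abs. exact Hn. Qed.

Lemma n_ge_1 : (1 <= n)%nat.
Proof.
  assert (H := n_ge). destruct n as [|m]; [|lia]. simpl in H. unfold T in H. nra.
Qed.

Lemma ln_n_nonneg : 0 <= ln (INR n).
Proof. apply ln_nonneg, (le_INR 1), n_ge_1. Qed.

Lemma zeta_approximation w : 1 < Re w -> T <= Rabs (Im w) -> Cmod w <= 3 * T ->
  Cmod (zeta w - zeta_sum w n) <= 2 / Rabs (Im w) + 2 * Cmod w / T ^ 2.
Proof.
  intros Hw Hi Hm. unfold T in *.
  assert (Hi0 : Im w <> 0) by (intro E; rewrite E, Rabs_R0 in Hi; lra).
  eapply Rle_trans; [apply (zeta_tail_bound w n); auto|]. apply Rplus_le_compat_l.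
  assert (H := n_ge). unfold T in H. unfold Rdiv. apply Rmult_le_compat_l.
  - generalize (Cmod_ge_0 w); lra.
  - apply Rinv_le_contravar; [nra | rewrite S_INR; lra].
Qed.

Lemma zeta_log_bound x k : 1 < x <= X -> 1 <= k <= 2 ->
  Cmod (zeta (RtoC x + Ci * RtoC (k * y))) <= L.
Proof.
  intros Hx Hk. set (w := (RtoC x + Ci * RtoC (k * y))%C).
  assert (HRe : Re w = x) by apply Re_vertical. assert (HIm : Im w = k * y) by apply Im_vertical.
  assert (HT : 7 <= T) by exact Hy.
  assert (Hky : Rabs (k * y) = k * T) by (rewrite Rabs_mult, (Rabs_pos_eq k) by lra; reflexivity).
  assert (Hw3 : Cmod w <= 3 * T).
  { eapply Rle_trans; [apply Cmod_vertical_le; lra|]. rewrite Hky. fold T in HXy. nra. }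
  assert (H1 := zeta_approximation w ltac:(rewrite HRe; lra) ltac:(rewrite HIm, Hky; nra) Hw3).
  assert (H2 := zeta_sum_bound w n ltac:(rewrite HRe; lra) n_ge_1).
  assert (H3 : 2 / Rabs (Im w) + 2 * Cmod w / T ^ 2 <= 2 / T + 6 / T).
  { apply Rplus_le_compat.
    - unfold Rdiv. apply Rmult_le_compat_l; [lra|]. apply Rinv_le_contravar; [lra|]. rewrite HIm, Hky. nra.
    - apply Rdiv_le_of_mult; [nra|]. replace (6 / T * T ^ 2) with (6 * T) by (field; lra). lra. }
  assert (H4 : Cmod (zeta w) <= Cmod (zeta w - zeta_sum w n) + Cmod (zeta_sum w n)).
  { generalize (Cmod_triangle_rev (zeta w) (zeta_sum w n)). lra. }
  assert (H5 : 2 / T + 6 / T <= 2).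
  { replace (2 / T + 6 / T) with (8 / T) by (field; lra). apply Rdiv_le_of_mult; lra. }
  unfold L. lra.
Qed.

(** No derivative is needed: [n] is taken so large that the tail of the series,
    including its main term [n ^ (1 - w) / (w - 1)], is [O(1 / |y|)]. *)
Lemma zeta_log_increment x x' : 1 < x <= x' -> x' <= X ->
  Cmod (zeta (RtoC x + Ci * RtoC y) - zeta (RtoC x' + Ci * RtoC y)) <= (x' - x) * L ^ 2 + 16 / T.
Proof.
  intros Hx Hx'.
  assert (HT : 7 <= T) by exact Hy.
  assert (Happ : forall v, 1 < v <= X ->
    Cmod (zeta (RtoC v + Ci * RtoC y) - zeta_sum (RtoC v + Ci * RtoC y) n) <= 8 / T).
  { intros v Hv. set (w := (RtoC v + Ci * RtoC y)%C).
    assert (HRe : Re w = v) by apply Re_vertical. assert (HIm : Im w = y) by apply Im_vertical.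
    assert (Hw3 : Cmod w <= 3 * T).
    { eapply Rle_trans; [apply Cmod_vertical_le; lra|]. fold T. fold T in HXy. lra. }
    eapply Rle_trans; [apply zeta_approximation; [rewrite HRe; lra | rewrite HIm; apply Rle_refl | exact Hw3]|].
    rewrite HIm. fold T. replace (8 / T) with (2 / T + 6 / T) by (field; lra).
    apply Rplus_le_compat_l. apply Rdiv_le_of_mult; [nra|].
    replace (6 / T * T ^ 2) with (6 * T) by (field; lra). lra. }
  set (w := (RtoC x + Ci * RtoC y)%C). set (w' := (RtoC x' + Ci * RtoC y)%C).
  assert (H1 : Cmod (zeta w - zeta_sum w n) <= 8 / T) by (apply Happ; lra).
  assert (H2 : Cmod (zeta w' - zeta_sum w' n) <= 8 / T) by (apply Happ; lra).
  assert (H3 : Cmod (zeta_sum w n - zeta_sum w' n) <= (x' - x) * L ^ 2).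
  { replace w' with (w + RtoC (x' - x))%C by (unfold w, w'; rewrite RtoC_minus; ring).
    eapply Rle_trans; [apply zeta_sum_increment; [unfold w; rewrite Re_vertical; lra | lra | apply n_ge_1]|].
    rewrite Rmult_assoc. apply Rmult_le_compat_l; [lra|].
    assert (H := ln_n_nonneg). unfold L. nra. }
  replace (zeta w - zeta w')%C with ((zeta w - zeta_sum w n) + (zeta_sum w n - zeta_sum w' n)
    - (zeta w' - zeta_sum w' n))%C by ring.
  eapply Rle_trans; [apply Cmod_triangle_minus|].
  eapply Rle_trans; [apply Rplus_le_compat_r, Cmod_triangle|].
  replace (16 / T) with (8 / T + 8 / T) by (field; lra). lra.
Qed.

Let c0 := (1 / 12) ^ 4.

Lemma L_ge_3 : 3 <= L.
Proof. unfold L. generalize ln_n_nonneg. lra. Qed.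

Lemma fourth_power_le u v : 0 <= v -> u ^ 4 <= v ^ 4 -> u <= v.
Proof.
  intros Hv H. apply Rnot_lt_le. intros Huv.
  assert (H2 : v ^ 2 < u ^ 2) by nra. assert (H3 : 0 <= v ^ 2) by apply pow2_ge_0. nra.
Qed.

(** The classical inequality loses [(x - 1) ^ (3/4)] against a logarithm, which
    is harmless at distance at least [c0 / L ^ 9] from the line. *)
Lemma zeta_lower_far x : x <= X -> 1 + c0 / L ^ 9 <= x ->
  2 * c0 <= Cmod (zeta (RtoC x + Ci * RtoC y)) * L ^ 7.
Proof.
  intros HxX Hx. assert (HL := L_ge_3).
  set (e := c0 / L ^ 9) in *.
  assert (HL9 : 1 <= L ^ 9) by (apply pow_R1_Rle; lra).
  assert (HL7 : 1 <= L ^ 7) by (apply pow_R1_Rle; lra).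
  assert (Hc0 : c0 = / 20736) by (unfold c0; field).
  assert (He : 0 < e <= 1).
  { unfold e. rewrite Hc0. split; [apply Rdiv_lt_0_compat; lra|]. apply Rdiv_le_of_mult; lra. }
  set (z := Cmod (zeta (RtoC x + Ci * RtoC y))).
  assert (Hz0 : 0 <= z) by apply Cmod_ge_0.
  assert (H341 := three_four_one x y ltac:(lra)). fold z in H341.
  assert (H1 := zeta_real_bound x ltac:(lra)).
  assert (H2 : 1 + / (x - 1) <= 2 / e).
  { assert (/ (x - 1) <= / e) by (apply Rinv_le_contravar; lra).
    assert (1 <= / e) by (rewrite <- Rinv_1; apply Rinv_le_contravar; lra).
    unfold Rdiv. lra. }
  assert (H3 := zeta_log_bound x 2 ltac:(lra) ltac:(lra)).
  set (u := Cmod (zeta (RtoC x))) in *. set (v := Cmod (zeta (RtoC x + Ci * RtoC (2 * y)))) in *.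
  assert (Hu0 : 0 <= u) by apply Cmod_ge_0. assert (Hv0 : 0 <= v) by apply Cmod_ge_0.
  assert (H4 : exp (-4) <= (2 / e) ^ 3 * z ^ 4 * L).
  { eapply Rle_trans; [exact H341|].
    assert (Hu3 : u ^ 3 <= (2 / e) ^ 3) by (apply pow_incr; lra).
    assert (Hz4 : 0 <= z ^ 4) by (apply pow_le; auto).
    assert (Hu3' : 0 <= u ^ 3) by (apply pow_le; auto).
    apply Rmult_le_compat; auto; [apply Rmult_le_pos; auto | apply Rmult_le_compat_r; auto]. }
  assert (H5 : / 81 <= exp (-4)).
  { replace (-4) with (- (4)) by ring. rewrite exp_Ropp. apply Rinv_le_contravar; [apply exp_pos|].
    replace 4 with (1 + 1 + (1 + 1)) by ring. rewrite !exp_plus. assert (H := exp_le_3). assert (H' := exp_pos 1).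
    assert (exp 1 * exp 1 <= 9) by nra. assert (0 <= exp 1 * exp 1) by nra. nra. }
  apply fourth_power_le; [apply Rmult_le_pos; lra|].
  assert (He3 : 0 < e ^ 3) by (apply pow_lt; lra).
  assert (H6 : e ^ 3 * / 81 <= 8 * z ^ 4 * L).
  { apply Rle_trans with (e ^ 3 * ((2 / e) ^ 3 * z ^ 4 * L)).
    - apply Rmult_le_compat_l; lra.
    - right. field. lra. }
  assert (H7 : L ^ 27 * (e ^ 3 * / 81) <= L ^ 27 * (8 * z ^ 4 * L)).
  { apply Rmult_le_compat_l; auto. apply pow_le; lra. }
  replace (L ^ 27 * (e ^ 3 * / 81)) with (c0 ^ 3 / 81) in H7 by (unfold e; field; lra).
  replace ((z * L ^ 7) ^ 4) with (L ^ 27 * (8 * z ^ 4 * L) / 8) by field.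
  rewrite Hc0 in *. lra.
Qed.

(** Closer to the line than [c0 / L ^ 9], the value is compared with the one at
    that distance.  The variation is at most [c0 / L ^ 7] up to [O(1 / |y|)],
    half the lower bound [2 c0 / L ^ 7] found there; [c0] is chosen so that this
    works. *)
Theorem zeta_lower_bound x : 1 < x -> x + 1 <= X -> 32 * L ^ 7 <= c0 * T ->
  c0 / 2 <= Cmod (zeta (RtoC x + Ci * RtoC y)) * L ^ 7.
Proof.
  intros Hx HxX HT7. assert (HL := L_ge_3).
  assert (HL9 : 1 <= L ^ 9) by (apply pow_R1_Rle; lra).
  assert (HL7 : 1 <= L ^ 7) by (apply pow_R1_Rle; lra).
  assert (Hc0 : c0 = / 20736) by (unfold c0; field).
  set (e := c0 / L ^ 9).
  assert (He : 0 < e <= 1).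
  { unfold e. rewrite Hc0. split; [apply Rdiv_lt_0_compat; lra|]. apply Rdiv_le_of_mult; lra. }
  assert (HTy : 7 <= T) by exact Hy.
  destruct (Rle_dec (1 + e) x) as [Hfar|Hnear].
  - assert (H := zeta_lower_far x ltac:(lra) Hfar). lra.
  - assert (Hf := zeta_lower_far (1 + e) ltac:(lra) (Rle_refl _)).
    assert (Hi := zeta_log_increment x (1 + e) ltac:(lra) ltac:(lra)).
    set (z := zeta (RtoC x + Ci * RtoC y)) in *.
    set (z' := zeta (RtoC (1 + e) + Ci * RtoC y)) in *.
    assert (Hr : Cmod z' - Cmod z <= e * L ^ 2 + 16 / T).
    { eapply Rle_trans; [apply Cmod_triangle_rev|]. rewrite Cmod_minus_sym.
      eapply Rle_trans; [exact Hi|]. apply Rplus_le_compat_r. apply Rmult_le_compat_r; [apply pow2_ge_0 | lra]. }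
    assert (H1 : (Cmod z' - Cmod z) * L ^ 7 <= (e * L ^ 2 + 16 / T) * L ^ 7).
    { apply Rmult_le_compat_r; lra. }
    replace ((e * L ^ 2 + 16 / T) * L ^ 7) with (c0 + 16 * L ^ 7 / T) in H1 by (unfold e; field; lra).
    assert (H2 : 16 * L ^ 7 / T <= c0 / 2) by (apply Rdiv_le_of_mult; lra).
    lra.
Qed.

End LogBounds.

(** * The continuation, and the comparison on its zeros *)

(** The alternating zeta-function: by [sine_sum_right] and [sine_sum_left] the
    limit exists for every [s]. *)
Definition eta (s : C) : C := Clim (fun m => sine_sum m s).

Lemma eta_right s : -1 < Re s -> eta s = right_limit s.
Proof.
  intros Hs. apply Clim_unique.
  apply (ucv_Ccv _ _ _ s (sine_sum_right (Cmod s) (Re s + 1) ltac:(lra))). lra.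
Qed.

Lemma eta_left a : 0 < Re a -> eta (- (2 * a)) = left_limit a.
Proof.
  intros Ha. apply Clim_unique.
  apply (ucv_Ccv _ _ _ a (sine_sum_left (Cmod a) (Re a) Ha)). lra.
Qed.

Lemma approx_rpow x p r : approx (fun s => rpow x (- s)) p r.
Proof.
  apply (approx_ext (fun s => Cexp (- RtoC (ln x) * s))%C).
  - intros z _. unfold rpow. f_equal. ring.
  - apply approx_Cexp.
Qed.

Lemma approx_sine_sum m p r : approx (sine_sum m) p r.
Proof.
  unfold sine_sum, alt_sum. apply approx_plus.
  - apply (approx_csum (fun k s => (- (1)) ^ k * rpow (hsin (S m) (INR (S k))) (- s))%C).
    intros k _. apply approx_scal, approx_rpow.
  - apply approx_scal, approx_rpow.
Qed.

Lemma eta_approx p : exists r, 0 < r /\ approx eta p r.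
Proof.
  assert (HRe : forall s, Cmod (s - p) <= 1/4 -> Re p - 1/4 <= Re s <= Re p + 1/4 /\ Cmod s <= Cmod p + 1).
  { intros s Hs. assert (H := re_le_Cmod (s - p)). unfold Cminus in H. rewrite re_plus, re_opp in H.
    assert (H' : Rabs (Re s + - Re p) <= 1/4) by (eapply Rle_trans; [exact H | exact Hs]).
    apply Rabs_le_between in H'. split; [lra|].
    generalize (Cmod_triangle_rev s p). lra. }
  exists (1/4). split; [lra|].
  apply (approx_ucv sine_sum); [intros; apply approx_sine_sum|].
  destruct (Rle_dec (- (1/2)) (Re p)) as [Hp|Hp].
  - apply (ucv_ext _ sine_sum _ right_limit); [exists 0%nat; auto| |].
    + intros s Hs. symmetry. apply eta_right. destruct (HRe s Hs). lra.
    + apply (ucv_mono (fun s => Cmod s <= Cmod p + 1 /\ -1 + 1/4 <= Re s));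
        [|apply sine_sum_right; lra].
      intros s Hs. destruct (HRe s Hs). lra.
  - intros e He.
    destruct (sine_sum_left (Cmod p + 1) (1/8) ltac:(lra) e He) as [N HN].
    exists N. intros n s Hn Hs. destruct (HRe s Hs) as [H1 H2].
    set (a := (- (RtoC (1/2)) * s)%C).
    assert (Ea : s = (- (2 * a))%C) by (unfold a; rewrite RtoC_div by lra; field).
    assert (HRa : Re a = - (1/2) * Re s) by (unfold a; rewrite <- RtoC_opp, re_scal_l; reflexivity).
    assert (HMa : Cmod a <= Cmod p + 1).
    { unfold a. rewrite Cmod_mult, Cmod_opp, Cmod_R, Rabs_pos_eq by lra.
      generalize (Cmod_ge_0 s). lra. }
    rewrite Ea. rewrite eta_left by lra. apply HN; auto. split; auto. lra.
Qed.

Lemma eta_double_approx p : exists r, 0 < r /\ approx (fun s => eta (2 * s)) p r.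
Proof.
  destruct (eta_approx (2 * p)) as (r & Hr & H). exists (r / 2). split; [lra|].
  apply approx_compose_scal. rewrite Cmod_R, Rabs_pos_eq by lra.
  apply (approx_mono _ _ r); auto. lra.
Qed.

Lemma eta_factor_approx p r : approx eta_factor p r.
Proof.
  apply approx_minus; [apply approx_const|]. apply approx_scal, approx_rpow.
Qed.

Lemma eta_factor_double_approx p r : approx (fun s => eta_factor (2 * s)) p r.
Proof. apply approx_compose_scal, eta_factor_approx. Qed.

(** Denominators are cleared so that everything but [Z] is entire. *)
Lemma zeta2_diag_eta (Z : C -> C) (p : C) : is_zeta2_diag Z -> analytic_at Z p ->
  (Z p * (2 * eta_factor p ^ 2 * eta_factor (2 * p))
   = eta p ^ 2 * eta_factor (2 * p) - eta (2 * p) * eta_factor p ^ 2)%C.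
Proof.
  intros [Hm Hz]. revert p.
  apply (identity_theorem Z
    (fun s => eta s ^ 2 * eta_factor (2 * s) - eta (2 * s) * eta_factor s ^ 2)%C
    (fun s => 2 * eta_factor s ^ 2 * eta_factor (2 * s))%C Hm) with (c := 1).
  - intros p. destruct (eta_approx p) as (r1 & Hr1 & H1). destruct (eta_double_approx p) as (r2 & Hr2 & H2).
    exists (Rmin r1 r2). split; [apply Rmin_pos; auto|].
    apply approx_minus; apply approx_mult.
    + apply approx_pow. apply approx_mono with r1; auto. apply Rmin_l.
    + apply eta_factor_double_approx.
    + apply approx_mono with r2; auto. apply Rmin_r.
    + apply approx_pow, eta_factor_approx.
  - intros p. exists 1. split; [lra|].
    apply approx_mult; [apply approx_mult; [apply approx_const | apply approx_pow, eta_factor_approx]|].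
    apply eta_factor_double_approx.
  - intros s Hs. cbv beta.
    assert (H2s : 1 < Re (2 * s)%C) by (rewrite re_scal_l; lra).
    rewrite !eta_right by lra. rewrite !right_limit_eta by auto.
    assert (H : is_zeta2_series s s (Z s)) by (apply Hz; [rewrite re_plus; lra | auto]).
    assert (E := zeta2_diagonal s (Z s) Hs H).
    replace (Z s * (2 * eta_factor s ^ 2 * eta_factor (2 * s)))%C
      with (eta_factor s ^ 2 * eta_factor (2 * s) * (2 * Z s))%C by ring.
    rewrite E. ring.
Qed.

Lemma log_power_negligible (B : R) (K : nat) :
  exists T0, 1 <= T0 /\ forall T, T0 <= T -> B * (3 + 3 * ln T) ^ K < T.
Proof.
  assert (HK := INR_S_pos K).
  set (M := Rabs B * 6 ^ K * INR (S K) ^ S K).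
  assert (HM : 0 <= M).
  { unfold M. apply Rmult_le_pos; [apply Rmult_le_pos; [apply Rabs_pos|]|]; apply pow_le; lra. }
  exists (exp (M + 1)). split.
  - generalize (exp_ineq1_le (M + 1)). lra.
  - intros T HT. assert (HT0 : 0 < T) by (generalize (exp_pos (M + 1)); lra).
    set (x := ln T).
    assert (Hx : M + 1 <= x).
    { unfold x. rewrite <- (ln_exp (M + 1)).
      apply ln_le; auto. apply exp_pos. }
    assert (HTx : (x / INR (S K)) ^ S K <= T).
    { replace T with (exp (x / INR (S K)) ^ S K).
      - apply pow_incr. split; [apply Rdiv_le_0_compat; lra|].
        generalize (exp_ineq1_le (x / INR (S K))). lra.
      - rewrite <- Rpower_pow by apply exp_pos. unfold Rpower. rewrite ln_exp.
        replace (INR (S K) * (x / INR (S K))) with x by (field; lra). unfold x. apply exp_ln; auto. }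
    eapply Rlt_le_trans; [|exact HTx].
    assert (Hpow : 0 < x ^ K) by (apply pow_lt; lra).
    apply Rle_lt_trans with (Rabs B * (6 ^ K * x ^ K)).
    + rewrite <- Rpow_mult_distr.
      assert (H1 : (3 + 3 * x) ^ K <= (6 * x) ^ K) by (apply pow_incr; lra).
      assert (H2 : 0 <= (3 + 3 * x) ^ K) by (apply pow_le; lra).
      assert (H3 := Rle_abs B). assert (H4 := Rabs_pos B).
      apply Rle_trans with (Rabs B * (3 + 3 * x) ^ K); [apply Rmult_le_compat_r; auto | apply Rmult_le_compat_l; auto].
    + unfold Rdiv. rewrite Rpow_mult_distr, pow_inv.
      assert (HKp : 0 < INR (S K) ^ S K) by (apply pow_lt; auto).
      apply Rmult_lt_reg_r with (INR (S K) ^ S K); auto.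
      replace (x ^ S K * / INR (S K) ^ S K * INR (S K) ^ S K) with (x * x ^ K) by (simpl (x ^ S K); field; lra).
      replace (Rabs B * (6 ^ K * x ^ K) * INR (S K) ^ S K) with (M * x ^ K) by (unfold M; ring).
      apply Rmult_lt_compat_r; auto. lra.
Qed.

Lemma Re_pair (x y : R) : Re (x, y) = x. Proof. reflexivity. Qed.

Lemma euler_factor_2_bounds w : 1 < Re w ->
  1 / 2 <= Cmod (1 - power_fun w 2) <= 3 / 2.
Proof.
  intros Hw.
  assert (H : Cmod (power_fun w 2) <= 1 / 2).
  { assert (H := power_fun_le_inv w 1 ltac:(lra)). simpl (INR 2) in H. lra. }
  split.
  - assert (H1 := Cmod_triangle_rev 1 (power_fun w 2)). rewrite Cmod_1 in H1. lra.
  - eapply Rle_trans; [apply Cmod_triangle_minus|]. rewrite Cmod_1. lra.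
Qed.

(** The powers of [2 / pi] on the two sides cancel, and [gamma_factor_ratio]
    removes the gamma factors. *)
Lemma zero_balance (a : C) (A : nat) : 0 < Re a -> Re a <= INR A -> INR A + 1 <= Im a ^ 2 ->
  (eta (- (2 * a)) ^ 2 * eta_factor (2 * (- (2 * a)))
     = eta (2 * (- (2 * a))) * eta_factor (- (2 * a)) ^ 2)%C ->
  4 * ratio_const A * Cmod a * Cmod (odd_zeta (2 * a + 1)) ^ 4 * Cmod (eta_factor (2 * (- (2 * a)))) ^ 2
    <= Cmod (odd_zeta (2 * (2 * a) + 1)) ^ 2 * Cmod (eta_factor (- (2 * a))) ^ 4.
Proof.
  intros Ha HA HI E.
  assert (HA0 := pos_INR A).
  assert (Hi : Im a <> 0) by (intro E0; rewrite E0 in HI; simpl in HI; lra).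
  assert (H2a : 0 < Re (2 * a)%C) by (rewrite re_scal_l; lra).
  assert (Hi2 : Im (2 * a)%C <> 0) by (rewrite im_scal_l; lra).
  assert (HR := gamma_factor_ratio A a Ha HA HI).
  assert (HG2 := proj1 (Cmod_gt_0 _) (gamma_factor_neq_0 (2 * a) H2a Hi2)).
  replace (2 * (- (2 * a)))%C with (- (2 * (2 * a)))%C in * by ring.
  rewrite !eta_left in E by auto. unfold left_limit in E.
  set (q1 := eta_factor (- (2 * a))) in *. set (q2 := eta_factor (- (2 * (2 * a)))) in *.
  set (l1 := odd_zeta (2 * a + 1)) in *. set (l2 := odd_zeta (2 * (2 * a) + 1)) in *.
  set (g := gamma_factor a) in *. set (g2 := gamma_factor (2 * a)) in *.
  set (rho := rpow (2 / PI) (2 * a)) in *.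
  assert (Hrho : rho <> 0%C) by apply rpow_neq_0.
  replace (rpow (2 / PI) (2 * (2 * a))) with (rho ^ 2)%C in E.
  2:{ unfold rho. simpl. rewrite Cmult_1_r, <- rpow_plus. f_equal. ring. }
  assert (E1 : (2 * (g ^ 2 * l1 ^ 2 * q2) = - (g2 * l2 * q1 ^ 2))%C).
  { transitivity ((- (2) * rho * g * l1) ^ 2 * q2 / (2 * rho ^ 2))%C.
    - field. auto.
    - rewrite E. field. auto. }
  assert (E2 : 2 * (Cmod g ^ 2 * Cmod l1 ^ 2 * Cmod q2) = Cmod g2 * Cmod l2 * Cmod q1 ^ 2).
  { assert (E2 := f_equal Cmod E1). rewrite Cmod_opp, !Cmod_mult, !Cmod_pow, Cmod_R, Rabs_pos_eq in E2 by lra.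
    exact E2. }
  assert (E3 : 4 * Cmod g ^ 4 * (Cmod l1 ^ 4 * Cmod q2 ^ 2) = Cmod g2 ^ 2 * (Cmod l2 ^ 2 * Cmod q1 ^ 4)).
  { transitivity ((2 * (Cmod g ^ 2 * Cmod l1 ^ 2 * Cmod q2)) ^ 2); [ring|]. rewrite E2. ring. }
  apply Rmult_le_reg_l with (Cmod g2 ^ 2); [apply pow_lt; auto|].
  rewrite <- E3.
  replace (Cmod g2 ^ 2 * (4 * ratio_const A * Cmod a * Cmod l1 ^ 4 * Cmod q2 ^ 2))
    with (4 * (ratio_const A * Cmod a * Cmod g2 ^ 2) * (Cmod l1 ^ 4 * Cmod q2 ^ 2)) by ring.
  apply Rmult_le_compat_r; [|lra].
  apply Rmult_le_pos; apply pow_le, Cmod_ge_0.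
Qed.

Theorem theorem5 :
  forall Z : C -> C, is_zeta2_diag Z ->
  forall sigma1 : R, (sigma1 < 0)%R ->
  exists t0 : R, (0 < t0)%R /\
    forall sigma t : R,
      (sigma1 <= sigma < 0)%R -> (t0 <= Rabs t)%R ->
      ~ is_zero_of Z (sigma, t).
Proof.
  intros Z HZ sigma1 Hs1.
  destruct (INR_unbounded (- sigma1)) as [A HA].
  assert (HA0 := pos_INR A).
  set (X := 2 - 2 * sigma1).
  set (c0 := (1 / 12) ^ 4).
  assert (Hc0 : 0 < c0) by (unfold c0; lra).
  set (Q := 1 + 2 * Rpower 2 (- sigma1)).
  assert (HQ : 1 < Q) by (unfold Q; generalize (Rpower_pos 2 (- sigma1)); lra).
  assert (Hrc := ratio_const_pos A). set (rc := ratio_const A) in *.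
  (* [B] collects the constants of all estimates; a zero would force
     [|t| <= B * L ^ 30] with [L] of order [ln |t|]. *)
  set (B := 512 * Q ^ 4 / (rc * c0 ^ 4)).
  destruct (log_power_negligible (32 / c0) 7) as (T1 & HT1 & HB1).
  destruct (log_power_negligible B 30) as (T2 & HT2 & HB2).
  set (t0 := T1 + T2 + X + 7 + 2 * (INR A + 1)).
  assert (HX : 2 <= X) by (unfold X; lra).
  exists t0. split; [unfold t0; lra|].
  intros sigma t Hsig Ht [Han Hz0].
  set (T := Rabs t) in *.
  assert (HTbig : 7 <= T /\ X <= T /\ T1 <= T /\ T2 <= T /\ 2 * (INR A + 1) <= T) by (unfold t0 in Ht; lra).
  destruct HTbig as (HT7 & HTX & HTT1 & HTT2 & HTA).
  assert (HTt : T ^ 2 = t ^ 2) by (unfold T; apply pow2_abs).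
  destruct (nfloor_ex (t ^ 2) (pow2_ge_0 t)) as [n0 Hn0].
  set (n := S n0).
  assert (Hn : t ^ 2 <= INR n <= t ^ 2 + 1) by (unfold n; rewrite S_INR; lra).
  set (L := 3 + ln (INR n)).
  assert (HnT : INR n <= T ^ 3) by nra.
  assert (Hn1 : 1 <= INR n) by nra.
  assert (HLn : ln (INR n) <= 3 * ln T).
  { assert (E : ln (T ^ 3) = 3 * ln T) by (rewrite ln_pow by lra; simpl; ring).
    rewrite <- E. apply ln_le; lra. }
  assert (HL3 : 3 <= L <= 3 + 3 * ln T).
  { split; [|unfold L; lra]. unfold L.
    generalize (ln_nonneg _ Hn1). lra. }
  assert (HL7 : 32 * L ^ 7 <= c0 * T).
  { specialize (HB1 T HTT1).
    assert (Hp : L ^ 7 <= (3 + 3 * ln T) ^ 7) by (apply pow_incr; lra).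
    assert (H : 32 / c0 * L ^ 7 <= T).
    { left. eapply Rle_lt_trans; [|exact HB1]. apply Rmult_le_compat_l; [|exact Hp].
      apply Rdiv_le_0_compat; lra. }
    replace (32 * L ^ 7) with (c0 * (32 / c0 * L ^ 7)) by (field; lra). apply Rmult_le_compat_l; lra. }
  assert (HL30 : B * L ^ 30 < T).
  { specialize (HB2 T HTT2).
    assert (Hp : L ^ 30 <= (3 + 3 * ln T) ^ 30) by (apply pow_incr; lra).
    eapply Rle_lt_trans; [|exact HB2]. apply Rmult_le_compat_l; [|exact Hp].
    unfold B. apply Rdiv_le_0_compat; [apply Rmult_le_pos; [lra | apply pow_le; lra]|].
    apply Rmult_lt_0_compat; auto. apply pow_lt; auto. }
  set (a := (- sigma / 2, - t / 2) : C).
  assert (Es : (sigma, t) = (- (2 * a))%C) by (apply C_ext; simpl; field).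
  assert (HRa : Re a = - sigma / 2) by reflexivity.
  assert (HIa : Im a = - t / 2) by reflexivity.
  assert (HIa2 : INR A + 1 <= Im a ^ 2) by (rewrite HIa; nra).
  assert (Hbal := zero_balance a A ltac:(lra) ltac:(lra) HIa2).
  rewrite <- Es in Hbal.
  assert (E := zeta2_diag_eta Z (sigma, t) HZ Han). rewrite Hz0, Cmult_0_l in E.
  symmetry in E. apply Ceq_minus in E.
  specialize (Hbal E). fold rc in Hbal.
  (* With [s = - 2 a], zeta is taken at [1 - s] and at [1 - 2 s]. *)
  assert (Ew1 : (2 * a + 1 = RtoC (1 - sigma) + Ci * RtoC (- t))%C) by (apply C_ext; simpl; field).
  assert (Ew2 : (2 * (2 * a) + 1 = RtoC (1 - 2 * sigma) + Ci * RtoC (2 * - t))%C) by (apply C_ext; simpl; field).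
  assert (HRw1 : 1 < Re (2 * a + 1)%C) by (rewrite Ew1, Re_vertical; lra).
  assert (HRw2 : 1 < Re (2 * (2 * a) + 1)%C) by (rewrite Ew2, Re_vertical; lra).
  rewrite !odd_zeta_eq in Hbal by auto. rewrite !Cmod_mult in Hbal.
  destruct (euler_factor_2_bounds _ HRw1) as [F1 _]. destruct (euler_factor_2_bounds _ HRw2) as [_ F2].
  set (f1 := Cmod (1 - power_fun (2 * a + 1) 2)) in *.
  set (f2 := Cmod (1 - power_fun (2 * (2 * a) + 1) 2)) in *.
  assert (HTm : Rabs (- t) = T) by apply Rabs_Ropp.
  assert (Hnt : (- t) ^ 2 <= INR n) by (replace ((- t) ^ 2) with (t ^ 2) by ring; lra).
  assert (Hz1 : c0 / 2 <= Cmod (zeta (2 * a + 1)) * L ^ 7).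
  { rewrite Ew1. apply (zeta_lower_bound X (- t) n);
      [lra | rewrite HTm; lra | rewrite HTm; lra | exact Hnt | lra | unfold X; lra | rewrite HTm; exact HL7]. }
  assert (Hz2 : Cmod (zeta (2 * (2 * a) + 1)) <= L).
  { rewrite Ew2. apply (zeta_log_bound X (- t) n);
      [lra | rewrite HTm; lra | rewrite HTm; lra | exact Hnt | unfold X; lra | lra]. }
  set (z1 := Cmod (zeta (2 * a + 1))) in *. set (z2 := Cmod (zeta (2 * (2 * a) + 1))) in *.
  assert (Hz20 : 0 <= z2) by apply Cmod_ge_0.
  assert (HQ1 : Cmod (eta_factor (sigma, t)) <= Q).
  { unfold eta_factor. eapply Rle_trans; [apply Cmod_triangle_minus|].
    rewrite Cmod_1, Cmod_mult, Cmod_R, Rabs_pos_eq, Cmod_power_fun by lra. simpl Re. simpl (INR 2).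
    unfold Q. assert (Rpower 2 (- sigma) <= Rpower 2 (- sigma1)) by (apply Rle_Rpower; lra).
    replace (1 + 1) with 2 by ring. lra. }
  assert (HQ2 : 1 <= Cmod (eta_factor (2 * (sigma, t)))).
  { unfold eta_factor. rewrite Cmod_minus_sym.
    eapply Rle_trans; [|apply Cmod_triangle_rev].
    rewrite Cmod_1, Cmod_mult, Cmod_R, Rabs_pos_eq, Cmod_power_fun by lra.
    rewrite re_scal_l, Re_pair. simpl (INR 2).
    assert (H1 : 1 <= Rpower (1 + 1) (- (2 * sigma))).
    { apply Rle_trans with (Rpower (1 + 1) 0); [rewrite Rpower_O; lra|]. apply Rle_Rpower; lra. }
    lra. }
  set (q1 := Cmod (eta_factor (sigma, t))) in *. set (q2 := Cmod (eta_factor (2 * (sigma, t)))) in *.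
  assert (Hq10 : 0 <= q1) by apply Cmod_ge_0.
  assert (Ha0 : T / 2 <= Cmod a).
  { eapply Rle_trans; [|apply im_le_Cmod]. rewrite HIa. unfold Rdiv.
    rewrite Rabs_mult, Rabs_Ropp, (Rabs_pos_eq (/ 2)) by lra. fold T. lra. }
  assert (HLp : 0 < L ^ 7) by (apply pow_lt; lra).
  assert (Hl1 : c0 / 4 <= f1 * z1 * L ^ 7).
  { assert (0 <= z1 * L ^ 7) by lra. rewrite Rmult_assoc. nra. }
  assert (Hlow : (c0 / 4) ^ 4 <= (f1 * z1) ^ 4 * L ^ 28).
  { replace ((f1 * z1) ^ 4 * L ^ 28) with ((f1 * z1 * L ^ 7) ^ 4) by ring.
    apply pow_incr. split; [lra|exact Hl1]. }
  assert (Hup : (f2 * z2) ^ 2 * q1 ^ 4 <= (2 * L) ^ 2 * Q ^ 4).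
  { assert (0 <= f2) by apply Cmod_ge_0.
    apply Rmult_le_compat; try (apply pow_le; auto; apply Rmult_le_pos; auto).
    - apply pow_incr. split; [apply Rmult_le_pos; auto|]. apply Rmult_le_compat; lra.
    - apply pow_incr. lra. }
  assert (Hmid : 2 * rc * T * (f1 * z1) ^ 4 <= (2 * L) ^ 2 * Q ^ 4).
  { eapply Rle_trans; [|exact Hup]. eapply Rle_trans; [|exact Hbal].
    assert (H4 : 0 <= (f1 * z1) ^ 4).
    { replace ((f1 * z1) ^ 4) with (((f1 * z1) ^ 2) ^ 2) by ring. apply pow2_ge_0. }
    assert (Hq2 : 1 <= q2 ^ 2) by (apply pow_R1_Rle; auto).
    assert (H5 : 2 * rc * T <= 4 * rc * Cmod a) by nra.
    apply Rle_trans with (4 * rc * Cmod a * (f1 * z1) ^ 4 * 1).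
    - rewrite Rmult_1_r. apply Rmult_le_compat_r; auto.
    - apply Rmult_le_compat_l; auto. apply Rmult_le_pos; auto.
      assert (0 <= Cmod a) by apply Cmod_ge_0. nra. }
  assert (Hfin : 2 * rc * T * (c0 / 4) ^ 4 <= 4 * Q ^ 4 * L ^ 30).
  { apply Rle_trans with (2 * rc * T * ((f1 * z1) ^ 4 * L ^ 28)).
    - apply Rmult_le_compat_l; [nra | exact Hlow].
    - replace (2 * rc * T * ((f1 * z1) ^ 4 * L ^ 28)) with (2 * rc * T * (f1 * z1) ^ 4 * L ^ 28) by ring.
      replace (4 * Q ^ 4 * L ^ 30) with ((2 * L) ^ 2 * Q ^ 4 * L ^ 28) by ring.
      apply Rmult_le_compat_r; auto. apply pow_le; lra. }
  assert (Hcontra : T <= B * L ^ 30).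
  { assert (Hd : 0 < 2 * rc * (c0 / 4) ^ 4).
    { apply Rmult_lt_0_compat; [lra | apply pow_lt; lra]. }
    apply Rmult_le_reg_l with (2 * rc * (c0 / 4) ^ 4); auto.
    replace (2 * rc * (c0 / 4) ^ 4 * (B * L ^ 30)) with (4 * Q ^ 4 * L ^ 30) by (unfold B; field; lra).
    lra. }
  lra.
Qed.
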